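(* Let $n\ge2$, $0\le l<k\le n-1$, $\theta\in(0,\frac{\pi}{2})$ and $p\ge1$. Let $f$ be a positive smooth function on $\mathcal{C}_\theta$ satisfying $$\nabla^2 f^{-\frac{1}{p+k-l-1}}+f^{-\frac{1}{p+k-l-1}}\sigma\ge 0\ \text{ in }\mathcal{C}_\theta,\qquad \nabla_\mu f+\cot\theta\,(p+k-l-1)f\ge 0\ \text{ on }\partial\mathcal{C}_\theta.$$ Let $h\in C^4(\mathcal{C}_\theta)$ be a positive admissible solution of $$\frac{\sigma_k(\nabla^2h+h\sigma)}{\sigma_l(\nabla^2h+h\sigma)}=f\,h^{p-1}\ \text{ in }\mathcal{C}_\theta,\qquad \nabla_\mu h=\cot\theta\, h\ \text{ on }\partial\mathcal{C}_\theta,$$ such that $W=\nabla^2h+h\sigma$ is positive semi-definite on $\mathcal{C}_\theta$. Then $W$ is positive definite on $\mathcal{C}_\theta$, i.e. $h$ is strictly convex.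
   Context: Let $e=-E_{n+1}$, $E_1,\dots,E_{n+1}$ the standard basis of $\mathbb{R}^{n+1}$, $\overline{\mathbb{R}^{n+1}_+}=\{x_{n+1}\ge0\}$. $\mathcal{C}_\theta=\{\xi\in\overline{\mathbb{R}^{n+1}_+}:|\xi-\cos\theta\,e|=1\}$ with round metric $\sigma$, connection $\nabla$, unit outward conormal $\mu$ of $\partial\mathcal{C}_\theta$. $\sigma_j(W)$ is the $j$-th elementary symmetric function of the eigenvalues of $W$ ($\sigma_0=1$); $\Gamma_k=\{\lambda\in\mathbb{R}^n:\sigma_i(\lambda)>0,1\le i\le k\}$; $h$ is admissible if the eigenvalues of $W=\nabla^2h+h\sigma$ lie in $\Gamma_k$ everywhere. *)

(* Defs.v *)
From HB Require Import structures.
From mathcomp Require Import all_boot all_order all_algebra.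
From mathcomp Require Import all_classical all_reals all_analysis.
Set Implicit Arguments. Unset Strict Implicit. Unset Printing Implicit Defensive.
Import Order.TTheory GRing.Theory Num.Theory.
Import numFieldNormedType.Exports.
Local Open Scope classical_set_scope.
Local Open Scope ring_scope.

Section Defs.
Variables (R : realType) (n : nat).
Local Notation V := 'rV[R]_(n.+1).

Definition dot (u v : V) : R := \sum_(i < n.+1) u ord0 i * v ord0 i.

Definition Elast : V := \row_(i < n.+1) (if i == ord_max then 1 else 0).

Definition capc (theta : R) : V := - (cos theta *: Elast).

Definition cap (theta : R) : set V :=
  [set xi : V | 0 <= xi ord0 ord_max /\ dot (xi - capc theta) (xi - capc theta) = 1].

Definition bcap (theta : R) : set V :=
  [set xi : V | cap theta xi /\ xi ord0 ord_max = 0].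

Definition nu (theta : R) (xi : V) : V := xi - capc theta.

Definition tangent (theta : R) (xi X : V) : Prop := dot X (nu theta xi) = 0.

(* unit outward conormal of bd C_theta in C_theta at xi in bd C_theta:
   the normalized tangential projection of -E_{n+1},
   mu = (cos theta * nu - E_{n+1}) / sin theta *)
Definition mu (theta : R) (xi : V) : V :=
  (sin theta)^-1 *: (cos theta *: nu theta xi - Elast).

Fixpoint Ck (k : nat) (U : set V) (F : V -> R) : Prop :=
  match k with
  | 0 => {within U, continuous F}
  | k'.+1 => (forall x, U x -> differentiable F x) /\
             (forall v : V, Ck k' U ('D_v F))
  end.

Definition smooth_on (U : set V) (F : V -> R) : Prop := forall k, Ck k U F.

(* the tensor  nabla^2 h + h sigma  at xi, evaluated on tangent vectors X Y,
   where H is any extension of h to a neighbourhood of the cap: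
   nabla^2 h (X,Y) = D^2 H (X,Y) - <DH, nu> <X,Y>  on the unit sphere *)
Definition Wform (theta : R) (H : V -> R) (xi X Y : V) : R :=
  'D_X ('D_Y H) xi - 'D_(nu theta xi) H xi * dot X Y + H xi * dot X Y.

Definition orthoframe (theta : R) (xi : V) (E : 'I_n -> V) : Prop :=
  (forall i, tangent theta xi (E i)) /\
  (forall i j, dot (E i) (E j) = if i == j then 1 else 0).

Definition eigs (theta : R) (Wf : V -> V -> R) (xi : V) (lam : 'I_n -> R) : Prop :=
  exists E : 'I_n -> V, orthoframe theta xi E /\
    char_poly (\matrix_(i < n, j < n) Wf (E i) (E j)) =
      \prod_(i < n) ('X - (lam i)%:P).

Definition sigma (j : nat) (lam : 'I_n -> R) : R :=
  \sum_(I : {set 'I_n} | #|I| == j) \prod_(i in I) lam i.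

Definition Gamma (k : nat) (lam : 'I_n -> R) : Prop :=
  forall i : nat, (1 <= i <= k)%N -> 0 < sigma i lam.

End Defs.

(* Main.v *)
(* The height function extends to the 1-homogeneous function
   h(x) = |x| H(x/|x| + c) on a cone of R^(n+1); then W is the Hessian D^2 h on the
   orthogonal complement of the unit vector x, the equation reads
   ln e_k(D^2 h) - ln e_l(D^2 h) = - q ln u + (p - 1) ln h  with
   u = f^(-1/(p+k-l-1)) extended in the same way and q = p + k - l - 1,
   u is convex, and the boundary conditions become D_E h = 0 <= D_E u.
   At the minimum point x* of h on the cap, which is interior, D^2 h >= min h.
   If W degenerated somewhere, minimize D^2h(x)(e,e) - eps exp(alpha <x,x*>) over
   unit tangent vectors (x,e).  At a minimizer the first and second order conditions
   along great circles, with e tilted in an optimal way, are inserted in the twice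
   differentiated equation.  Log-concavity of (e_k/e_l)^(1/(k-l)) along matrix lines, obtained
   by differentiating the log-concave sequence of elementary symmetric functions, absorbs
   the quadratic terms, and a large alpha gives a contradiction.  At a boundary minimizer the
   conormal derivatives of the equation and of D_E h = 0 do the same. *)
Require Import Defs.
From HB Require Import structures.
From mathcomp Require Import all_boot all_order all_algebra all_fingroup.
From mathcomp Require Import ring lra zify.
Set Implicit Arguments. Unset Strict Implicit. Unset Printing Implicit Defensive.
Import Order.TTheory GRing.Theory Num.Theory.
Local Open Scope ring_scope.

(** * Elementary symmetric functions *)

(** Degeneracy is the obstacle: [W] may have zero eigenvalues at the contact point. Concavity
    therefore enters through the inverse variables: [e_m / e_(m+1)] at [a_i / b_i] is concave in
    [b], and the path [a_i / (1 - t x_i)] keeps zero eigenvalues at zero. It treats only the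
    diagonal third derivatives [H_ii]; the off-diagonal ones are handled pair by pair. Both consume
    the term [2 sum_j H_ij^2 / a_j] that the optimal tilt produces; if [a_j = 0] the tilt is free
    and forces [H_ij = 0]. The tilt cannot use the radial or the contact direction, but third
    derivatives there are at most [phi (1 + alpha)], with [phi] the weight. So every error is
    proportional to [phi], which divides out, and [alpha^2] has to beat terms linear in [alpha]
    whose constants do not depend on [alpha]. This needs the contact point to stay away from [x*],
    where the weight is critical on the sphere: the weight is kept below half the minimum of [h],
    while at [x*] all tangential eigenvalues are at least that minimum. *)

Section LogConcavity.
Variable R : realFieldType.
Implicit Types (Q : {poly R}) (x : R).

Definition gap Q (i j r : nat) : R := Q`_(i + r) * Q`_j - Q`_i * Q`_(j + r).

(** All two-by-two Toeplitz minors of the coefficients are required, not only those of neighbouring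
    indices. This form needs no division and stays usable when coefficients vanish, as they do for
    zero eigenvalues. *)
Definition log_concave Q : Prop :=
  (forall i, 0 <= Q`_i) /\ (forall i j r, (i <= j)%N -> 0 <= gap Q i j r).

Lemma coef_linM x Q i : ((1 + x *: 'X) * Q)`_i = Q`_i + x * ('X * Q)`_i.
Proof. by rewrite mulrDl mul1r coefD -scalerAl coefZ. Qed.

Lemma coef_XlinM x Q i :
  ('X * ((1 + x *: 'X) * Q))`_i = ('X * Q)`_i + x * ('X * ('X * Q))`_i.
Proof. by rewrite mulrCA coef_linM. Qed.

Lemma log_concave1 : log_concave 1.
Proof.
split=> [i|i j r ij]; first by rewrite coef1 ler0n.
rewrite /gap !coef1; case: i ij => [|i] ij; last by rewrite addSn /= !mul0r subrr.
by case: j ij => [|j] ij; case: r; rewrite /= ?mulr0 ?mulr1 ?mul1r subrr.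
Qed.

Lemma log_concaveX Q : log_concave Q -> log_concave ('X * Q).
Proof.
move=> [Q0 QC]; split=> [i|[|i] [|j] r //= ij]; rewrite /gap ?coefXM.
- by case: i => //= i; exact: Q0.
- by rewrite !add0n mulrC subrr.
- by rewrite eqxx mul0r subr0 /= mulr_ge0 //; case: ifP.
- by rewrite !addSn /=; exact: QC.
Qed.

(* The coefficient of [x] in the gap of [(1 + x X) Q] is a sum of two gaps of
   [Q], with spans [r + 1] and [r - 1]. *)
Lemma gap_linM x Q i j r : 0 <= x -> log_concave Q -> (i <= j)%N ->
  gap Q i j r <= gap ((1 + x *: 'X) * Q) i j r.
Proof.
move=> x0 QL ij; have [Q0 QC] := QL; have [_ QX] := log_concaveX QL.
case: r => [|r]; first by rewrite /gap !addn0 !subrr.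
rewrite /gap !coef_linM.
have H2 : 0 <= gap ('X * Q) i j r.+1 by exact: QX.
have H1 : 0 <= Q`_(i + r.+1) * ('X * Q)`_j - ('X * Q)`_i * Q`_(j + r.+1).
  rewrite !coefXM; case: i ij {H2} => [|i] ij.
    by rewrite eqxx mul0r subr0 mulr_ge0 //; case: ifP.
  case: j ij => [|j] //= ij; have := QC i j r.+2 ij.
  by rewrite /gap !addSnnS.
have H3 : 0 <= ('X * Q)`_(i + r.+1) * Q`_j - Q`_i * ('X * Q)`_(j + r.+1).
  by rewrite !coefXM !addnS /=; exact: QC.
rewrite /gap in H2.
have := mulr_ge0 x0 H1; have := mulr_ge0 x0 H3; have := mulr_ge0 (mulr_ge0 x0 x0) H2.
move: (Q`_ _) (Q`_ _) (Q`_ _) (Q`_ _) (('X * Q)`_ _) (('X * Q)`_ _) (('X * Q)`_ _) (('X * Q)`_ _) => a b c d e f g h.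
lra.
Qed.

Lemma log_concave_linM x Q : 0 <= x -> log_concave Q ->
  log_concave ((1 + x *: 'X) * Q).
Proof.
move=> x0 QL; have [Q0 QC] := QL; split=> [i|i j r ij].
  by rewrite coef_linM addr_ge0 ?mulr_ge0 //; apply (log_concaveX QL).1.
exact: le_trans (QC i j r ij) (gap_linM _ x0 QL ij).
Qed.

End LogConcavity.

Section GeneratingPolynomial.
Variables (R : realFieldType) (I : finType).
Implicit Types (l a : I -> R) (A : {set I}).

(** The coefficients are the elementary symmetric functions. Removing [i] and multiplying by ['X]
    gives the partial derivative in [l i]: the shift lowers the order by one and yields zero at
    order 0, with no truncated subtraction. *)
Definition gen l A : {poly R} := \prod_(i in A) (1 + l i *: 'X).

Lemma genD1 l A i : i \in A -> gen l A = (1 + l i *: 'X) * gen l (A :\ i).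
Proof. by move=> iA; rewrite /gen (big_setD1 i). Qed.

Lemma gen_log_concave l A : (forall i, 0 <= l i) -> log_concave (gen l A).
Proof.
move=> l0; rewrite /gen; elim/big_rec: _ => [|i Q iA QL]; first exact: log_concave1.
exact: log_concave_linM.
Qed.

Lemma coef_gen_ge0 l A m : (forall i, 0 <= l i) -> 0 <= (gen l A)`_m.
Proof. by move=> l0; exact: (gen_log_concave A l0).1. Qed.

Lemma coef_genX_ge0 l A m : (forall i, 0 <= l i) -> 0 <= ('X * gen l A)`_m.
Proof. by move=> l0; exact: (log_concaveX (gen_log_concave A l0)).1. Qed.

Lemma deriv_gen l A : 'X * (gen l A)^`() = \sum_(i in A) l i *: ('X * gen l (A :\ i)).
Proof.
have [n] := ubnP #|A|; elim: n A => // n IH A; rewrite ltnS => An.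
have [->|[i iA]] := set_0Vmem A; first by rewrite /gen !big_set0 derivC mulr0.
have cA : (#|A :\ i| < n)%N by move: An; rewrite (cardsD1 i) iA.
rewrite (genD1 l iA) derivM mulrDr (big_setD1 i iA) /=; congr (_ + _).
  by rewrite derivD derivC add0r derivZ derivX -scalerAl mul1r -scalerAr.
rewrite mulrCA IH // mulr_sumr; apply: eq_bigr => j; rewrite inE => /andP[ji jA].
rewrite -scalerAr mulrCA (@genD1 l (A :\ j) i) ; last first.
  by move: ji; rewrite !inE eq_sym => ->.
by rewrite !setDDl (setUC [set j]).
Qed.

(** Euler's relation for a homogeneous function of degree [m]. *)
Lemma sum_coef_gen l A m : \sum_(i in A) l i * ('X * gen l (A :\ i))`_m = m%:R * (gen l A)`_m.
Proof.
have := congr1 (fun P : {poly R} => P`_m) (deriv_gen l A).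
rewrite coefXM coef_deriv coef_sum; under eq_bigr do rewrite coefZ.
by move=> <-; case: m => [|m] /=; rewrite ?mul0r // mulr_natl.
Qed.

End GeneratingPolynomial.

Section Newton.
Variables (R : realFieldType).

Lemma log_concave_cross (Q : {poly R}) l k : log_concave Q -> (l <= k)%N ->
  0 <= ('X * Q)`_k * Q`_l - ('X * Q)`_l * Q`_k.
Proof.
move=> [Q0 QC]; rewrite !coefXM; case: l => [|l]; case: k => [|k] //= lk.
- by rewrite mul0r subrr.
- by rewrite mul0r subr0 mulr_ge0.
- by have := QC l k 1 lk; rewrite /gap !addn1 mulrC.
Qed.

Lemma log_concave_cross2 (Q : {poly R}) l k : log_concave Q -> (l <= k)%N ->
  0 <= ('X * ('X * Q))`_k * Q`_l - ('X * ('X * Q))`_l * Q`_k.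
Proof.
move=> [Q0 QC]; rewrite !coefXM; case: l => [|[|l]]; case: k => [|[|k]] //= lk;
  rewrite ?mul0r ?subr0 ?mulr_ge0 //.
by have := QC l k 2 lk; rewrite /gap !addn2 mulrC.
Qed.

Variable (I : finType).
Implicit Types (a : I -> R) (A : {set I}).

Variables (a : I -> R) (k l : nat).
Hypotheses (a0 : forall i, 0 <= a i) (lk : (l < k)%N).

(** Up to the factor [e_l^2], the derivative of [e_k / e_l] in [a i]; [off] is the same combination
    formed with mixed second derivatives. *)
Definition ell A i :=
  ('X * gen a (A :\ i))`_k * (gen a A)`_l - ('X * gen a (A :\ i))`_l * (gen a A)`_k.

Definition off A i j :=
  ('X * ('X * gen a (A :\ i :\ j)))`_k * (gen a A)`_l
  - ('X * ('X * gen a (A :\ i :\ j)))`_l * (gen a A)`_k.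

Lemma ellE A i : i \in A -> ell A i =
  ('X * gen a (A :\ i))`_k * (gen a (A :\ i))`_l
  - ('X * gen a (A :\ i))`_l * (gen a (A :\ i))`_k.
Proof. by move=> iA; rewrite /ell (genD1 a iA) !coef_linM; ring. Qed.

Lemma ell_ge0 A i : i \in A -> 0 <= ell A i.
Proof.
by move=> iA; rewrite ellE //; apply: log_concave_cross (ltnW lk); exact: gen_log_concave.
Qed.

(** Both sides are expressed by the polynomial [q] without the factors [i] and [j]. The terms cubic
    in [a i] and [a j] cancel, and the difference is [a i * a j * C + (a i + a j) * D] with the
    nonnegative cross terms [C] and [D] of [q]. *)
Lemma off_ell A i j : i \in A -> j \in A -> j != i ->
  a i * a j * off A i j <= a i * ell A i + a j * ell A j.
Proof.
move=> iA jA ji.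
have jAi : j \in A :\ i by rewrite !inE ji.
have iAj : i \in A :\ j by rewrite !inE eq_sym ji.
have PC := gen_log_concave (A :\ i :\ j) a0.
have Eq : A :\ j :\ i = A :\ i :\ j by rewrite !setDDl (setUC [set j]).
rewrite !ellE // /off (genD1 a iA) (genD1 a jAi) (genD1 a iAj) Eq.
rewrite !(coef_linM, coef_XlinM).
have := log_concave_cross2 PC (ltnW lk); have := log_concave_cross PC (ltnW lk).
set q := gen _ _; set u := ('X * ('X * q))`_k; set u' := ('X * ('X * q))`_l.
set v := ('X * q)`_k; set v' := ('X * q)`_l => D C; rewrite -subr_ge0.
have := addr_ge0 (mulr_ge0 (mulr_ge0 (a0 i) (a0 j)) C) (mulr_ge0 (addr_ge0 (a0 i) (a0 j)) D).
congr (0 <= _); ring.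
Qed.

(** Newton's inequality with the multiplicities [k] and [l] supplied by Euler's relation. They leave
    a surplus of [k - l] copies of [e_(k-1) e_l], from which [ell_lower] draws its lower bound. *)
Lemma newton_strict A :
  k%:R * ((gen a A)`_k * ('X * gen a A)`_l) <= l%:R * (('X * gen a A)`_k * (gen a A)`_l).
Proof.
rewrite mulrA -sum_coef_gen [X in _ <= X]mulrCA -sum_coef_gen mulr_sumr mulr_suml.
apply: ler_sum => i iA.
have PX : log_concave ('X * gen a (A :\ i)) by apply/log_concaveX/gen_log_concave.
have := mulr_ge0 (mulr_ge0 (a0 i) (a0 i)) (log_concave_cross PX (ltnW lk)).
rewrite !(genD1 a iA) !coef_XlinM -subr_ge0; set q := gen _ _.
move: ('X * ('X * q))`_k ('X * ('X * q))`_l ('X * q)`_k ('X * q)`_l => u u' v v'.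
by congr (0 <= _); ring.
Qed.

Lemma coef_gen_sub A i m : (gen a (A :\ i))`_m <= (gen a A)`_m.
Proof.
case: (boolP (i \in A)) => iA; last by rewrite (setDidPl _) 1?disjoint_sym ?disjoints1.
by rewrite (genD1 a iA) coef_linM ler_wpDr ?mulr_ge0 ?coef_genX_ge0.
Qed.

Variable s : R.

Lemma coef_genS A m : \sum_(i in A) a i <= s -> (gen a A)`_m.+1 <= s * (gen a A)`_m.
Proof.
move=> As; have P0 := coef_gen_ge0 A m a0.
apply: (@le_trans _ _ (m.+1%:R * (gen a A)`_m.+1)).
  by rewrite ler_peMl ?coef_gen_ge0 // ler1n.
rewrite -sum_coef_gen; apply: (@le_trans _ _ (\sum_(i in A) a i * (gen a A)`_m)).
  by apply: ler_sum => i iA; rewrite coefXM /= ler_wpM2l ?coef_gen_sub.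
by rewrite -mulr_suml ler_wpM2r.
Qed.

Hypothesis s0 : 0 < s.

Lemma coef_gen_le A m j : \sum_(i in A) a i <= s ->
  (gen a A)`_(m + j) <= s ^+ j * (gen a A)`_m.
Proof.
move=> As; elim: j => [|j IH]; first by rewrite addn0 expr0 mul1r.
rewrite addnS exprS -mulrA; apply: (le_trans (coef_genS _ As)).
by rewrite ler_wpM2l // ltW.
Qed.

Lemma sum_setD1_le A i : \sum_(j in A) a j <= s -> \sum_(j in A :\ i) a j <= s.
Proof.
case: (boolP (i \in A)) => iA; last by rewrite (setDidPl _) 1?disjoint_sym ?disjoints1.
by apply: le_trans; rewrite (big_setD1 i iA) /= ler_wpDl.
Qed.

(** Ellipticity although some [a i] may vanish: [e_k] of the whole set is at most [2 s] times
    [e_(k-1)] of the rest, one factor [e_(k-1)] is traded for [e_l] against a power of [s], and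
    [e_(k-1) e_l] is at most [k] times [ell] by [newton_strict]. *)
Lemma ell_lower A i : i \in A -> \sum_(j in A) a j <= s ->
  (gen a A)`_k ^+ 2 <= k%:R * (s + s) ^+ 2 * s ^+ (k.-1 - l) * ell A i.
Proof.
move=> iA As; have As' := sum_setD1_le i As.
case: k lk (newton_strict (A :\ i)) (ellE iA) => // k' lk' N E; rewrite /= ltnS in lk' *.
set Q := gen a (A :\ i) in N E.
have Q0 m : 0 <= Q`_m by exact: coef_gen_ge0.
have H1 : (gen a A)`_k'.+1 <= (s + s) * Q`_k'.
  rewrite (genD1 a iA) coef_linM mulrDl lerD ?coef_genS //.
  rewrite coefXM /= ler_wpM2r //; apply: le_trans As.
  by rewrite (big_setD1 i iA) /= ler_wpDr ?sumr_ge0.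
have H2 : Q`_k' <= s ^+ (k' - l) * Q`_l by rewrite -{1}(subnKC lk') coef_gen_le.
have H3 : Q`_k' * Q`_l <= k'.+1%:R * ell A i.
  have e : ('X * Q)`_k'.+1 = Q`_k' by rewrite coefXM.
  rewrite E e; rewrite e in N.
  have lk1 : l%:R + 1 <= k'.+1%:R :> R by rewrite -[1]/(1%:R) -natrD ler_nat addn1.
  have := ler_wpM2r (mulr_ge0 (Q0 k') (Q0 l)) lk1.
  move: N; move: (Q`_k') (Q`_l) ('X * Q)`_l Q`_k'.+1 (l%:R : R) (k'.+1%:R : R).
  by move=> x y z t L K N; lra.
have ss0 : 0 <= s + s by rewrite addr_ge0 ?ltW.
apply: (@le_trans _ _ ((s + s) ^+ 2 * (Q`_k' * Q`_k'))).
  rewrite -expr2 -exprMn ler_sqr ?nnegrE ?coef_gen_ge0 ?mulr_ge0 //.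
rewrite (_ : _ * ell A i = (s + s) ^+ 2 * (s ^+ (k' - l) * (k'.+1%:R * ell A i))); last by ring.
apply: ler_wpM2l; first exact: exprn_ge0.
apply: (@le_trans _ _ (s ^+ (k' - l) * (Q`_k' * Q`_l))).
  rewrite [X in _ <= X]mulrCA; exact: ler_wpM2l.
by apply: ler_wpM2l => //; exact/exprn_ge0/ltW.
Qed.

End Newton.

(** * Concavity of quotients of elementary symmetric functions (Marcus and Lopes) *)

Section MarcusLopes.
Variables (R : realFieldType) (I : finType) (l : I -> R).
Hypothesis l_gt0 : forall i, 0 < l i.
Implicit Types (a b : I -> R) (A : {set I}).

(** [x t / (x + z t)] is the parallel sum of [x / z] and [t], hence jointly concave and increasing
    in [t]; the explicit difference has one nonnegative term for each of the two properties. *)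
Lemma parallel_sum_concave (x y z t u s : R) : 0 < x -> 0 < y -> 0 < z ->
  0 < t -> 0 < u -> (t + u) / 2 <= s ->
  (x * t / (x + z * t) + y * u / (y + z * u)) / 2
  <= (x + y) / 2 * s / ((x + y) / 2 + z * s).
Proof.
move=> x0 y0 z0 t0 u0 us.
have s0 : 0 < s by apply: lt_le_trans us; rewrite divr_gt0 ?addr_gt0.
have d1 : 0 < x + z * t by rewrite addr_gt0 ?mulr_gt0.
have d2 : 0 < y + z * u by rewrite addr_gt0 ?mulr_gt0.
have d3 : 0 < (x + y) + z * (t + u) by rewrite addr_gt0 ?mulr_gt0 ?addr_gt0.
have d4 : 0 < (x + y) + 2 * (z * s) by rewrite addr_gt0 ?mulr_gt0 ?addr_gt0.
rewrite -subr_ge0.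
have -> : (x + y) / 2 * s / ((x + y) / 2 + z * s)
    - (x * t / (x + z * t) + y * u / (y + z * u)) / 2
  = (x + y) ^+ 2 * (s - (t + u) / 2) / ((x + y + 2 * (z * s)) * (x + y + z * (t + u)))
    + z * (x * u - y * t) ^+ 2
      / ((x + z * t) * (y + z * u) * (x + y + z * (t + u)) * 2).
  by field; rewrite ?pnatr_eq0 !gt_eqF.
have ss0 : 0 <= s - (t + u) / 2 by rewrite subr_ge0.
have p1 := ltW (mulr_gt0 d4 d3).
have p2 := ltW (mulr_gt0 (mulr_gt0 (mulr_gt0 d1 d2) d3) (ltr0Sn R 1)).
apply: addr_ge0.
  exact: divr_ge0 (mulr_ge0 (sqr_ge0 _) ss0) p1.
exact: divr_ge0 (mulr_ge0 (ltW z0) (sqr_ge0 _)) p2.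
Qed.

(** Homogenized form of [gen]: the coefficient of order [m] has degree [#|A| - m] in [a], so the
    quotient of two neighbouring coefficients has degree one and can be concave in [a]. *)
Definition gen2 a A : {poly R} := \prod_(i in A) ((a i)%:P + l i *: 'X).

Lemma gen2D1 a A i : i \in A -> gen2 a A = ((a i)%:P + l i *: 'X) * gen2 a (A :\ i).
Proof. by move=> iA; rewrite /gen2 (big_setD1 i). Qed.

Lemma coef_gen2D1 a A i m : i \in A ->
  (gen2 a A)`_m.+1 = a i * (gen2 a (A :\ i))`_m.+1 + l i * (gen2 a (A :\ i))`_m.
Proof.
by move=> iA; rewrite (gen2D1 a iA) mulrDl coefD coefCM -scalerAl coefZ coefXM.
Qed.

Lemma deriv_gen2 a A : 'X * (gen2 a A)^`() = \sum_(i in A) l i *: ('X * gen2 a (A :\ i)).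
Proof.
have [n] := ubnP #|A|; elim: n A => // n IH A; rewrite ltnS => An.
have [->|[i iA]] := set_0Vmem A; first by rewrite /gen2 !big_set0 derivC mulr0.
have cA : (#|A :\ i| < n)%N by move: An; rewrite (cardsD1 i) iA.
rewrite (gen2D1 a iA) derivM mulrDr (big_setD1 i iA) /=; congr (_ + _).
  by rewrite derivD derivC add0r derivZ derivX -scalerAl mul1r -scalerAr.
rewrite mulrCA IH // mulr_sumr; apply: eq_bigr => j; rewrite inE => /andP[ji jA].
rewrite -scalerAr mulrCA (@gen2D1 a (A :\ j) i); last first.
  by move: ji; rewrite !inE eq_sym => ->.
by rewrite !setDDl (setUC [set j]).
Qed.

(* Euler's relation, the other half of the counting of the factors of each
   monomial: the summand of [i] keeps [a i] and not [l i]. *)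
Lemma sum_coef_gen2 a A m :
  \sum_(i in A) a i * (gen2 a (A :\ i))`_m = (#|A|%:R - m%:R) * (gen2 a A)`_m.
Proof.
rewrite mulrBl.
have -> : m%:R * (gen2 a A)`_m = \sum_(i in A) l i * ('X * gen2 a (A :\ i))`_m.
  have := congr1 (fun P : {poly R} => P`_m) (deriv_gen2 a A).
  rewrite coefXM coef_deriv coef_sum; under eq_bigr do rewrite coefZ.
  by move=> <-; case: m => [|m] /=; rewrite ?mul0r // mulr_natl.
rewrite -sum1_card natr_sum mulr_suml -sumrB; apply: eq_bigr => i iA.
by rewrite (gen2D1 a iA) mulrDl coefD coefCM -scalerAl coefZ mul1r addrK.
Qed.

Lemma coef_gen2_ge0 a A m : (forall i, 0 < a i) -> 0 <= (gen2 a A)`_m.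
Proof.
move=> a0; rewrite /gen2; elim/big_rec: _ m => [|i Q iA QL] m; first by rewrite coef1 ler0n.
rewrite mulrDl coefD coefCM -scalerAl coefZ coefXM.
apply: addr_ge0; first exact: mulr_ge0 (ltW _) (QL _).
by apply: mulr_ge0 (ltW _) _ => //; case: ifP.
Qed.

Lemma coef_gen2_eq0 a A m : (#|A| < m)%N -> (gen2 a A)`_m = 0.
Proof.
have [n] := ubnP #|A|; elim: n A m => // n IH A m; rewrite ltnS => An.
have [->|[i iA]] := set_0Vmem A.
  by rewrite /gen2 big_set0 coef1 cards0; case: m.
move: An; rewrite (cardsD1 i) iA => An; case: m => // m Am.
by rewrite (coef_gen2D1 _ _ iA) !IH ?mulr0 ?addr0 // ltnW.
Qed.

Lemma coef_gen2_gt0 a A m : (forall i, 0 < a i) -> (m <= #|A|)%N -> 0 < (gen2 a A)`_m.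
Proof.
move=> a0; have [n] := ubnP #|A|; elim: n A m => // n IH A m; rewrite ltnS => An.
have [->|[i iA]] := set_0Vmem A.
  by rewrite /gen2 big_set0 coef1 cards0 leqn0 => /eqP->; rewrite ltr01.
move: An; rewrite (cardsD1 i) iA => An; case: m => [|m] Am.
  rewrite (gen2D1 _ iA) mulrDl coefD coefCM -scalerAl coefZ coefXM mulr0 addr0.
  by rewrite mulr_gt0 // IH.
rewrite (coef_gen2D1 _ _ iA) ltr_wpDl //; last by rewrite mulr_gt0 ?IH.
exact: mulr_ge0 (ltW _) (coef_gen2_ge0 _ _ _).
Qed.

(** By Euler's relation, [#|A| - m] times the quotient is a sum over [i] of parallel sums of [a i]
    with the quotient for [A :\ i]; the induction then runs through [parallel_sum_concave]. *)
Lemma ratio_gen2_concave a b A m : (forall i, 0 < a i) -> (forall i, 0 < b i) ->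
  (m < #|A|)%N ->
  ((gen2 a A)`_m / (gen2 a A)`_m.+1 + (gen2 b A)`_m / (gen2 b A)`_m.+1) / 2
  <= (gen2 (fun i => (a i + b i) / 2) A)`_m / (gen2 (fun i => (a i + b i) / 2) A)`_m.+1.
Proof.
move=> a0 b0; set c := fun i => _.
have c0 i : 0 < c i by rewrite divr_gt0 ?addr_gt0.
have [n] := ubnP #|A|; elim: n A m => // n IH A m; rewrite ltnS => An mA.
have E d : (forall i, 0 < d i) -> (#|A|%:R - m%:R) * ((gen2 d A)`_m / (gen2 d A)`_m.+1)
    = \sum_(i in A) d i * (gen2 d (A :\ i))`_m
        / (d i * (gen2 d (A :\ i))`_m.+1 + l i * (gen2 d (A :\ i))`_m).
  move=> d0; rewrite mulrA -sum_coef_gen2 mulr_suml.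
  by apply: eq_bigr => i iA; rewrite -(coef_gen2D1 _ _ iA).
have Am0 : 0 < #|A|%:R - m%:R :> R by rewrite subr_gt0 ltr_nat.
rewrite -(ler_pM2l Am0) mulrA mulrDr !E // mulrDl !mulr_suml -big_split /=.
apply: ler_sum => i iA.
have cA : #|A| = #|A :\ i|.+1 by rewrite (cardsD1 i) iA.
have An' : (#|A :\ i| < n)%N by rewrite -cA.
have mA' : (m <= #|A :\ i|)%N by rewrite -ltnS -cA.
have P d : (forall i, 0 < d i) -> 0 < (gen2 d (A :\ i))`_m.
  by move=> d0; apply: coef_gen2_gt0.
(* When [m] equals the size of [A :\ i], the next coefficient of the rest vanishes and the summand
   is the linear function [d i / l i]. *)
move: mA'; rewrite leq_eqVlt => /orP[/eqP mA'|mA'].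
  have Z d : (gen2 d (A :\ i))`_m.+1 = 0 by apply: coef_gen2_eq0; rewrite mA'.
  have Q d : (forall i, 0 < d i) -> d i * (gen2 d (A :\ i))`_m / (l i * (gen2 d (A :\ i))`_m) = d i / l i.
    by move=> d0; rewrite -mulf_div divff ?mulr1 // gt_eqF ?P.
  by rewrite !Z !mulr0 !add0r !Q // -!mulrDl mulrAC.
have P1 d : (forall i, 0 < d i) -> 0 < (gen2 d (A :\ i))`_m.+1.
  by move=> d0; apply: coef_gen2_gt0.
have T d : (forall i, 0 < d i) -> d i * (gen2 d (A :\ i))`_m
        / (d i * (gen2 d (A :\ i))`_m.+1 + l i * (gen2 d (A :\ i))`_m)
    = d i * ((gen2 d (A :\ i))`_m / (gen2 d (A :\ i))`_m.+1)
      / (d i + l i * ((gen2 d (A :\ i))`_m / (gen2 d (A :\ i))`_m.+1)).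
  move=> d0; have p0 := P1 d d0; have p := P d d0.
  have h : 0 < d i * (gen2 d (A :\ i))`_m.+1 + l i * (gen2 d (A :\ i))`_m.
    by rewrite addr_gt0 ?mulr_gt0.
  by field; rewrite !gt_eqF.
rewrite -mulrDl !T //; apply: parallel_sum_concave => //; rewrite ?divr_gt0 ?P ?P1 //.
exact: IH.
Qed.

End MarcusLopes.

Section GenDiv.
Variables (R : realFieldType) (I : finType) (a a' : I -> R) (S : {set I}).
Hypotheses (aS : forall i, i \in S -> a' i = a i) (a0 : forall i, i \notin S -> a i = 0).

(** Zero entries of [a] drop out and [1 / b i] factors out of the others, so quotients taken at
    [a / b] become quotients of [gen2] in the variable [b]. Off the support [S] the values of [a']
    are free and can be made positive. *)
Lemma gen_div (b : I -> R) : (forall i, 0 < b i) ->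
  gen (fun i => a i / b i) [set: I] = (\prod_(i in S) (b i)^-1) *: gen2 a' b S.
Proof.
move=> b0; rewrite /gen /gen2 -mul_polyC (rmorph_prod (@polyC R)) -big_split /=.
rewrite [LHS](big_setID S) /= [X in _ * X]big1 ?mulr1 => [|i]; last first.
  by rewrite !inE andbT => /a0 ->; rewrite mul0r scale0r addr0.
rewrite setTI; apply: eq_bigr => i /aS ->.
by rewrite mulrDr -polyCM mulVf ?gt_eqF // mul_polyC scalerA mulrC.
Qed.

Lemma gen_div_ratio (b : I -> R) m : (forall i, 0 < b i) ->
  (gen (fun i => a i / b i) [set: I])`_m / (gen (fun i => a i / b i) [set: I])`_m.+1
  = (gen2 a' b S)`_m / (gen2 a' b S)`_m.+1.
Proof.
move=> b0; rewrite !gen_div // !coefZ -mulf_div divff ?mul1r //.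
by apply/prodf_neq0 => i _; rewrite invr_neq0 // gt_eqF.
Qed.

Lemma gen_gen2 : gen a [set: I] = gen2 a' (fun=> 1) S.
Proof.
have := @gen_div (fun=> 1) (fun=> ltr01).
rewrite [X in X *: _]big1 ?scale1r => [<-|i _]; last by rewrite invr1.
by rewrite /gen; apply: eq_bigr => i _; rewrite divr1.
Qed.

End GenDiv.

(** * Second order expansion of a determinant at a diagonal matrix *)

Section DetJet.
Variables (A : comNzRingType) (n : nat).

Lemma deriv_prod_in (I : finType) (F : I -> {poly A}) (S : {set I}) :
  (\prod_(i in S) F i)^`() = \sum_(i in S) (F i)^`() * \prod_(j in S :\ i) F j.
Proof.
have [m] := ubnP #|S|; elim: m S => // m IH S; rewrite ltnS => Sm.
have [->|[i iS]] := set_0Vmem S; first by rewrite !big_set0 derivC.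
have cS : (#|S :\ i| < m)%N by move: Sm; rewrite (cardsD1 i) iS.
rewrite (big_setD1 i) //= derivM (big_setD1 i iS) /=; congr (_ + _).
rewrite IH // mulr_sumr; apply: eq_bigr => j; rewrite inE => /andP[ji jS].
rewrite mulrCA; congr (_ * _); rewrite (@big_setD1 _ _ _ _ i (S :\ j)) /=; last first.
  by move: ji; rewrite !inE eq_sym => ->.
by rewrite !setDDl (setUC [set j]).
Qed.

Lemma derivn2_prod (I : finType) (F : I -> {poly A}) :
  (\prod_i F i)^`()^`() = \sum_i ((F i)^`()^`() * \prod_(j in [set~ i]) F j
    + \sum_(j in [set~ i]) (F i)^`() * ((F j)^`() * \prod_(m in [set~ i] :\ j) F m)).
Proof.
have S1 : \prod_i F i = \prod_(i in [set: I]) F i by apply: eq_bigl => i; rewrite inE.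
rewrite S1 deriv_prod_in linear_sum /=.
under eq_bigl do rewrite inE.
apply: eq_bigr => i _; rewrite derivM; congr (_ + _); first by rewrite -setTD.
by rewrite -setTD deriv_prod_in mulr_sumr.
Qed.

Lemma perm_fix2 (I : finType) (i j : I) (s : {perm I}) : i != j ->
  (forall m, m != i -> m != j -> s m = m) -> s = 1%g \/ s = tperm i j.
Proof.
move=> ij fs; case: (eqVneq (s i) i) => si; [left|right]; apply/permP => m; rewrite ?perm1.
  case: (eqVneq m i) => [->//|mi]; case: (eqVneq m j) => [->|mj]; last exact: fs.
  case: (eqVneq (s j) j) => // sj; have sji : s j != i.
    by apply: contraNneq ij => e; rewrite -(inj_eq (@perm_inj _ s)) si e.
  by move: (fs _ sji sj) => /perm_inj e; rewrite e eqxx in sj.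
have sij : s i = j.
  by apply/eqP; apply: contraTT isT => sj; move: (fs _ si sj) => /perm_inj e; rewrite e eqxx in si.
have sji : s j = i.
  apply/eqP; apply: contraTT isT => si'; have sj : s j != j.
    by apply: contraNneq ij => e; rewrite -(inj_eq (@perm_inj _ s)) e sij.
  by move: (fs _ si' sj) => /perm_inj e; rewrite e eqxx in sj.
case: tpermP => [->|->|/eqP mi /eqP mj] //; exact: fs.
Qed.

Variables (D : 'I_n -> A) (B C : 'M[A]_n).

Definition jetmx : 'M[{poly A}]_n :=
  \matrix_(i, j) ((if i == j then D i else 0)%:P + B i j *: 'X + C i j *: 'X^2).

Let J0 i j : (jetmx i j)`_0 = if i == j then D i else 0.
Proof. by rewrite mxE !coefD coefC !coefZ coefX coefXn !mulr0 !addr0. Qed.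

Let J1 i j : ((jetmx i j)^`())`_0 = B i j.
Proof.
by rewrite mxE coef_deriv !coefD coefC !coefZ coefX coefXn mulr0 mulr1 addr0 add0r.
Qed.

Let J2 i j : ((jetmx i j)^`()^`())`_0 = C i j *+ 2.
Proof.
by rewrite mxE !coef_deriv !coefD coefC !coefZ coefX coefXn !mulr0 mulr1 !add0r.
Qed.

Let coef0_prod (I : finType) (P : pred I) (F : I -> {poly A}) :
  (\prod_(i | P i) F i)`_0 = \prod_(i | P i) (F i)`_0.
Proof. by rewrite -!horner_coef0 horner_prod; apply: eq_bigr => i _; rewrite horner_coef0. Qed.

Let prod_fix (S : {set 'I_n}) (s : 'S_n) (i : 'I_n) : i \in S -> s i != i ->
  \prod_(j in S) (jetmx j (s j))`_0 = 0.
Proof. by move=> iS si; rewrite (big_setD1 i) //= J0 eq_sym (negbTE si) mul0r. Qed.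

Let prod_id (S : {set 'I_n}) (s : 'S_n) : (forall i, i \in S -> s i = i) ->
  \prod_(j in S) (jetmx j (s j))`_0 = \prod_(j in S) D j.
Proof. by move=> fs; apply: eq_bigr => j jS; rewrite J0 fs // eqxx. Qed.


Let coef_sign (s : 'S_n) (x : {poly A}) m : ((-1) ^+ s * x)`_m = (-1) ^+ s * x`_m.
Proof. by case: (odd_perm s); rewrite ?expr0 ?mul1r // expr1 !mulN1r coefN. Qed.

Let deriv_sign (s : 'S_n) (x : {poly A}) : ((-1) ^+ s * x)^`() = (-1) ^+ s * x^`().
Proof. by case: (odd_perm s); rewrite ?expr0 ?mul1r // expr1 !mulN1r derivN. Qed.

Lemma coef0_det_jetmx : (\det jetmx)`_0 = \prod_i D i.
Proof.
rewrite -horner_coef0 -horner_evalE -det_map_mx.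
rewrite (_ : map_mx _ _ = diag_mx (\row_i D i)).
  by rewrite det_diag; apply: eq_bigr => i _; rewrite mxE.
apply/matrixP => i j; rewrite [LHS]mxE -[LHS]/((jetmx i j).[0]) horner_coef0 J0 !mxE.
by case: eqP => _; rewrite ?mulr1n ?mulr0n.
Qed.

Lemma coef1_det_jetmx : (\det jetmx)`_1 = \sum_i B i i * \prod_(j in [set~ i]) D j.
Proof.
have -> : (\det jetmx)`_1 = ((\det jetmx)^`())`_0 by rewrite coef_deriv.
rewrite /determinant linear_sum coef_sum /=.
under eq_bigr => s _.
  rewrite deriv_sign coef_sign (eq_bigl (fun i => i \in [set: 'I_n])); last by move=> i; rewrite inE.
  rewrite deriv_prod_in coef_sum mulr_sumr (eq_bigl predT); last by move=> i; rewrite inE.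
  over.
rewrite exchange_big /=; apply: eq_bigr => i _.
rewrite (bigD1 1%g) //= [X in _ + X]big1 ?addr0 => [|s s1].
  rewrite odd_perm1 expr0 mul1r coef0M coef0_prod J1 perm1 setTD.
  by congr (_ * _); apply: prod_id => j _; rewrite perm1.
rewrite coef0M coef0_prod setTD.
have [j ji sj] : exists2 j, j \in [set~ i] & s j != j.
  apply/exists_inP; apply: contraNT s1; rewrite negb_exists_in => /forall_inP fs.
  have fs' j : j != i -> s j = j by move=> ji; apply/eqP; have := fs j; rewrite !inE ji negbK; apply.
  apply/eqP/permP => j; rewrite perm1; case: (eqVneq j i) => [->|]; last exact: fs'.
  by case: (eqVneq (s i) i) => // si; have := fs' _ si; move/perm_inj => e; rewrite e eqxx in si.
by rewrite (prod_fix ji sj) !mulr0.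
Qed.

(** At [X = 0] the off-diagonal entries vanish, so once two factors [i] and [j] are differentiated
    only the identity and the transposition of [i] and [j] survive. The doubling avoids a division
    by two in the ring. *)
Lemma coef2_det_jetmx : (\det jetmx)`_2 *+ 2 =
  \sum_i (C i i * \prod_(j in [set~ i]) D j *+ 2
    + \sum_(j in [set~ i]) (B i i * B j j - B i j * B j i) * \prod_(m in [set~ i] :\ j) D m).
Proof.
have -> : (\det jetmx)`_2 *+ 2 = ((\det jetmx)^`()^`())`_0 by rewrite !coef_deriv.
rewrite /determinant !linear_sum coef_sum /=.
under eq_bigr => s _.
  rewrite !deriv_sign coef_sign derivn2_prod coef_sum mulr_sumr.
  over.
rewrite exchange_big /=; apply: eq_bigr => i _.
under eq_bigr => s _ do rewrite coefD coef_sum mulrDr mulr_sumr.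
rewrite big_split /=; congr (_ + _).
  rewrite (bigD1 1%g) //= [X in _ + X]big1 ?addr0 => [|s s1].
    rewrite odd_perm1 expr0 mul1r coef0M coef0_prod J2 perm1 mulrnAl.
    by congr (_ * _ *+ _); apply: prod_id => j _; rewrite perm1.
  rewrite coef0M coef0_prod.
  have [j ji sj] : exists2 j, j \in [set~ i] & s j != j.
    apply/exists_inP; apply: contraNT s1; rewrite negb_exists_in => /forall_inP fs.
    have fs' j : j != i -> s j = j by move=> ji; apply/eqP; have := fs j; rewrite !inE ji negbK; apply.
    apply/eqP/permP => j; rewrite perm1; case: (eqVneq j i) => [->|]; last exact: fs'.
    by case: (eqVneq (s i) i) => // si; have := fs' _ si; move/perm_inj => e; rewrite e eqxx in si.
  by rewrite (prod_fix ji sj) !mulr0.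
rewrite exchange_big /=; apply: eq_bigr => j; rewrite !inE => ji.
have ij : i != j by rewrite eq_sym.
have t1 : tperm i j != 1%g by apply: contraNneq ij => e; rewrite -[i](perm1) -e tpermL.
rewrite (bigD1 1%g) //= (bigD1 (tperm i j)) //= [X in _ + (_ + X)]big1 ?addr0 => [|s /andP[s1 st]].
  rewrite !coef0M coef0_prod !perm1 !J1 odd_perm1 expr0 mul1r.
  rewrite coef0_prod odd_tperm ij expr1 tpermL tpermR mulN1r prod_id; last by move=> m _; rewrite perm1.
  rewrite prod_id; first by rewrite !mulrA mulrBl.
  by move=> m; rewrite !inE => /andP[mj mi]; rewrite tpermD // eq_sym.
rewrite !coef0M coef0_prod.
have [m mS sm] : exists2 m, m \in [set~ i] :\ j & s m != m.
  apply/exists_inP; apply: contraT; rewrite negb_exists_in => /forall_inP fs.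
  case: (@perm_fix2 _ i j s ij) => [m mi mj|e|e].
  - by apply/eqP; have := fs m; rewrite !inE mi mj negbK; apply.
  - by rewrite e eqxx in s1.
  - by rewrite e eqxx in st.
by rewrite (prod_fix mS sm) !mulr0.
Qed.

End DetJet.

From mathcomp Require Import all_classical all_reals all_analysis.
Import Order.TTheory GRing.Theory Num.Theory.
Import numFieldNormedType.Exports.
Local Open Scope classical_set_scope.
Local Open Scope ring_scope.

(** * Second order Taylor expansions *)

Section Jet.
Variable R : realType.
Implicit Types (f g : R -> R) (a b c t : R).

(* [f t = a + b t + c t^2 + o(t^2)] *)
Definition jet f a b c : Prop :=
  exists r : R -> R, [/\ {for 0, continuous r}, r 0 = c &
    forall t, f t = a + b * t + t ^+ 2 * r t].

Lemma jet_at0 f a b c : jet f a b c -> f 0 = a.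
Proof. by case=> r [_ _ ->]; rewrite mulr0 expr0n mul0r !addr0. Qed.

Lemma jet_near f g a b c : {near 0, f =1 g} -> jet f a b c -> jet g a b c.
Proof.
move=> fg [r [rc r0 fE]].
exists (fun t => if t == 0 then c else (g t - a - b * t) / t ^+ 2); split.
- have E : {near 0, r =1 (fun t => if t == 0 then c else (g t - a - b * t) / t ^+ 2)}.
    near=> t; have e : f t = g t by near: t.
    case: eqP => [->//|/eqP t0]; rewrite -e fE.
    by field.
  rewrite /prop_for /continuous_at eqxx; rewrite -r0 in E *; apply: cvg_trans rc.
  exact: near_eq_cvg.
- by rewrite eqxx.
- move=> t; case: eqP => [->|/eqP t0]; last by field.
  rewrite -(nbhs_singleton fg) mulr0 expr0n mul0r !addr0.
  by rewrite fE mulr0 expr0n mul0r !addr0.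
Unshelve. all: by end_near. Qed.

Lemma jet_cst a : jet (fun=> a) a 0 0.
Proof. by exists (fun=> 0); split=> [||t]; [exact: cvg_cst| |rewrite mul0r mulr0 !addr0]. Qed.

Lemma jet_id : jet id 0 1 0.
Proof.
by exists (fun=> 0); split=> [||t]; [exact: cvg_cst| |rewrite mulr0 mul1r add0r addr0].
Qed.

Lemma jet_eq f a b c a' b' c' : jet f a b c -> a = a' -> b = b' -> c = c' -> jet f a' b' c'.
Proof. by move=> fj <- <- <-. Qed.

Lemma jetD f g a b c a' b' c' : jet f a b c -> jet g a' b' c' ->
  jet (fun t => f t + g t) (a + a') (b + b') (c + c').
Proof.
move=> [r [rc r0 fE]] [s [sc s0 gE]]; exists (fun t => r t + s t); split.
- by apply: cvgD; [exact: rc | exact: sc].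
- by rewrite r0 s0.
- by move=> t; rewrite fE gE; ring.
Qed.

Lemma jetM f g a b c a' b' c' : jet f a b c -> jet g a' b' c' ->
  jet (fun t => f t * g t) (a * a') (a * b' + b * a') (a * c' + b * b' + c * a').
Proof.
move=> [r [rc r0 fE]] [s [sc s0 gE]].
exists (fun t => a * s t + b * b' + r t * a' + t * (b * s t + r t * b') + t * t * (r t * s t)).
split.
- have tc : {for 0, continuous (fun t : R => t)} by exact: cvg_id.
  apply: cvgD; last first.
    by apply: cvgM; [apply: cvgM; exact: tc | apply: cvgM; [exact: rc | exact: sc]].
  apply: cvgD; last first.
    apply: cvgM; first exact: tc.
    by apply: cvgD; apply: cvgM; do ?[exact: cvg_cst | exact: rc | exact: sc].
  apply: cvgD; last by apply: cvgM; [exact: rc | exact: cvg_cst].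
  apply: cvgD; last exact: cvg_cst.
  by apply: cvgM; [exact: cvg_cst|exact: sc].
- by rewrite r0 s0 !mul0r !addr0.
- by move=> t; rewrite fE gE; ring.
Qed.

Lemma jetZ k f a b c : jet f a b c -> jet (fun t => k * f t) (k * a) (k * b) (k * c).
Proof. by move=> fj; apply: jet_eq (jetM (jet_cst k) fj) _ _ _; ring. Qed.

Lemma jetN f a b c : jet f a b c -> jet (fun t => - f t) (- a) (- b) (- c).
Proof.
move=> /(jetZ (-1)) fj; rewrite !mulN1r in fj; apply: jet_near fj.
by near=> t; rewrite mulN1r.
Unshelve. all: by end_near. Qed.

Lemma jet_sum (I : Type) (s : seq I) (P : pred I) (f : I -> R -> R) (a b c : I -> R) :
  (forall i, P i -> jet (f i) (a i) (b i) (c i)) ->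
  jet (fun t => \sum_(i <- s | P i) f i t) (\sum_(i <- s | P i) a i)
    (\sum_(i <- s | P i) b i) (\sum_(i <- s | P i) c i).
Proof.
move=> fj; elim: s => [|i s IH].
  apply: (@jet_near (fun=> 0)); first by near=> t; rewrite big_nil.
  by rewrite !big_nil; exact: jet_cst.
apply: (@jet_near (fun t => if P i then f i t + \sum_(j <- s | P j) f j t
                          else \sum_(j <- s | P j) f j t)).
  by near=> t; rewrite big_cons.
by rewrite !big_cons; case: ifP => // Pi; apply: jetD => //; exact: fj.
Unshelve. all: by end_near. Qed.

Lemma jet_comp (g f : R -> R) (a b c g0 g1 g2 : R) :
  jet (fun s => g (a + s)) g0 g1 g2 -> jet f a b c ->
  jet (fun t => g (f t)) g0 (g1 * b) (g1 * c + g2 * b ^+ 2).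
Proof.
move=> [r [rc r0 gE]] [s [sc s0 fE]].
have tc : {for 0, continuous (fun t : R => t)} by exact: cvg_id.
have ic : (fun t => b * t + t ^+ 2 * s t) @ (0 : R) --> (0 : R).
  rewrite -[X in _ --> X](_ : b * 0 + 0 * 0 * s 0 = 0); last by rewrite !mul0r mulr0 addr0.
  apply: cvgD; first by apply: cvgM; [exact: cvg_cst|exact: tc].
  by apply: cvgM; [apply: cvgM; exact: tc|exact: sc].
exists (fun t => g1 * s t + (b + t * s t) * (b + t * s t) * r (b * t + t ^+ 2 * s t)).
have e0 : b * 0 + 0 ^+ 2 * s 0 = 0 by rewrite mulr0 expr0n mul0r addr0.
have e1 : b + 0 * s 0 = b by rewrite mul0r addr0.
split.
- rewrite /prop_for /continuous_at e0; apply: cvgD; first by apply: cvgM; [exact: cvg_cst|exact: sc].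
  have h : (fun t => b + t * s t) @ (0 : R) --> b + 0 * s 0.
    by apply: cvgD; [exact: cvg_cst|apply: cvgM; [exact: tc|exact: sc]].
  apply: cvgM; first by apply: cvgM; exact: h.
  exact: (cvg_comp _ _ ic rc).
- by rewrite e0 e1 r0 s0 mulrC; ring.
- move=> t; have -> : f t = a + (b * t + t ^+ 2 * s t) by rewrite fE addrA.
  by rewrite gE; ring.
Qed.

Lemma jet_flip f a b c : jet f a b c -> jet (fun t => f (- t)) a (- b) c.
Proof.
move=> fj; have := @jet_comp f -%R 0 (-1) 0 a b c.
rewrite sqrrN expr1n mulr0 mulrN mulr1 mulr1 add0r; apply.
  by apply: jet_near fj; near=> t; rewrite add0r.
by apply: jet_eq (jetN jet_id) _ _ _; rewrite ?oppr0.
Unshelve. all: by end_near. Qed.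

Lemma jet_le_right f g a b c b' c' : jet f a b c -> jet g a b' c' ->
  (\forall t \near 0^'+, f t <= g t) -> b <= b'.
Proof.
move=> [r [rc r0 fE]] [s [sc s0 gE]] fg; rewrite -subr_ge0.
apply: (@cvgr_to_ge _ (0 : R)^'+ _ _ (fun t => (b' - b) + t * (s t - r t))); last first.
  near=> t; have t0 : 0 < t by [].
  rewrite -(pmulr_rge0 _ t0).
  rewrite (_ : t * _ = g t - f t); last by rewrite fE gE; ring.
  by rewrite subr_ge0; near: t.
rewrite -[X in _ --> X](_ : (b' - b) + 0 * (s 0 - r 0) = _); last by rewrite mul0r addr0.
apply: cvg_at_right_filter; apply: cvgD; first exact: cvg_cst.
by apply: cvgM; [exact: cvg_id|apply: cvgB; [exact: sc|exact: rc]].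
Unshelve. all: by end_near. Qed.

(** The conditions at a two-sided contact: reflecting [t] turns the inequality of slopes into an
    equality, after which division by [t ^+ 2] compares the second coefficients. *)
Lemma jet_le f g a b c b' c' : jet f a b c -> jet g a b' c' ->
  (\forall t \near 0, f t <= g t) -> b = b' /\ c <= c'.
Proof.
move=> fj gj fg.
have bb : b <= b' by apply: jet_le_right fj gj _; exact: cvg_at_right_filter fg.
have bb' : - b <= - b'.
  apply: jet_le_right (jet_flip fj) (jet_flip gj) _.
  move/nbhs_ballP: fg => [d /= d0 fg]; near=> y; apply: fg.
  have y0 : 0 < y by [].
  by rewrite /ball /= sub0r opprK gtr0_norm //; near: y; exact: nbhs_right_lt.
have e : b = b' by apply: le_anti; rewrite bb -lerN2 bb'.
split=> //; move: fj gj => [r [rc r0 fE]] [s [sc s0 gE]]; rewrite -subr_ge0.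
apply: (@cvgr_to_ge _ (0 : R)^'+ _ _ (fun t => s t - r t)); last first.
  near=> t; have t0 : 0 < t by [].
  rewrite -(pmulr_rge0 _ (exprn_gt0 2 t0)).
  rewrite (_ : t ^+ 2 * _ = g t - f t); last by rewrite fE gE e; ring.
  by rewrite subr_ge0; near: t; exact: cvg_at_right_filter fg.
rewrite -r0 -s0.
by apply: cvg_at_right_filter; apply: cvgB; [exact: sc|exact: rc].
Unshelve. all: by end_near. Qed.

Lemma jet_of_derive f (df : R -> R) c :
  (\forall t \near (0 : R), is_derive (t : R) (1 : R) f (df t)) ->
  is_derive (0 : R) (1 : R) df c ->
  jet f (f 0) (df 0) (c / 2).
Proof.
move=> fd dfd.
pose r t := if t == 0 then c / 2 else (f t - f 0 - df 0 * t) / t ^+ 2.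
exists r; split; last 2 first.
- by rewrite /r eqxx.
- move=> t; rewrite /r; case: eqP => [->|/eqP t0]; last by field.
  by rewrite mulr0 expr0n mul0r !addr0.
apply/continuous_withinNx.
apply/cvgrPdist_le => e e0.
have dq : h^-1 *: (df (h *: 1 + 0) - df 0) @[h --> 0^'] --> c.
  by case: dfd => dv <-; exact: dv.
have : \forall h \near 0^', `|c - h^-1 *: (df (h *: 1 + 0) - df 0)| <= e.
  by move/cvgrPdist_le: dq; apply.
rewrite near_withinE => /nbhs_ballP[d1 /= d10 H1].
move/nbhs_ballP: fd => [d2 /= d20 H2].
have dm : 0 < Num.min d1 d2 by rewrite lt_min d10.
near=> t.
have t0 : t != 0 by near: t; exact: nbhs_dnbhs_neq.
have td : `|t| < Num.min d1 d2.
  near: t; apply: nbhs_dnbhs; exists (Num.min d1 d2) => //= x.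
  by rewrite /ball_ /= sub0r normrN.
have {td} [td1 td2] : `|t| < d1 /\ `|t| < d2 by move: td; rewrite lt_min => /andP[].
rewrite /r eqxx (negbTE t0).
(* The mean value theorem is applied in [s] on the unit interval, along [t * s], which treats both
   signs of [t] at once. *)
pose G s := f (t * s) - df 0 * (t * s) - c / 2 * (t * s) ^+ 2.
pose G' s := (df (t * s) - df 0 - c * (t * s)) * t.
have Gd (s : R) : s \in `[(0 : R), 1] -> is_derive s 1 G (G' s).
  rewrite in_itv /= => /andP[s0 s1].
  have ls : is_derive s 1 (fun s => t * s) t.
    by apply: is_derive_eq; rewrite /GRing.scale /= ?mulr1 ?scaler0 ?addr0 ?add0r.
  have ts : `|t * s| < d2.
    by apply: le_lt_trans td2; rewrite normrM (ger0_norm s0) ler_piMr.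
  have fts : is_derive (t * s) 1 f (df (t * s)) by apply: H2; rewrite /ball /= sub0r normrN.
  have h1 := is_derive1_comp fts ls.
  have h2 : is_derive s 1 (fun s => df 0 * (t * s)) (df 0 * t).
    by apply: is_derive_eq; rewrite /GRing.scale /= ?mulr1 ?mulr0 ?addr0 ?add0r.
  have h3 : is_derive s 1 (fun s => c / 2 * (t * s) ^+ 2) (c * (t * s) * t).
    apply: is_derive_eq; rewrite /GRing.scale /= ?mulr1 ?mulr0 ?addr0 ?add0r.
    by field.
  apply: is_derive_eq; rewrite /G' !mulrBl //.
have Go (s : R) : s \in `](0 : R), 1[ -> is_derive s 1 G (G' s).
  by move=> sI; apply: Gd; exact: subset_itv_oo_cc sI.
have Gc : {within `[(0 : R), 1], continuous G}.
  by apply: derivable_within_continuous => s /Gd Gs; exact: ex_derive.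
have [s sI] := @MVT_segment R G G' 0 1 ler01 Go Gc.
rewrite subr0 mulr1 /G /G' mulr1 mulr0 expr0n /= !mulr0 !subr0 => E.
have {}E : c / 2 - (f t - f 0 - df 0 * t) / t ^+ 2
    = - ((df (t * s) - df 0 - c * (t * s)) * t) / t ^+ 2.
  by rewrite -E; field.
rewrite E mulNr normrN normf_div normrM normrX ler_pdivrMr ?exprn_gt0 ?normr_gt0 //.
rewrite expr2 [e * _]mulrA ler_wpM2r //.
move: sI; rewrite in_itv /= => /andP[s0 s1].
have [->|sn0] := eqVneq s 0.
  by rewrite mulr0 subrr mulr0 subrr normr0 mulr_ge0 // ltW.
have ts0 : t * s != 0 by rewrite mulf_neq0.
have ts : `|t * s| < d1.
  by apply: le_lt_trans td1; rewrite normrM (ger0_norm s0) ler_piMr.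
have bts : ball 0 d1 (t * s) by rewrite /ball /= sub0r normrN.
have := H1 _ bts ts0.
rewrite /GRing.scale /= mulr1 addr0 => H.
have -> : df (t * s) - df 0 - c * (t * s) = - (t * s) * (c - (t * s)^-1 * (df (t * s) - df 0)).
  by field; rewrite sn0 t0.
rewrite normrM normrN mulrC; apply: ler_pM => //.
by rewrite normrM (ger0_norm s0) ler_piMr.
Unshelve. all: by end_near. Qed.

Lemma jet_ln_shift a : 0 < a -> jet (fun s => ln (a + s)) (ln a) a^-1 (- (a ^- 2) / 2).
Proof.
move=> a0.
have H := @jet_of_derive (fun s => ln (a + s)) (fun s => (a + s)^-1) (- (a ^- 2)).
rewrite !addr0 in H.
have h (s : R) : is_derive s 1 (fun s : R => a + s) 1.
  by apply: is_derive_eq; rewrite ?mulr1 add0r.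
apply: H.
- near=> s; have s0 : 0 < a + s.
    have : `|s| < a by near: s; exists a => //= x; rewrite /ball_ /= sub0r normrN.
    by rewrite ltr_norml => /andP[]; lra.
  by have := is_derive1_comp (is_derive1_ln s0) (h s); rewrite mulr1.
- have a0' : a + 0 != 0 by rewrite addr0 gt_eqF.
  apply: DeriveDef; first exact: (@derivableV _ _ (fun s => a + s) _ _ a0' (@ex_derive _ _ _ _ _ _ _ (h 0))).
  rewrite (@deriveV _ _ (fun s => a + s) _ _ a0' (@ex_derive _ _ _ _ _ _ _ (h 0))).
  by rewrite (@derive_val _ _ _ _ _ _ _ (h 0)) addr0 /GRing.scale /= mulr1.
Unshelve. all: by end_near. Qed.

Lemma jet_ln f a b c : 0 < a -> jet f a b c ->
  jet (fun t => ln (f t)) (ln a) (b / a) (c / a - (b / a) ^+ 2 / 2).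
Proof.
move=> a0 fj; apply: jet_eq (jet_comp (jet_ln_shift a0) fj) _ _ _ => //.
  by rewrite mulrC.
by field; rewrite gt_eqF.
Qed.

Lemma jet_exp f a b c : jet f a b c ->
  jet (fun t => expR (f t)) (expR a) (expR a * b) (expR a * (c + b ^+ 2 / 2)).
Proof.
move=> fj; have H : jet (fun s => expR (a + s)) (expR a) (expR a) (expR a / 2).
  have := @jet_of_derive (fun s => expR (a + s)) (fun s => expR (a + s)) (expR a).
  have hd (s : R) : is_derive s 1 (fun s => expR (a + s)) (expR (a + s)).
    have h : is_derive s 1 (fun s : R => a + s) 1 by apply: is_derive_eq; rewrite ?mulr1 add0r.
    by have := is_derive1_comp (is_derive_expR (a + s)) h; rewrite mulr1.
  rewrite addr0; apply; first by near=> s.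
  by have := hd 0; rewrite addr0.
by apply: jet_eq (jet_comp H fj) _ _ _ => //; move: (expR a) => e; field.
Unshelve. all: by end_near. Qed.

End Jet.

(** * Expansions of polynomial-valued curves and their determinants *)

Section PolyJet.
Variable R : realType.

(** The outer indeterminate of [J] is the time, the inner one that of the generating polynomial.
    Sums and products of curves become sums and products of [J], so a determinant expands into the
    determinant of the expansions. *)
Definition pjet (F : R -> {poly R}) (J : {poly {poly R}}) : Prop :=
  forall m, jet (fun t => (F t)`_m) (J`_0)`_m (J`_1)`_m (J`_2)`_m.

Lemma pjet_cst p : pjet (fun=> p) p%:P.
Proof. move=> m; rewrite !coefC /=; case: ifP => _; exact: jet_cst. Qed.

Lemma pjetD F G J K : pjet F J -> pjet G K -> pjet (fun t => F t + G t) (J + K).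
Proof.
move=> FJ GK m; rewrite !coefD.
by rewrite (_ : (fun t => _) = fun t => (F t)`_m + (G t)`_m); [exact: jetD|apply: funext => t; rewrite coefD].
Qed.

Lemma pjetM F G J K : pjet F J -> pjet G K -> pjet (fun t => F t * G t) (J * K).
Proof.
move=> FJ GK m.
rewrite (_ : (fun t => _) = fun t => \sum_(i < m.+1) (F t)`_i * (G t)`_(m - i)); last first.
  by apply: funext => t; rewrite coefM.
apply: jet_eq (jet_sum (index_enum 'I_m.+1) (fun i _ => jetM (FJ i) (GK (m - i)%N))) _ _ _.
- by rewrite coef0M coefM.
- have -> : (J * K)`_1 = J`_0 * K`_1 + J`_1 * K`_0.
    by rewrite coefM !big_ord_recl big_ord0 addr0.
  by rewrite coefD !coefM -big_split.
- have -> : (J * K)`_2 = J`_0 * K`_2 + J`_1 * K`_1 + J`_2 * K`_0.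
    by rewrite coefM !big_ord_recl big_ord0 addr0 addrA.
  by rewrite !coefD !coefM -!big_split.
Qed.

Lemma pjet_prod (I : Type) (s : seq I) (F : I -> R -> {poly R}) J :
  (forall i, pjet (F i) (J i)) ->
  pjet (fun t => \prod_(i <- s) F i t) (\prod_(i <- s) J i).
Proof.
move=> FJ; elim: s => [|i s IH].
  rewrite big_nil (_ : (fun t => _) = fun=> 1); first exact: pjet_cst.
  by apply: funext => t; rewrite big_nil.
rewrite big_cons (_ : (fun t => _) = fun t => F i t * \prod_(i <- s) F i t).
  exact: pjetM.
by apply: funext => t; rewrite big_cons.
Qed.

Lemma pjet_sum (I : Type) (s : seq I) (F : I -> R -> {poly R}) J :
  (forall i, pjet (F i) (J i)) ->
  pjet (fun t => \sum_(i <- s) F i t) (\sum_(i <- s) J i).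
Proof.
move=> FJ; elim: s => [|i s IH].
  rewrite big_nil (_ : (fun t => _) = fun=> 0); first by rewrite -polyC0; exact: pjet_cst.
  by apply: funext => t; rewrite big_nil.
rewrite big_cons (_ : (fun t => _) = fun t => F i t + \sum_(i <- s) F i t).
  exact: pjetD.
by apply: funext => t; rewrite big_cons.
Qed.

Lemma pjet_det n (M : R -> 'M[{poly R}]_n) (J : 'M[{poly {poly R}}]_n) :
  (forall i j, pjet (fun t => M t i j) (J i j)) -> pjet (fun t => \det (M t)) (\det J).
Proof.
move=> MJ; apply: pjet_sum => s; apply: pjetM; last by apply: pjet_prod.
have := pjet_cst ((-1) ^+ s); rewrite rmorphXn /= rmorphN rmorph1; exact.
Qed.

End PolyJet.

Section Esp.
Variables (R : realType) (n : nat).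
Implicit Types (M : 'M[R]_n) (a d : 'I_n -> R).
Local Notation full := [set: 'I_n]%SET.

(** [det (1 + X M)]: its coefficients are the elementary symmetric functions of the eigenvalues,
    available along a curve of matrices without diagonalizing it. *)
Definition detX M : {poly R} := \det (\matrix_(i, j) ((i == j)%:R%:P + M i j *: 'X)).

Definition esp M m := (detX M)`_m.

Lemma detX_diag a : detX (\matrix_(i, j) if i == j then a i else 0) = gen a full.
Proof.
rewrite /detX (_ : \matrix_(i, j) _ = diag_mx (\row_i (1 + a i *: 'X))).
  by rewrite det_diag /gen; apply: eq_big => i; rewrite ?finset.inE ?mxE.
apply/matrixP => i j; rewrite !mxE; case: eqP => _ /=; first by rewrite mulr1n.
by rewrite scale0r addr0 mulr0n.
Qed.

Definition lin a m d : R := \sum_i d i * ('X * gen a (full :\ i))`_m.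

Definition quad a m (H : 'I_n -> 'I_n -> R) : R :=
  (\sum_i \sum_(j in full :\ i) (H i i * H j j - H i j * H j i)
     * ('X * ('X * gen a (full :\ i :\ j)))`_m) / 2.

Lemma jet_esp (M : R -> 'M[R]_n) a (H C : 'I_n -> 'I_n -> R) m :
  (forall i j, jet (fun t => M t i j) (if i == j then a i else 0) (H i j) (C i j)) ->
  jet (fun t => esp (M t) m) (gen a full)`_m (lin a m (fun i => H i i))
    (lin a m (fun i => C i i) + quad a m H).
Proof.
move=> Mj; pose D i : {poly R} := 1 + a i *: 'X.
pose B : 'M[{poly R}]_n := \matrix_(i, j) (H i j *: 'X).
pose C' : 'M[{poly R}]_n := \matrix_(i, j) (C i j *: 'X).
have /(_ m) : pjet (fun t => detX (M t)) (\det (jetmx D B C')).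
  apply: pjet_det => i j m'.
  rewrite (_ : (fun t => _) = fun t => ((i == j)%:R%:P : {poly R})`_m' + M t i j * 'X`_m'); last first.
    by apply: funext => t; rewrite mxE coefD coefZ.
  have J0 : (jetmx D B C' i j)`_0 = if i == j then D i else 0.
    by rewrite mxE !coefD coefC !coefZ coefX coefXn !mulr0 !addr0.
  have J1 : (jetmx D B C' i j)`_1 = H i j *: 'X.
    by rewrite mxE !coefD coefC !coefZ coefX coefXn !mulr0 mulr1 addr0 add0r mxE.
  have J2 : (jetmx D B C' i j)`_2 = C i j *: 'X.
    by rewrite mxE !coefD coefC !coefZ coefX coefXn !mulr0 mulr1 !add0r mxE.
  rewrite J0 J1 J2 !coefZ.
  apply: jet_eq (jetD (jet_cst _) (jetM (Mj i j) (jet_cst _))) _ _ _.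
  - case: eqP => _; first by rewrite /D coefD coefZ.
    by rewrite mul0r addr0 !coef0.
  - by rewrite mulr0 !add0r.
  - by rewrite !mulr0 !add0r.
move=> /jet_eq; apply.
- rewrite coef0_det_jetmx (_ : \prod_i D i = gen a full) //.
  by apply: eq_bigl => i; rewrite finset.inE.
- rewrite coef1_det_jetmx coef_sum /lin; apply: eq_bigr => i _.
  by rewrite mxE -scalerAl coefZ finset.setTD.
- have := congr1 (fun p : {poly R} => p`_m) (coef2_det_jetmx D B C').
  rewrite coefMn => E.
  apply: (@mulIf _ 2); first by rewrite pnatr_eq0.
  rewrite mulr_natr E mulrDl /quad divfK ?pnatr_eq0 //.
  rewrite coef_sum /lin mulr_suml -big_split /=; apply: eq_bigr => i _.
  rewrite coefD coefMn mxE -scalerAl coefZ mulr_natr finset.setTD; congr (_ + _).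
  rewrite coef_sum; apply: eq_bigr => j _; rewrite !mxE.
  rewrite -!scalerAl -!scalerAr !scalerA -scalerBl -scalerAl coefZ.
  by rewrite -mulrA.
Qed.

End Esp.

Section MoreJets.
Variable R : realType.

Lemma jet_cvg (f : R -> R) (a b c : R) : jet f a b c -> f t @[t --> (0 : R)] --> a.
Proof.
move=> [r [rc r0 fE]].
have tc : {for 0, continuous (fun t : R => t)} by exact: cvg_id.
rewrite (_ : f = fun t => a + b * t + t * t * r t); last first.
  by apply: funext => t; rewrite fE expr2.
rewrite -[X in _ --> X](_ : a + b * 0 + 0 * 0 * r 0 = a); last by rewrite mulr0 !mul0r !addr0.
apply: cvgD; first by apply: cvgD; [exact: cvg_cst|apply: cvgM; [exact: cvg_cst|exact: tc]].
by apply: cvgM; [apply: cvgM; exact: tc|exact: rc].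
Qed.

Lemma jet_gt0 (f : R -> R) (a b c : R) : jet f a b c -> 0 < a -> \forall t \near (0 : R), 0 < f t.
Proof. by move=> /jet_cvg fa a0; apply: (cvgr_gt a fa). Qed.

Lemma jet_div_lin (a x : R) : jet (fun t => a / (1 - t * x)) a (a * x) (a * x ^+ 2).
Proof.
have c : {for 0, continuous (fun t : R => 1 - t * x)}.
  by apply: cvgB; [exact: cvg_cst|apply: cvgM; [exact: cvg_id|exact: cvg_cst]].
have c0 : 1 - 0 * x != 0 by rewrite mul0r subr0 oner_eq0.
have n0 : \forall t \near (0 : R), 0 < 1 - t * x.
  by apply: (cvgr_gt _ c); rewrite mul0r subr0.
apply: (@jet_near _ (fun t => a + a * x * t + t ^+ 2 * (a * x ^+ 2 / (1 - t * x)))).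
  near=> t; have : 0 < 1 - t * x by near: t.
  by move=> t0; field; rewrite gt_eqF.
exists (fun t => a * x ^+ 2 / (1 - t * x)); split=> //.
  by apply: cvgM; [exact: cvg_cst|exact: (cvgV c0 c)].
by rewrite mul0r subr0 divr1.
Unshelve. all: by end_near. Qed.

End MoreJets.

(** * Inverse concavity of [e_k / e_l] at second order *)

Section Core.
Variables (R : realType) (n : nat) (a : 'I_n -> R) (k l : nat).
Local Notation full := [set: 'I_n]%SET.
Hypotheses (a_ge0 : forall i, 0 <= a i) (lk : (l < k)%N) (ek0 : 0 < (gen a full)`_k).

Lemma coef_gen_gt0 m : (m <= k)%N -> 0 < (gen a full)`_m.
Proof.
move=> mk; rewrite lt_neqAle coef_gen_ge0 // andbT eq_sym; apply: contraTneq ek0 => e.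
rewrite -leNgt -(subnKC mk).
pose s := 1 + \sum_(i in full) a i.
have s0 : 0 < s by rewrite ltr_wpDr ?sumr_ge0.
by apply: le_trans (coef_gen_le a_ge0 s0 m (k - m) _) _; rewrite ?e ?mulr0 // lerDr.
Qed.

Definition ln_lin m (d : 'I_n -> R) := lin a m d / (gen a full)`_m.

Definition ln_quad m (c : 'I_n -> R) (H : 'I_n -> 'I_n -> R) :=
  (lin a m c + quad a m H) / (gen a full)`_m - ln_lin m (fun i => H i i) ^+ 2 / 2.

Definition posn : {set 'I_n} := [set i | 0 < a i]%SET.

(** The value 1 at zero entries satisfies the positivity asked by [ratio_gen2_concave]; [gen2] is
    only taken over [posn], where nothing has changed. *)
Let a' i := if 0 < a i then a i else 1.

Let a'_gt0 i : 0 < a' i.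
Proof. by rewrite /a'; case: ifP. Qed.

Let a'S i : i \in posn -> a' i = a i.
Proof. by rewrite finset.inE /a' => ->. Qed.

Let aS0 i : i \notin posn -> a i = 0.
Proof. by rewrite finset.inE -leNgt => ai; apply: le_anti; rewrite a_ge0 ai. Qed.

Let k_card : (k <= #|posn|)%N.
Proof. by rewrite leqNgt; apply/negP => kc; move: ek0; rewrite (gen_gen2 a'S aS0) coef_gen2_eq0 ?ltxx. Qed.

Variable x : 'I_n -> R.

Let H i j := if i == j then a i * x i else 0.
Let c i := a i * x i ^+ 2.
(** On the support of [a] the inverses [(1 - t * x i) / a i] are affine in [t], as concavity in the
    inverse variables requires; the price is the second order coefficient [c i]. *)
Let M t : 'M[R]_n := \matrix_(i, j) if i == j then a i / (1 - t * x i) else 0.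

Let jetM i j : jet (fun t => M t i j) (if i == j then a i else 0) (H i j) (if i == j then c i else 0).
Proof.
rewrite (_ : (fun t => _) = fun t => if i == j then a i / (1 - t * x i) else 0); last first.
  by apply: funext => t; rewrite mxE.
by rewrite /H; case: eqP => _; [exact: jet_div_lin|exact: jet_cst].
Qed.

Let jet_ln_esp m : (m <= k)%N ->
  jet (fun t => ln (esp (M t) m)) (ln (gen a full)`_m) (ln_lin m (fun i => H i i)) (ln_quad m c H).
Proof.
move=> mk; apply: jet_eq (jet_ln (coef_gen_gt0 mk) (jet_esp m jetM)) _ _ _ => //.
by rewrite /ln_quad; congr ((lin _ _ _ + _) / _ - _); apply: funext => i; rewrite eqxx.
Qed.

(** Midpoint concavity of [e_m / e_(m+1)] between the times [t] and [- t], read off at second order;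
    the square comes from passing to logarithms. *)
Lemma log_ratio_step m : (m < k)%N ->
  ln_quad m c H - ln_quad m.+1 c H + (ln_lin m (fun i => H i i) - ln_lin m.+1 (fun i => H i i)) ^+ 2 / 2 <= 0.
Proof.
move=> mk.
have E0 : {near (0 : R), (fun t => expR (ln (esp (M t) m) - ln (esp (M t) m.+1)))
                          =1 (fun t => esp (M t) m / esp (M t) m.+1)}.
  near=> t.
  have p0 : 0 < esp (M t) m.
    by near: t; apply: jet_gt0 (jet_esp m jetM) (coef_gen_gt0 (ltnW mk)).
  have p1 : 0 < esp (M t) m.+1.
    by near: t; apply: jet_gt0 (jet_esp m.+1 jetM) (coef_gen_gt0 mk).
  by rewrite expRD expRN !lnK.
pose r0 := expR (ln (gen a full)`_m - ln (gen a full)`_m.+1).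
pose w := ln_lin m (fun i => H i i) - ln_lin m.+1 (fun i => H i i).
have jr : jet (fun t => esp (M t) m / esp (M t) m.+1) r0 (r0 * w)
    (r0 * (ln_quad m c H - ln_quad m.+1 c H + w ^+ 2 / 2)).
  exact: jet_near E0 (jet_exp (jetD (jet_ln_esp (ltnW mk)) (jetN (jet_ln_esp mk)))).
have jl := jetZ 2^-1 (jetD jr (jet_flip jr)).
set r1 := (_ + w ^+ 2 / 2) in jl *.
have r0gt : 0 < r0 by exact: expR_gt0.
have jc : jet (fun=> esp (M 0) m / esp (M 0) m.+1) (2^-1 * (r0 + r0)) 0 0.
  rewrite (_ : 2^-1 * (r0 + r0) = r0); last by field.
  have -> : r0 = esp (M 0) m / esp (M 0) m.+1 by exact: (esym (jet_at0 jr)).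
  exact: jet_cst.
have [|_] := jet_le jl jc; last first.
  rewrite (_ : 2^-1 * _ = r0 * r1); last by field.
  by rewrite pmulr_rle0.
pose b t i := 1 - t * x i.
have bn : \forall t \near (0 : R), forall i, 0 < b t i.
  apply: (@filter_forall R 'I_n (fun i t => 0 < b t i) (nbhs (0 : R)) _) => i.
  have cb : {for 0, continuous (fun t : R => 1 - t * x i)}.
    by apply: cvgB; [exact: cvg_cst|apply: cvgM; [exact: cvg_id|exact: cvg_cst]].
  by apply: (cvgr_gt _ cb); rewrite mul0r subr0.
have bn' : \forall t \near (0 : R), forall i, 0 < b (- t) i.
  apply: (@filter_forall R 'I_n (fun i t => 0 < b (- t) i) (nbhs (0 : R)) _) => i.
  have cb : {for 0, continuous (fun t : R => 1 - (- t) * x i)}.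
    by apply: cvgB; [exact: cvg_cst|apply: cvgM; [apply: cvgN; exact: cvg_id|exact: cvg_cst]].
  by apply: (cvgr_gt _ cb); rewrite oppr0 mul0r subr0.
have E t m' : esp (M t) m' = (gen (fun i => a i / b t i) full)`_m' by rewrite /esp detX_diag.
near=> t.
have b1 : forall i, 0 < b t i by near: t.
have b2 : forall i, 0 < b (- t) i by near: t.
rewrite !E !(gen_div_ratio a'S aS0) //; last by move=> i; rewrite /b mul0r subr0.
rewrite mulrC.
have := ratio_gen2_concave a'_gt0 b1 b2 (leq_trans mk k_card).
congr (_ <= _ / _); congr (polyseq (gen2 a' _ posn))`_ _; apply: funext => i;
  by rewrite /b mul0r subr0 mulNr opprK; lra.
Unshelve. all: by end_near. Qed.

(** The steps from [l] to [k] are added one at a time; the Cauchy-Schwarz inequality for the [k - l]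
    increments of the first derivatives gives the denominator [2 * (k - l)%:R]. *)
Lemma log_ratio_concave :
  (ln_lin k (fun i => H i i) - ln_lin l (fun i => H i i)) ^+ 2 / (2 * (k - l)%:R)
  <= ln_quad k c H - ln_quad l c H.
Proof.
suff : forall j, (l + j <= k)%N ->
  (ln_lin (l + j) (fun i => H i i) - ln_lin l (fun i => H i i)) ^+ 2 / (2 * j%:R)
  <= ln_quad (l + j) c H - ln_quad l c H.
  by move=> /(_ (k - l)%N); rewrite (subnKC (ltnW lk)) => /(_ (leqnn k)).
elim=> [|j IH] jk'; first by rewrite addn0 !subrr expr0n mul0r.
rewrite addnS in jk' *; have := IH (ltnW jk'); have := log_ratio_step jk'.
set z := ln_lin (l + j) _; set z' := ln_lin (l + j).+1 _; set z0 := ln_lin l _.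
set u := ln_quad (l + j) _ _; set u' := ln_quad (l + j).+1 _ _; set u0 := ln_quad l _ _ => s1 s2.
apply: (@le_trans _ _ ((z - z0) ^+ 2 / (2 * j%:R) + (z - z') ^+ 2 / 2)); last by lra.
have [j0|j0] := posnP j.
  rewrite (_ : z0 = z) ?j0; last by rewrite /z0 /z j0 addn0.
  by rewrite subrr expr0n mul0r add0r mulr1 (_ : (z' - z) ^+ 2 = (z - z') ^+ 2) //; ring.
have j0' : 0 < j%:R :> R by rewrite ltr0n.
rewrite -subr_ge0 -(natr1 j).
have -> : (z - z0) ^+ 2 / (2 * j%:R) + (z - z') ^+ 2 / 2 - (z' - z0) ^+ 2 / (2 * (j%:R + 1))
  = ((z - z0) + j%:R * (z - z')) ^+ 2 / (2 * j%:R * (j%:R + 1)).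
  by field; rewrite !gt_eqF //; apply: ltr_wpDl; rewrite // ltW.
by rewrite divr_ge0 ?sqr_ge0 // mulr_ge0 ?mulr_ge0 ?ler0n // addr_ge0 // ltW.
Qed.

End Core.

(** * The algebraic core of the interior estimate *)

Section CoreIneq.
Variables (R : realType) (n : nat) (a : 'I_n -> R) (k l : nat).
Local Notation full := [set: 'I_n]%SET.
Local Notation e m := ((gen a full)`_m).
Hypotheses (a_ge0 : forall i, 0 <= a i) (lk : (l < k)%N) (ek0 : 0 < e k).

(** The gradient of [ln e_k - ln e_l] in the eigenvalues, that is, the coefficients of the
    linearized equation. *)
Definition ellq i := ell a k l full i / (e k * e l).
Definition offq i j := off a k l full i j / (e k * e l).

Let el0 : 0 < e l.
Proof. by apply: (coef_gen_gt0 a_ge0 ek0); exact: ltnW. Qed.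

Lemma ellq_ge0 i : 0 <= ellq i.
Proof.
by rewrite divr_ge0 ?(ltW (mulr_gt0 ek0 el0)) //; apply: ell_ge0 => //; rewrite finset.inE.
Qed.

Lemma lin_diff d : lin a k d / e k - lin a l d / e l = \sum_i d i * ellq i.
Proof.
rewrite /lin !mulr_suml -sumrB; apply: eq_bigr => i _.
by rewrite /ellq /ell; field; rewrite !gt_eqF.
Qed.

Lemma quad_diff H : quad a k H / e k - quad a l H / e l
  = (\sum_i \sum_(j in full :\ i) (H i i * H j j - H i j * H j i) * offq i j) / 2.
Proof.
rewrite /quad [_ / 2 / e k]mulrAC [_ / 2 / e l]mulrAC -mulrBl; congr (_ / 2); rewrite !mulr_suml -sumrB.
apply: eq_bigr => i _; rewrite !mulr_suml -sumrB; apply: eq_bigr => j _.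
by rewrite /offq /off; field; rewrite !gt_eqF.
Qed.

Lemma sum_swap (F : 'I_n -> 'I_n -> R) :
  \sum_i \sum_(j in full :\ i) F i j = \sum_i \sum_(j in full :\ i) F j i.
Proof.
under eq_bigr do rewrite big_mkcond.
rewrite exchange_big; apply: eq_bigr => i _; rewrite [RHS]big_mkcond; apply: eq_bigr => j _.
by rewrite !finset.inE eq_sym.
Qed.

(** This is [off_ell] divided by [a i * a j]. If one of them vanishes, so does [x], and both sides
    are zero. *)
Lemma pair_ineq i j (x : R) : j != i -> (a i = 0 \/ a j = 0 -> x = 0) ->
  x ^+ 2 * offq i j <= ellq i * x ^+ 2 / a j + ellq j * x ^+ 2 / a i.
Proof.
move=> ji xz.
have [ai|ai] := eqVneq (a i) 0; first by rewrite xz ?ai; [lra|left].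
have [aj|aj] := eqVneq (a j) 0; first by rewrite xz ?aj; [lra|right].
have ai0 : 0 < a i by rewrite lt_neqAle eq_sym ai a_ge0.
have aj0 : 0 < a j by rewrite lt_neqAle eq_sym aj a_ge0.
have -> : ellq i * x ^+ 2 / a j + ellq j * x ^+ 2 / a i
  = x ^+ 2 * (ellq i / a j + ellq j / a i) by ring.
apply: ler_wpM2l; first exact: sqr_ge0.
have : 0 <= a i * ell a k l full i + a j * ell a k l full j - a i * a j * off a k l full i j.
  by rewrite subr_ge0; apply: off_ell => //; rewrite finset.in_setT.
rewrite -subr_ge0 /ellq /offq.
move: (ell _ _ _ _ i) (ell _ _ _ _ j) (off _ _ _ _ i j) => u v w uvw.
have -> : u / (e k * e l) / a j + v / (e k * e l) / a i - w / (e k * e l)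
  = (a i * u + a j * v - a i * a j * w) / (a i * a j * (e k * e l)).
  by field; rewrite ai aj !gt_eqF.
by apply: divr_ge0 uvw (ltW _); rewrite !mulr_gt0.
Qed.

(** In the application [H] and [z] are third and fourth derivatives at the contact point, [phi] is
    the contribution of the barrier, [J] is the set of frame directions along which the tangent
    vector may be tilted, and [delta] is the size of the rows of [H] off [J]. *)
Variables (H : 'I_n -> 'I_n -> R) (z phi : 'I_n -> R) (J : {set 'I_n}) (K G C delta : R).
Hypothesis Hsym : forall i j, H i j = H j i.
Hypothesis Hz : forall i, 2 * (\sum_(j in J) H i j ^+ 2 / a j) + phi i <= z i.
Hypothesis H0 : forall i j, j \in J -> a j = 0 -> H i j = 0.
Hypothesis HJ : forall i j, i \notin J -> `|H i j| <= delta.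
Hypothesis HC : forall i j, `|H i j| <= C.
Hypothesis G1 : forall i j, `|offq i j| <= G.
Hypothesis G2 : forall i, 0 <= ('X * gen a (full :\ i))`_k / e k <= G.
Hypothesis G3 : forall i, 0 <= ('X * gen a (full :\ i))`_l / e l <= G.
Hypotheses (C0 : 0 <= C) (G0 : 0 <= G) (delta0 : 0 <= delta).

Local Notation d := (fun i => H i i).
Local Notation y1 := (ln_lin a).
Local Notation y2 := (ln_quad a).

Hypothesis eqn : y2 k (fun i => z i / 2) H - y2 l (fun i => z i / 2) H
  <= (y1 k d - y1 l d) ^+ 2 / (2 * (k - l)%:R) + K.

(** Off [J] no quadratic term is available to absorb a diagonal third derivative, so it is cut to
    zero at a cost proportional to [delta]. *)
Let d' i := if i \in J then H i i else 0.
Let x i := d' i / a i.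

Let ax i : a i * x i = d' i.
Proof.
rewrite /x; have [ai|ai] := eqVneq (a i) 0; last by rewrite mulrC divfK.
by rewrite ai mul0r /d'; case: ifP => // iJ; rewrite (H0 i iJ ai).
Qed.

Let d'C i : `|d' i| <= C.
Proof. by rewrite /d'; case: ifP => // _; rewrite normr0 C0. Qed.

Let dd' i : `|d i - d' i| <= delta.
Proof. by rewrite /d'; case: ifP => [_|/negbT iJ]; rewrite ?subrr ?normr0 // subr0 HJ. Qed.

Let y1_bound m u B : (forall i, 0 <= ('X * gen a (full :\ i))`_m / e m <= G) ->
  (forall i, `|u i| <= B) -> `|y1 m u| <= n%:R * (B * G).
Proof.
move=> Gm uB; rewrite /ln_lin /lin mulr_suml; apply: le_trans (ler_norm_sum _ _ _) _.
rewrite mulr_natl -[X in _ *+ X]card_ord -sumr_const; apply: ler_sum => i _.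
have /andP[p q] := Gm i.
by rewrite -mulrA normrM (ger0_norm p) ler_pM.
Qed.

Let y1B m u v : y1 m u - y1 m v = y1 m (fun i => u i - v i).
Proof.
by rewrite /ln_lin -mulrBl /lin -sumrB; congr (_ / _); apply: eq_bigr => i _; rewrite mulrBl.
Qed.

Let sqr_diff (u v B D : R) : `|u - v| <= D -> `|u| <= B -> `|v| <= B ->
  `|u ^+ 2 - v ^+ 2| <= D * (B + B).
Proof.
move=> uv uB vB; rewrite subr_sqr normrM; apply: ler_pM => //.
by apply: le_trans (ler_normD _ _) _; apply: lerD.
Qed.

Let y1_sqr m : (forall i, 0 <= ('X * gen a (full :\ i))`_m / e m <= G) ->
  `|y1 m d ^+ 2 - y1 m d' ^+ 2| <= n%:R ^+ 2 * (2 * G ^+ 2 * C * delta).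
Proof.
move=> Gm.
have := @sqr_diff (y1 m d) (y1 m d') (n%:R * (C * G)) (n%:R * (delta * G)).
rewrite y1B => /(_ (y1_bound Gm dd') (y1_bound Gm (fun i => HC i i)) (y1_bound Gm d'C)).
by congr (_ <= _); ring.
Qed.

Let Y u := y1 k u - y1 l u.

Let Y_sqr : `|Y d ^+ 2 - Y d' ^+ 2| <= n%:R ^+ 2 * (8 * G ^+ 2 * C * delta).
Proof.
have N (s t B : R) : `|s| <= B -> `|t| <= B -> `|s - t| <= B + B.
  by move=> sB tB; apply: le_trans (ler_normB _ _) _; apply: lerD.
have := @sqr_diff (Y d) (Y d') (n%:R * (C * G) + n%:R * (C * G))
  (n%:R * (delta * G) + n%:R * (delta * G)).
have -> : Y d - Y d' = (y1 k d - y1 k d') - (y1 l d - y1 l d') by rewrite /Y; ring.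
rewrite !y1B => /(_ (N _ _ _ (y1_bound G2 dd') (y1_bound G3 dd'))).
move=> /(_ (N _ _ _ (y1_bound G2 (fun i => HC i i)) (y1_bound G3 (fun i => HC i i)))).
move=> /(_ (N _ _ _ (y1_bound G2 d'C) (y1_bound G3 d'C))).
by congr (_ <= _); ring.
Qed.

Let Qd u := \sum_i \sum_(j in full :\ i) u i * u j * offq i j.

Let double_sum_le (F : 'I_n -> 'I_n -> R) B : 0 <= B -> (forall i j, j != i -> F i j <= B) ->
  \sum_i \sum_(j in full :\ i) F i j <= n%:R ^+ 2 * B.
Proof.
move=> B0 FB.
have -> : n%:R ^+ 2 * B = \sum_(i < n) \sum_(j < n) B.
  by rewrite !sumr_const card_ord -!mulrnA -natrX mulr_natl.
apply: ler_sum => i _; rewrite [X in _ <= X](bigID (mem (full :\ i))) /=.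
apply: ler_wpDr; first by apply: sumr_ge0.
by apply: ler_sum => j; rewrite !finset.inE andbT; exact: FB.
Qed.

Let Qd_diff : Qd d' - Qd d <= n%:R ^+ 2 * (G * C * delta).
Proof.
rewrite /Qd -sumrB; under eq_bigr do rewrite -sumrB.
apply: double_sum_le => [|i j ji]; first by rewrite !mulr_ge0 .
rewrite -mulrBl; apply: le_trans (ler_norm _) _; rewrite normrM mulrC -mulrA.
apply: ler_pM => //; rewrite /d'; case: ifP => iJ; case: ifP => jJ.
- by rewrite subrr normr0 mulr_ge0 .
- by rewrite mulr0 sub0r normrN normrM; apply: ler_pM => //; apply: HJ; rewrite jJ.
- by rewrite mul0r sub0r normrN normrM mulrC; apply: ler_pM => //; apply: HJ; rewrite iJ.
- by rewrite mul0r sub0r normrN normrM; apply: ler_pM => //; apply: HJ; rewrite jJ.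
Qed.

Let Qo := \sum_i \sum_(j in full :\ i) H i j ^+ 2 * offq i j.

Let P i j := if j \in J then ellq i * H i j ^+ 2 / a j else 0.

Let P_ge0 i j : 0 <= P i j.
Proof.
by rewrite /P; case: ifP => // _; rewrite divr_ge0 // mulr_ge0 ?sqr_ge0 ?ellq_ge0.
Qed.

(** For [i] and [j] in [J], [P i j + P j i] is the right side of [pair_ineq] and dominates the
    off-diagonal term, while [P i i] equals the diagonal term. Pairs that leave [J] are errors of
    size [G * C * delta]. *)
Let offdiag : \sum_i ellq i * (a i * x i ^+ 2) - n%:R ^+ 2 * (G * C * delta) / 2
  <= \sum_i \sum_j P i j - Qo / 2.
Proof.
have -> : \sum_i \sum_j P i j = \sum_i P i i + \sum_i \sum_(j in full :\ i) P i j.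
  rewrite -big_split; apply: eq_bigr => i _; rewrite (bigD1 i) //=; congr (_ + _).
  by apply: eq_bigl => j; rewrite !finset.inE andbT.
have -> : \sum_i \sum_(j in full :\ i) P i j
    = (\sum_i \sum_(j in full :\ i) (P i j + P j i)) / 2.
  under [in RHS]eq_bigr do rewrite big_split.
  by rewrite big_split /= -sum_swap; field.
have E1 : \sum_i ellq i * (a i * x i ^+ 2) <= \sum_i P i i.
  apply: ler_sum => i _; rewrite /P /x /d'; case: ifP => iJ; last by rewrite mul0r expr0n !mulr0.
  have [ai|ai] := eqVneq (a i) 0; first by rewrite (H0 i iJ ai) mul0r expr0n !mulr0 mul0r.
  by rewrite le_eqVlt; apply/orP; left; apply/eqP; field.
have E2 : Qo - \sum_i \sum_(j in full :\ i) (P i j + P j i) <= n%:R ^+ 2 * (G * C * delta).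
  rewrite /Qo -sumrB; under eq_bigr do rewrite -sumrB.
  apply: double_sum_le => [|i j ji]; first by rewrite !mulr_ge0 .
  have B0 : 0 <= G * C * delta by rewrite !mulr_ge0 .
  have [/andP[iJ jJ]|ij] := boolP ((i \in J) && (j \in J)).
    rewrite /P iJ jJ (Hsym j i); apply: le_trans B0; rewrite subr_le0.
    by apply: pair_ineq => // -[ai|aj]; [rewrite Hsym H0|rewrite H0].
  rewrite lerBlDr; apply: ler_wpDr; first by rewrite addr_ge0.
  apply: le_trans (ler_norm _) _; rewrite normrM mulrC -mulrA; apply: ler_pM => //.
  rewrite normrX expr2; move: ij; rewrite negb_and => /orP[iJ|jJ].
    by apply: ler_pM => //; apply: HJ.
  by apply: ler_pM => //; rewrite Hsym; apply: HJ.
lra.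
Qed.

(** [log_ratio_concave] at [x i = d' i / a i] cancels the square allowed by [eqn]. In units of
    [n%:R ^+ 2 * G * C * delta] the errors are one half each from [Qd_diff] and [offdiag], [4 * G]
    from [Y_sqr] and [G] from each of the two uses of [y1_sqr]: together [1 + 6 * G]. *)
Lemma interior_ineq :
  (\sum_i ellq i * phi i) / 2 <= K + n%:R ^+ 2 * (G * C * delta * (1 + 6 * G)).
Proof.
pose H' i j := if i == j then a i * x i else 0.
have H'd i : H' i i = d' i by rewrite /H' eqxx ax.
have Q1 : quad a k H / e k - quad a l H / e l = (Qd d - Qo) / 2.
  rewrite quad_diff /Qd /Qo -sumrB; congr (_ / 2); apply: eq_bigr => i _.
  by rewrite -sumrB; apply: eq_bigr => j _; rewrite (Hsym j i) -expr2 mulrBl.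
have Q2 : quad a k H' / e k - quad a l H' / e l = Qd d' / 2.
  rewrite quad_diff /Qd; congr (_ / 2); apply: eq_bigr => i _.
  apply: eq_bigr => j; rewrite !finset.inE andbT => ji.
  by rewrite !H'd {1}/H' eq_sym (negbTE ji) mul0r subr0.
have L := log_ratio_concave a_ge0 lk ek0 x.
have e1 m : y1 m (fun i => if i == i then a i * x i else 0) = y1 m d'.
  by congr (ln_lin _ _ _); apply: funext => i; rewrite eqxx ax.
rewrite !e1 in L.
have {}L : Y d' ^+ 2 / (2 * (k - l)%:R)
  <= \sum_i ellq i * (a i * x i ^+ 2) + Qd d' / 2 - (y1 k d' ^+ 2 - y1 l d' ^+ 2) / 2.
  apply: le_trans L _; rewrite /ln_quad !e1 -Q2.
  have := lin_diff (fun i => a i * x i ^+ 2).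
  under eq_bigr do rewrite mulrC.
  rewrite /H'; move=> <-; lra.
have E : \sum_i (z i / 2) * ellq i + (Qd d - Qo) / 2 - (y1 k d ^+ 2 - y1 l d ^+ 2) / 2
   <= Y d ^+ 2 / (2 * (k - l)%:R) + K.
  by apply: le_trans eqn; rewrite -lin_diff -Q1 /ln_quad; lra.
have Z : \sum_i \sum_j P i j + (\sum_i ellq i * phi i) / 2 <= \sum_i (z i / 2) * ellq i.
  rewrite mulr_suml -big_split; apply: ler_sum => i _ /=.
  have -> : \sum_j P i j = ellq i * \sum_(j in J) H i j ^+ 2 / a j.
    rewrite mulr_sumr [RHS]big_mkcond; apply: eq_bigr => j _.
    by rewrite /P; case: ifP => // _; rewrite -mulrA.
  by have := ler_wpM2l (ellq_ge0 i) (Hz i); lra.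
have D0 : 1 <= (k - l)%:R :> R by rewrite ler1n subn_gt0.
have S : Y d ^+ 2 / (2 * (k - l)%:R) <= Y d' ^+ 2 / (2 * (k - l)%:R)
    + n%:R ^+ 2 * (8 * G ^+ 2 * C * delta) / 2.
  rewrite -lerBlDl -mulrBl.
  have := Y_sqr; set w := _ ^+ 2 - _ ^+ 2; set B := n%:R ^+ 2 * _ => wB.
  have B0 : 0 <= B := le_trans (normr_ge0 _) wB.
  have DD : (0 : R) < 2 * (k - l)%:R by rewrite mulr_gt0 // (lt_le_trans ltr01).
  rewrite ler_pdivrMr //; apply: le_trans (le_trans (ler_norm _) wB) _.
  have := ler_wpM2l B0 D0; lra.
have S1 := y1_sqr G2; have S2 := y1_sqr G3.
move: S1 S2; rewrite !ler_norml => /andP[_ S1] /andP[S2 _].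
have := offdiag; have := Qd_diff; rewrite -/(Qd d').
lra.
Qed.

End CoreIneq.

(** * Functions of class C^k *)

Section DiffExt.
Variables (R : numFieldType) (V W : normedModType R).

Lemma near_eq_differentiable (f g : V -> W) (x : V) :
  {near x, f =1 g} -> differentiable f x -> differentiable g x.
Proof.
move=> fg df; have [dc fE] := (diff_locallyP _ _).1 df.
have gE : g \o shift x = cst (g x) + 'd f x +o_ 0 id.
  apply/eqaddoP => e e0; move/eqaddoP: fE => /(_ e e0) fE.
  have fg0 : \forall h \near (0 : V), f (h + x) = g (h + x).
    by move: fg; rewrite (near_shift 0) /= subr0.
  near=> h; have hE : f (h + x) = g (h + x) by near: h.
  have : `|(f \o shift x - (cst (f x) + 'd f x)) h| <= e * `|h| by near: h.
  by rewrite !fctE /= hE (nbhs_singleton fg).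
by apply/diff_locallyP; rewrite (diff_unique dc gE).
Unshelve. all: by end_near. Qed.

End DiffExt.

Section CkCalculus.
Variables (R : realType) (n : nat).
Local Notation V := 'rV[R]_n.+1.
Implicit Types (U : set V) (F G : V -> R) (x v : V).

Lemma open_nbhsW U x (P : V -> Prop) : open U -> U x -> (forall y, U y -> P y) ->
  \forall y \near x, P y.
Proof. by move=> oU Ux UP; near=> y; apply: UP; near: y; exact: open_nbhs_nbhs. 
Unshelve. all: by end_near. Qed.

Lemma Ck_differentiable k U F x : Ck k.+1 U F -> U x -> differentiable F x.
Proof. by move=> [+ _]; apply. Qed.

Lemma Ck_D k U F v : Ck k.+1 U F -> Ck k U ('D_v F).
Proof. by case=> _; apply. Qed.

Lemma Ck_continuous k U F x : open U -> Ck k U F -> U x -> {for x, continuous F}.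
Proof.
move=> oU; case: k => [|k] /=; last first.
  by move=> [Fd _] Ux; apply: differentiable_continuous; exact: Fd.
by rewrite continuous_open_subspace // => Fc Ux; apply: Fc; rewrite inE.
Qed.

Lemma CkW k U F : open U -> Ck k.+1 U F -> Ck k U F.
Proof.
move=> oU; elim: k F => [|k IH] F Fk.
  by rewrite /= continuous_open_subspace // => x /set_mem; exact: Ck_continuous Fk.
by split; [exact: Fk.1 | move=> v; apply: IH; exact: Fk.2].
Qed.

Lemma Ck_le j k U F : open U -> (j <= k)%N -> Ck k U F -> Ck j U F.
Proof.
move=> oU /subnKC <-; elim: (k - j)%N => [|m IH]; first by rewrite addn0.
by rewrite addnS => /(CkW oU).
Qed.

Lemma Ck_eq k U F G : open U -> (forall x, U x -> F x = G x) -> Ck k U F -> Ck k U G.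
Proof.
move=> oU; elim: k F G => [|k IH] F G FG.
  rewrite /= !continuous_open_subspace // => Fc x /[dup] xU /set_mem Ux.
  have e := open_nbhsW oU Ux FG.
  rewrite /continuous_at -(FG _ Ux); apply: cvg_trans (Fc x xU).
  by apply: (near_eq_cvg e).
case=> Fd FD; split=> [x Ux|v].
  by apply: near_eq_differentiable (Fd x Ux); exact: open_nbhsW oU Ux FG.
apply: (IH ('D_v F)); last exact: FD.
by move=> x Ux; apply: near_eq_derive; exact: open_nbhsW oU Ux FG.
Qed.

Lemma Ck_subset k U U' F : open U -> open U' -> U' `<=` U -> Ck k U F -> Ck k U' F.
Proof.
move=> oU oU' UU; elim: k F => [|k IH] F.
  by rewrite /= !continuous_open_subspace // => Fc x /set_mem/UU/mem_set; exact: Fc.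
by case=> Fd FD; split=> [x /UU|v]; [exact: Fd|apply: IH; exact: FD].
Qed.

Lemma Ck_cst k U (c : R) : Ck k U (cst c).
Proof.
elim: k c => [|k IH] c; first by apply: continuous_subspaceT => x; exact: cst_continuous.
split=> [x _|v]; first exact: differentiable_cst.
by rewrite (_ : 'D_v (cst c) = cst 0) //; apply: funext => x; rewrite derive_cst.
Qed.

Lemma CkD k U F G : open U -> Ck k U F -> Ck k U G -> Ck k U (F + G).
Proof.
move=> oU; elim: k F G => [|k IH] F G.
  rewrite /= !continuous_open_subspace // => Fc Gc x xU.
  exact: (continuousD (Fc x xU) (Gc x xU)).
case=> Fd FD [Gd GD]; split=> [x Ux|v]; first by apply: differentiableD; [exact: Fd|exact: Gd].
apply: (Ck_eq oU) (IH _ _ (FD v) (GD v)) => x Ux.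
by rewrite deriveD //; apply: diff_derivable; [exact: Fd|exact: Gd].
Qed.

Lemma CkM k U F G : open U -> Ck k U F -> Ck k U G -> Ck k U (F * G).
Proof.
move=> oU; elim: k F G => [|k IH] F G Fk Gk.
  move: Fk Gk; rewrite /= !continuous_open_subspace // => Fc Gc x xU.
  exact: (continuousM (Fc x xU) (Gc x xU)).
split=> [x Ux|v]; first by apply: differentiableM; [exact: Fk.1|exact: Gk.1].
apply: (Ck_eq oU) (CkD oU (IH _ _ (CkW oU Fk) (Gk.2 v)) (IH _ _ (CkW oU Gk) (Fk.2 v))).
by move=> x Ux; rewrite deriveM //; apply: diff_derivable; [exact: Fk.1|exact: Gk.1].
Qed.

Lemma Ck_sum k U (I : Type) (s : seq I) (F : I -> V -> R) : open U ->
  (forall i, Ck k U (F i)) -> Ck k U (fun x => \sum_(i <- s) F i x).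
Proof.
move=> oU FC; elim: s => [|i s IH].
  by apply: (Ck_eq oU) (Ck_cst k U 0) => x _; rewrite big_nil.
by apply: (Ck_eq oU) (CkD oU (FC i) IH) => x _; rewrite big_cons.
Qed.

Lemma derive_coord (i : 'I_n.+1) x v : 'D_v (fun y : V => y ord0 i) x = v ord0 i.
Proof.
have := congr1 (fun M : V => M ord0 i) (derive_mx (@derivable_id R V x v)).
by rewrite derive_id mxE => ->.
Qed.

Lemma Ck_coord k U (i : 'I_n.+1) : Ck k U (fun y : V => y ord0 i).
Proof.
case: k => [|k]; first by apply: continuous_subspaceT => x; exact: coord_continuous.
split=> [x _|v]; first exact: differentiable_coord.
rewrite (_ : 'D_v _ = cst (v ord0 i)); first exact: Ck_cst.
by apply: funext => x; rewrite derive_coord.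
Qed.

Lemma Ck_powR k U F (a : R) : open U -> (forall x, U x -> 0 < F x) -> Ck k U F ->
  Ck k U (fun x => F x `^ a).
Proof.
move=> oU F0; elim: k F F0 a => [|k IH] F F0 a Fk.
  move: Fk; rewrite /= !continuous_open_subspace // => Fc x xU.
  have gc : {for F x, continuous (fun y : R => y `^ a)}.
    apply: differentiable_continuous; apply/derivable1_diffP.
    by apply: ex_derive; apply: is_derive1_powR; apply: F0; exact: set_mem.
  exact: (continuous_comp (Fc x xU) gc).
have pd x : U x -> differentiable (fun y : R => y `^ a) (F x).
  move=> Ux; apply/derivable1_diffP.
  by apply: ex_derive; apply: is_derive1_powR; exact: F0.
split=> [x Ux|v].
  by apply: (@differentiable_comp _ _ _ _ F (fun y : R => y `^ a)); [exact: Fk.1|exact: pd].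
apply: (Ck_eq oU) (CkM oU (CkM oU (Ck_cst k U a) (IH F F0 (a - 1) (CkW oU Fk))) (Fk.2 v)).
move=> x Ux; have Fd := Fk.1 x Ux; have [ed ev] := is_derive1_powR a (F0 x Ux).
rewrite deriveE; last by apply: (@differentiable_comp _ _ _ _ F (fun y : R => y `^ a)) => //; exact: pd.
rewrite (@diff_comp _ _ _ _ F (fun y : R => y `^ a)) //; last exact: pd.
rewrite /= -(deriveE _ Fd) deriv1E // derive1E ev mulrC //.
Qed.

End CkCalculus.

Section Directional.
Variables (R : realType) (n : nat).
Local Notation V := 'rV[R]_n.+1.
Implicit Types (U : set V) (F G : V -> R) (x v : V).

Lemma deriveDdir F x v w : differentiable F x -> 'D_(v + w) F x = 'D_v F x + 'D_w F x.
Proof. by move=> Fd; rewrite !deriveE // linearD. Qed.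

Lemma deriveZdir F x (c : R) v : differentiable F x -> 'D_(c *: v) F x = c * 'D_v F x.
Proof. by move=> Fd; rewrite !deriveE // linearZ. Qed.

Lemma deriveNdir F x v : differentiable F x -> 'D_(- v) F x = - 'D_v F x.
Proof. by move=> Fd; rewrite -scaleN1r deriveZdir // mulN1r. Qed.

Lemma deriveBdir F x v w : differentiable F x -> 'D_(v - w) F x = 'D_v F x - 'D_w F x.
Proof. by move=> Fd; rewrite deriveDdir // deriveNdir. Qed.

Lemma derive_sumdir (I : Type) (s : seq I) F x (c : I -> R) (v : I -> V) :
  differentiable F x ->
  'D_(\sum_(i <- s) c i *: v i) F x = \sum_(i <- s) c i * 'D_(v i) F x.
Proof.
move=> Fd; elim: s => [|i s IH]; first by rewrite !big_nil deriveE // linear0.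
by rewrite !big_cons deriveDdir // deriveZdir // IH.
Qed.

Lemma eq_derive_on U F G x v : open U -> (forall y, U y -> F y = G y) -> U x ->
  'D_v F x = 'D_v G x.
Proof. by move=> oU FG Ux; apply: near_eq_derive; exact: open_nbhsW oU Ux FG. Qed.

Lemma derive2Zdir U F x u (c : R) v : open U -> Ck 2 U F -> U x ->
  'D_u ('D_(c *: v) F) x = c * 'D_u ('D_v F) x.
Proof.
move=> oU F2 Ux.
rewrite (@eq_derive_on U _ (c \*: 'D_v F)) //; last first.
  by move=> y Uy; rewrite deriveZdir //; exact: F2.1.
by rewrite deriveZ //; apply: diff_derivable; apply: (F2.2 _).1.
Qed.

Lemma differentiable_vec (Phi : V -> V) x :
  (forall i, differentiable (fun y => Phi y ord0 i) x) -> differentiable Phi x.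
Proof.
move=> Pd; rewrite (_ : Phi = \sum_(i < n.+1) (fun y => Phi y ord0 i *: ('e_i : V))); last first.
  by apply: funext => y; rewrite fct_sumE -row_sum_delta.
by apply: differentiable_sum => i; exact: differentiableZl.
Qed.

Lemma derive_vec (Phi : V -> V) x v i : differentiable Phi x ->
  'D_v (fun y => Phi y ord0 i) x = ('d Phi x v) ord0 i.
Proof. by move=> Pd; rewrite -deriveE // derive_mx ?mxE //; exact: diff_derivable. Qed.

Lemma derive_compE (Phi : V -> V) F x v :
  (forall i, differentiable (fun y => Phi y ord0 i) x) -> differentiable F (Phi x) ->
  'D_v (F \o Phi) x = \sum_(i < n.+1) 'D_v (fun y => Phi y ord0 i) x * 'D_('e_i) F (Phi x).
Proof.
move=> Pc Fd; have Pd := differentiable_vec Pc.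
rewrite deriveE; last exact: differentiable_comp.
rewrite diff_comp //= -[in RHS](eq_bigr _ (fun i _ => congr1 ( *%R^~ _) (esym (derive_vec v i Pd)))).
rewrite -(deriveE _ Fd) [in LHS](row_sum_delta ('d Phi x v)) derive_sumdir //.
Qed.

(** One order more is asked of [Phi], so that its coordinates are differentiable even at order 0 and
    the chain rule can be iterated. *)
Lemma Ck_comp k U U' (Phi : V -> V) F : open U -> open U' -> (forall x, U' x -> U (Phi x)) ->
  (forall i, Ck k.+1 U' (fun y => Phi y ord0 i)) -> Ck k U F -> Ck k U' (F \o Phi).
Proof.
move=> oU oU' UU; elim: k F => [|k IH] F Pk Fk.
  move: Fk; rewrite /= !continuous_open_subspace // => Fc x /set_mem xU.
  have Pc : {for x, continuous Phi}.
    by apply: differentiable_continuous; apply: differentiable_vec => i; exact: (Pk i).1.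
  by apply: (continuous_comp Pc); apply: Fc; exact/mem_set/UU.
have Pd x : U' x -> forall i, differentiable (fun y => Phi y ord0 i) x.
  by move=> Ux i; apply: (Pk i).1.
split=> [x Ux|v].
  apply: differentiable_comp; last exact/Fk.1/UU.
  by apply: differentiable_vec; exact: Pd.
apply: (@Ck_eq _ _ _ _ (fun x => \sum_(i < n.+1) 'D_v (fun y => Phi y ord0 i) x * ('D_('e_i) F \o Phi) x)) => //.
  by move=> x Ux; rewrite derive_compE //; [exact: Pd|exact/Fk.1/UU].
apply: Ck_sum => // i; apply: CkM => //; first by apply: CkW => //; exact: (Pk i).2.
by apply: IH; [move=> j; exact: CkW (Pk j)|exact: Fk.2].
Qed.

End Directional.

Section Curves.
Variables (R : realType) (n : nat).
Local Notation V := 'rV[R]_n.+1.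
Implicit Types (U : set V) (F : V -> R) (x u v w : V).

Lemma is_derive_scalel (f : R -> R) (t c : R) w :
  is_derive t 1 f c -> is_derive t 1 (fun s => f s *: w) (c *: w).
Proof.
move=> fd; have fD : differentiable f t by apply/derivable1_diffP; exact: ex_derive.
apply: DeriveDef; first by apply/derivable1_diffP; exact: differentiableZl.
rewrite deriveE; last exact: differentiableZl.
by rewrite diffZl //= -deriveE // derive_val.
Qed.

Lemma is_derive_comp_curve (g : R -> V) F (t : R) v :
  is_derive t 1 g v -> differentiable F (g t) -> is_derive t 1 (F \o g) ('D_v F (g t)).
Proof.
move=> gd Fd; have gD : differentiable g t by apply/derivable1_diffP; exact: ex_derive.
apply: DeriveDef; first by apply/derivable1_diffP; exact: differentiable_comp.
rewrite deriveE; last exact: differentiable_comp.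
have e : 'd g t 1 = v by rewrite -deriveE // derive_val.
by rewrite diff_comp //= e -deriveE.
Qed.

Lemma is_derive_line x u (t : R) : is_derive t 1 (fun s => x + s *: u) u.
Proof.
have h := @is_derive_scalel id t 1 u (is_derive_id t 1).
by apply: is_derive_eq; rewrite add0r scale1r.
Qed.

Lemma is_derive_parabola x u w (t : R) :
  is_derive t 1 (fun s => x + s *: u + s ^+ 2 *: w) (u + (2 * t) *: w).
Proof.
have h1 := is_derive_line x u t.
have h2 : is_derive t 1 (fun s : R => s ^+ 2) (2 * t).
  by apply: is_derive_eq; rewrite /GRing.scale /=; ring.
have h3 := is_derive_scalel w h2.
by apply: is_derive_eq.
Qed.

Lemma near_parabola U x u w : open U -> U x -> \forall t \near (0 : R), U (x + t *: u + t ^+ 2 *: w).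
Proof.
move=> oU Ux; have h := is_derive_parabola x u w 0.
have c : {for 0, continuous (fun s : R => x + s *: u + s ^+ 2 *: w)}.
  by apply: differentiable_continuous; apply/derivable1_diffP; exact: ex_derive.
apply: c; rewrite scale0r expr0n scale0r !addr0; exact: open_nbhs_nbhs.
Qed.

Lemma jet_parabola U F x u w : open U -> Ck 2 U F -> U x ->
  jet (fun t => F (x + t *: u + t ^+ 2 *: w)) (F x) ('D_u F x)
    ('D_u ('D_u F) x / 2 + 'D_w F x).
Proof.
move=> oU F2 Ux; pose g (t : R) := x + t *: u + t ^+ 2 *: w.
have g0 : g 0 = x by rewrite /g scale0r expr0n scale0r !addr0.
pose df t := 'D_u F (g t) + 2 * t * 'D_w F (g t).
have H : jet (F \o g) ((F \o g) 0) (df 0) (('D_u ('D_u F) x + 2 * 'D_w F x) / 2).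
  apply: jet_of_derive.
    near=> t; have Ug : U (g t) by near: t; exact: near_parabola.
    have Fd := F2.1 _ Ug.
    have := is_derive_comp_curve (is_derive_parabola x u w t) Fd.
    by rewrite deriveDdir // deriveZdir.
  have Fu v : differentiable ('D_v F) (g 0) by rewrite g0; exact: (F2.2 v).1.
  have gd : is_derive (0 : R) 1 g u.
    by have := is_derive_parabola x u w 0; rewrite mulr0 scale0r addr0.
  have h1 := is_derive_comp_curve gd (Fu u).
  have h2 := is_derive_comp_curve gd (Fu w).
  have h3 : is_derive (0 : R) 1 (fun t : R => 2 * t) 2.
    by apply: is_derive_eq; rewrite /GRing.scale /= !mulr1 ?mulr0 ?addr0.
  rewrite /df; apply: is_derive_eq; rewrite /GRing.scale /= g0 mulr0 mul0r add0r mulrC.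
  by rewrite mulrC.
apply: jet_eq H _ _ _; rewrite ?g0 //=.
- by rewrite g0.
- by rewrite /df g0 mulr0 mul0r addr0.
- by field.
Unshelve. all: by end_near. Qed.

Lemma jet_line U F x u : open U -> Ck 2 U F -> U x ->
  jet (fun t => F (x + t *: u)) (F x) ('D_u F x) ('D_u ('D_u F) x / 2).
Proof.
move=> oU F2 Ux; apply: (@jet_near _ (fun t => F (x + t *: u + t ^+ 2 *: 0))).
  by near=> t; rewrite scaler0 addr0.
apply: jet_eq (jet_parabola u 0 oU F2 Ux) _ _ _ => //.
by rewrite derive0 addr0.
Unshelve. all: by end_near. Qed.

(** The mean value theorem is applied along [u] and then along [v]. The mixed difference is
    symmetric in [u] and [v], so that [derive_comm] can equate the two orders of derivation at two
    points near [x]. *)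
Let second_difference U F x u v (r t : R) : Ck 2 U F -> ball x r `<=` U -> 0 < t ->
  t * (`|u| + `|v|) < r -> exists2 y, ball x r y &
  F (x + t *: u + t *: v) - F (x + t *: u) - (F (x + t *: v) - F x)
  = t ^+ 2 * 'D_v ('D_u F) y.
Proof.
move=> F2 bU t0 tr.
have inb s s' : 0 <= s <= t -> 0 <= s' <= t -> ball x r (x + s *: u + s' *: v).
  move=> /andP[s0 st] /andP[s0' st']; rewrite -ball_normE /ball_ /= -addrA opprD addNKr.
  rewrite normrN (le_lt_trans _ tr) // (le_trans (ler_normD _ _)) // mulrDr !normrZ.
  by rewrite lerD // ler_wpM2r // ger0_norm.
have itv (s : R) : s \in `[0, t] -> 0 <= s <= t by rewrite in_itv.
have tt : 0 <= t <= t by rewrite lexx ltW.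
have t0' : 0 <= (0 : R) <= t by rewrite lexx ltW.
pose g s := F (x + s *: u + t *: v) - F (x + s *: u).
pose g' s := 'D_u F (x + s *: u + t *: v) - 'D_u F (x + s *: u).
have gd (s : R) : s \in `[0, t] -> is_derive s 1 g (g' s).
  move=> /itv st.
  have l1 : is_derive s 1 (fun s => x + s *: u + t *: v) u.
    have -> : (fun s => x + s *: u + t *: v) = (fun s => (x + t *: v) + s *: u).
      by apply: funext => z; rewrite addrAC.
    exact: is_derive_line.
  have U1 := bU _ (inb _ _ st tt).
  have U2 : U (x + s *: u) by have := bU _ (inb _ _ st t0'); rewrite scale0r addr0.
  have h1 := is_derive_comp_curve l1 (F2.1 _ U1).
  have h2 := is_derive_comp_curve (is_derive_line x u s) (F2.1 _ U2).
  exact: is_deriveB.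
have [s sI E1] := @MVT_segment R g g' 0 t (ltW t0) (fun s sI => gd s (subset_itv_oo_cc sI))
  (derivable_within_continuous (fun s sI => @ex_derive _ _ _ _ _ _ _ (gd s sI))).
have st := itv _ sI.
pose h z := 'D_u F (x + s *: u + z *: v).
have hd (z : R) : z \in `[0, t] -> is_derive z 1 h ('D_v ('D_u F) (x + s *: u + z *: v)).
  move=> /itv zt; have U1 := bU _ (inb _ _ st zt).
  exact: is_derive_comp_curve (is_derive_line (x + s *: u) v z) ((F2.2 u).1 _ U1).
have [q qI E2] := @MVT_segment R h _ 0 t (ltW t0) (fun s sI => hd s (subset_itv_oo_cc sI))
  (derivable_within_continuous (fun s sI => @ex_derive _ _ _ _ _ _ _ (hd s sI))).
exists (x + s *: u + q *: v); first exact: inb st (itv _ qI).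
move: E1; rewrite /g /g' scale0r !addr0 subr0 => ->.
by move: E2; rewrite /h scale0r addr0 subr0 => ->; ring.
Qed.

Lemma derive_comm U F x u v : open U -> Ck 2 U F -> U x ->
  'D_u ('D_v F) x = 'D_v ('D_u F) x.
Proof.
move=> oU F2 Ux; apply/eqP; rewrite -subr_eq0 -normr_eq0; apply: contraT => N0.
pose e := `|'D_u ('D_v F) x - 'D_v ('D_u F) x| / 4.
have e0 : 0 < e by rewrite divr_gt0 // lt_neqAle eq_sym N0 normr_ge0.
have c w w' : \forall y \near x, `|'D_w ('D_w' F) x - 'D_w ('D_w' F) y| <= e.
  have cF : {for x, continuous ('D_w ('D_w' F))}.
    by apply: (@Ck_continuous _ _ 0 U) => //; apply: (F2.2 w').2.
  by move/cvgrPdist_le : cF; apply.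
have H : nbhs x (U `&` ([set y | `|'D_u ('D_v F) x - 'D_u ('D_v F) y| <= e]
    `&` [set y | `|'D_v ('D_u F) x - 'D_v ('D_u F) y| <= e])).
  apply: filterI; first exact: open_nbhs_nbhs.
  by apply: filterI; [exact: c u v|exact: c v u].
move/nbhs_ballP: H => [r /= r0 br].
pose t := r / (`|u| + `|v| + 1).
have d0 : 0 < `|u| + `|v| + 1 by rewrite ltr_wpDl ?addr_ge0.
have t0 : 0 < t by rewrite divr_gt0.
have tr : t * (`|u| + `|v|) < r.
  by rewrite /t mulrAC ltr_pdivrMr // ltr_pM2l // ltrDl.
have bU : ball x r `<=` U by move=> y /br[].
have [y yb E1] := @second_difference U F x u v r t F2 bU t0 tr.
have tr' : t * (`|v| + `|u|) < r by rewrite [`|v| + _]addrC.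
have [z bz E2] := @second_difference U F x v u r t F2 bU t0 tr'.
have E : 'D_v ('D_u F) y = 'D_u ('D_v F) z.
  have t20 : t ^+ 2 != 0 by rewrite expf_neq0 // gt_eqF.
  have E3 : t ^+ 2 * 'D_v ('D_u F) y = t ^+ 2 * 'D_u ('D_v F) z.
    apply: etrans (esym E1) (etrans _ E2).
    have -> : x + t *: v + t *: u = x + t *: u + t *: v by rewrite addrAC.
    by move: (F _) (F _) (F _) (F _) => f1 f2 f3 f4; ring.
  exact: (mulfI t20 E3).
have [_ [_ h1]] := br _ yb; have [_ [h2 _]] := br _ bz.
have : `|'D_u ('D_v F) x - 'D_v ('D_u F) x| <= e + e.
  apply: le_trans (ler_distD ('D_u ('D_v F) z) _ _) _; rewrite -{2}E [X in _ + X]distrC.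
  exact: lerD h2 h1.
rewrite /e leNgt => /negP; case.
have N1 : 0 < `|'D_u ('D_v F) x - 'D_v ('D_u F) x| by rewrite lt_neqAle eq_sym N0 normr_ge0.
by move: `|_ - _| N1 => q q0; clear -q0; lra.
Unshelve. all: by end_near. Qed.

End Curves.

(** * One-homogeneous extensions *)

Section Dot.
Variables (R : realType) (n : nat).
Local Notation V := 'rV[R]_n.+1.
Implicit Types (x y z u v : V).

Lemma dotC x y : dot x y = dot y x.
Proof. by apply: eq_bigr => i _; rewrite mulrC. Qed.

Lemma dotDl x y z : dot (x + y) z = dot x z + dot y z.
Proof. by rewrite -big_split; apply: eq_bigr => i _; rewrite mxE mulrDl. Qed.

Lemma dotZl (c : R) x y : dot (c *: x) y = c * dot x y.
Proof. by rewrite mulr_sumr; apply: eq_bigr => i _; rewrite mxE mulrA. Qed.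

Lemma dotNl x y : dot (- x) y = - dot x y.
Proof. by rewrite -scaleN1r dotZl mulN1r. Qed.

Lemma dotDr x y z : dot x (y + z) = dot x y + dot x z.
Proof. by rewrite dotC dotDl !(dotC x). Qed.

Lemma dotZr (c : R) x y : dot x (c *: y) = c * dot x y.
Proof. by rewrite dotC dotZl dotC. Qed.

Lemma dotNr x y : dot x (- y) = - dot x y.
Proof. by rewrite dotC dotNl dotC. Qed.

Lemma dot0l x : dot 0 x = 0.
Proof. by rewrite -(scale0r x) dotZl mul0r. Qed.

Lemma dot0r x : dot x 0 = 0.
Proof. by rewrite dotC dot0l. Qed.

Lemma dot_suml (I : Type) (s : seq I) (P : pred I) (F : I -> V) x :
  dot (\sum_(i <- s | P i) F i) x = \sum_(i <- s | P i) dot (F i) x.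
Proof. by elim/big_rec2: _ => [|i y z _ <-]; rewrite ?dot0l ?dotDl. Qed.

Lemma dot_ge0 x : 0 <= dot x x.
Proof. by apply: sumr_ge0 => i _; rewrite -expr2 sqr_ge0. Qed.

Lemma dot_eq0 x : (dot x x == 0) = (x == 0).
Proof.
apply/eqP/eqP => [x0|->]; last exact: dot0l.
apply/rowP => i; rewrite mxE; apply/eqP; rewrite -sqrf_eq0 expr2; apply/eqP.
by apply: (psumr_eq0P _ x0) => // j _; rewrite -expr2 sqr_ge0.
Qed.

Lemma dot_gt0 x : (0 < dot x x) = (x != 0).
Proof. by rewrite lt_neqAle eq_sym dot_eq0 dot_ge0 andbT. Qed.

Lemma dot_Elast x : dot x (Elast R n) = x ord0 ord_max.
Proof.
rewrite /dot (bigD1 ord_max) //= big1 ?addr0 => [|i /negbTE im]; rewrite mxE ?eqxx ?mulr1 //.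
by rewrite im mulr0.
Qed.

Lemma dot_Elast2 : dot (Elast R n) (Elast R n) = 1.
Proof. by rewrite dot_Elast mxE eqxx. Qed.

Lemma cauchy_schwarz x y : dot x y ^+ 2 <= dot x x * dot y y.
Proof.
have [->|y0] := eqVneq y 0; first by rewrite !dot0r expr0n mulr0.
have yy : 0 < dot y y by rewrite dot_gt0.
have := dot_ge0 (dot y y *: x - dot x y *: y).
rewrite !(dotDl, dotDr, dotNl, dotNr, dotZl, dotZr) (dotC y x).
rewrite (_ : _ + _ = dot y y * (dot x x * dot y y - dot x y ^+ 2)); last by ring.
by rewrite pmulr_rge0 // subr_ge0.
Qed.

End Dot.

Section Homogeneous.
Variables (R : realType) (n : nat) (c : 'rV[R]_n.+1).
Local Notation V := 'rV[R]_n.+1.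
Implicit Types (U : set V) (F G : V -> R) (x y v X Y : V).

(** Length and inverse length are real powers of [dot x x], so one rule for powers gives smoothness
    and derivatives of both away from 0. *)
Definition len x : R := dot x x `^ 2^-1.
Definition rho x : R := dot x x `^ (- 2^-1).
Definition proj x : V := rho x *: x + c.
Definition cone U : set V := [set x | x != 0 /\ U (proj x)].
Definition hom G x : R := len x * G (proj x).

Lemma len_sqr x (r : R) : 0 <= r -> dot x x = r ^+ 2 -> len x = r.
Proof. by move=> r0 xr; rewrite /len xr powR12_sqrt ?sqr_ge0 // sqrtr_sqr ger0_norm. Qed.

Lemma rhoE x : rho x = (len x)^-1.
Proof. by rewrite /rho powRN. Qed.

Lemma len_gt0 x : x != 0 -> 0 < len x.
Proof. by move=> x0; rewrite powR_gt0 // dot_gt0. Qed.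

Lemma lenZ (r : R) x : 0 < r -> len (r *: x) = r * len x.
Proof.
move=> r0; rewrite /len dotZl dotZr mulrA powRM ?mulr_ge0 ?dot_ge0 // 1?ltW //.
by rewrite powR12_sqrt ?mulr_ge0 1?ltW // -expr2 sqrtr_sqr gtr0_norm.
Qed.

Lemma projZ (r : R) x : 0 < r -> proj (r *: x) = proj x.
Proof.
move=> r0; rewrite /proj !rhoE lenZ // invfM scalerA mulrAC mulVf ?gt_eqF // mul1r //.
Qed.

Lemma coneZ U (r : R) x : 0 < r -> cone U x -> cone U (r *: x).
Proof.
by move=> r0 [x0 Ux]; split; [rewrite scaler_eq0 gt_eqF|rewrite projZ].
Qed.

Lemma homZ G (r : R) x : 0 < r -> hom G (r *: x) = r * hom G x.
Proof. by move=> r0; rewrite /hom lenZ // projZ // mulrA. Qed.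

Lemma unit_neq0 x : dot x x = 1 -> x != 0.
Proof. by move=> x1; rewrite -dot_gt0 x1. Qed.

Lemma len_unit x : dot x x = 1 -> len x = 1.
Proof. by move=> x1; apply: len_sqr; rewrite ?x1 ?expr1n. Qed.

Lemma rho_unit x : dot x x = 1 -> rho x = 1.
Proof. by move=> x1; rewrite rhoE len_unit // invr1. Qed.

Lemma proj_unit x : dot x x = 1 -> proj x = x + c.
Proof. by move=> x1; rewrite /proj rho_unit // scale1r. Qed.

Lemma hom_unit G x : dot x x = 1 -> hom G x = G (x + c).
Proof. by move=> x1; rewrite /hom len_unit // mul1r proj_unit. Qed.

Let punctured : set V := [set x | x != 0].

Lemma Ck_dotl k U v : open U -> Ck k U (fun x => dot x v).
Proof.
by move=> oU; apply: Ck_sum => // i; apply: CkM => //; [exact: Ck_coord|exact: Ck_cst].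
Qed.

Lemma Ck_dot2 k U : open U -> Ck k U (fun x => dot x x).
Proof. by move=> oU; apply: Ck_sum => // i; apply: CkM => //; exact: Ck_coord. Qed.

Lemma open_punctured : open punctured.
Proof.
rewrite (_ : punctured = (fun x : V => dot x x) @^-1` [set r | 0 < r]).
  apply: open_comp; last exact: open_gt.
  by move=> x _; apply: (@Ck_continuous _ _ 0 setT) => //; [exact: openT|exact: Ck_dot2 openT].
by apply/seteqP; split=> x /=; rewrite dot_gt0.
Qed.

Lemma Ck_len k : Ck k punctured len.
Proof.
apply: Ck_powR; [exact: open_punctured| |exact: Ck_dot2 open_punctured].
by move=> x; rewrite dot_gt0.
Qed.

Lemma Ck_rho k : Ck k punctured rho.
Proof.
apply: Ck_powR; [exact: open_punctured| |exact: Ck_dot2 open_punctured].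
by move=> x; rewrite dot_gt0.
Qed.

Lemma Ck_proj k i : Ck k punctured (fun x => proj x ord0 i).
Proof.
have oP := open_punctured.
apply: (Ck_eq oP) (CkD oP (CkM oP (Ck_rho k) (Ck_coord k punctured i)) (Ck_cst k punctured (c ord0 i))).
by move=> x _; rewrite /proj !mxE.
Qed.

Lemma open_cone U : open U -> open (cone U).
Proof.
move=> oU; rewrite openE => x [x0 Ux].
have pc : {for x, continuous proj}.
  apply: differentiable_continuous; apply: differentiable_vec => i.
  exact: (Ck_proj 1 i).1.
have h1 : \forall y \near x, U (proj y) by apply: pc; exact: open_nbhs_nbhs.
have h2 : \forall y \near x, y != 0 by apply: open_nbhs_nbhs; split=> //; exact: open_punctured.
by apply: filterS2 h1 h2 => y.
Qed.

Let cone_punctured U : cone U `<=` punctured.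
Proof. by move=> x []. Qed.

Lemma Ck_comp_proj k U G : open U -> Ck k U G -> Ck k (cone U) (G \o proj).
Proof.
move=> oU Gk; apply: (Ck_comp oU (open_cone oU)) => // [x []//|i].
exact: (Ck_subset open_punctured (open_cone oU) (@cone_punctured U) (Ck_proj _ i)).
Qed.

Lemma Ck_hom k U G : open U -> Ck k U G -> Ck k (cone U) (hom G).
Proof.
move=> oU Gk; apply: (CkM (open_cone oU)); last exact: Ck_comp_proj.
exact: (Ck_subset open_punctured (open_cone oU) (@cone_punctured U) (Ck_len _)).
Qed.

Lemma derive_dotl v x X : 'D_X (fun y => dot y v) x = dot X v.
Proof.
rewrite (_ : (fun y => dot y v) = \sum_(i < n.+1) (fun y : V => y ord0 i * v ord0 i)); last first.
  by apply: funext => y; rewrite fct_sumE.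
rewrite derive_sum => [|i].
  apply: eq_bigr => i _; rewrite deriveM ?derive_coord ?derive_cst //.
    by rewrite scaler0 add0r /GRing.scale /= mulrC.
  exact/diff_derivable/differentiable_coord.
apply: derivableM; last exact: derivable_cst.
exact/diff_derivable/differentiable_coord.
Qed.

Lemma derive_dot2 x X : 'D_X (fun y => dot y y) x = 2 * dot x X.
Proof.
have dc i : derivable (fun y : V => y ord0 i) x X by exact/diff_derivable/differentiable_coord.
rewrite (_ : (fun y => dot y y) = \sum_(i < n.+1) (fun y : V => y ord0 i * y ord0 i)); last first.
  by apply: funext => y; rewrite fct_sumE.
rewrite derive_sum => [|i]; last exact: derivableM.
rewrite mulr_sumr; apply: eq_bigr => i _; rewrite deriveM // derive_coord /GRing.scale /=.
by ring.
Qed.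

Lemma derive_powdot (a : R) x X : x != 0 ->
  'D_X (fun y => dot y y `^ a) x = 2 * a * dot x X * dot x x `^ (a - 1).
Proof.
move=> x0; have p0 : 0 < dot x x by rewrite dot_gt0.
have Fd : differentiable (fun y => dot y y) x by apply: (Ck_dot2 1 openT).1.
have [ed ev] := is_derive1_powR a p0.
have pd : differentiable (fun y : R => y `^ a) (dot x x) by exact/derivable1_diffP.
rewrite deriveE; last by apply: (@differentiable_comp _ _ _ _ (fun y => dot y y) (fun y : R => y `^ a)).
rewrite (@diff_comp _ _ _ _ (fun y => dot y y) (fun y : R => y `^ a)) //=.
rewrite -(deriveE _ Fd) deriv1E // derive1E ev derive_dot2 /GRing.scale /=.
by ring.
Qed.

Lemma derive_len x X : x != 0 -> 'D_X len x = dot x X * rho x.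
Proof.
move=> x0; rewrite derive_powdot // /rho (_ : 2^-1 - 1 = - 2^-1 :> R); last by field.
by field.
Qed.

Lemma rho3 x : x != 0 -> dot x x `^ (- 2^-1 - 1) = rho x ^+ 3.
Proof.
move=> x0; rewrite (_ : - 2^-1 - 1 = - 2^-1 * 3%:R :> R); last by field.
by rewrite powRrM powR_mulrn // powR_ge0.
Qed.

Lemma derive_rho x X : x != 0 -> 'D_X rho x = - (dot x X * rho x ^+ 3).
Proof. by move=> x0; rewrite derive_powdot // rho3 //; field. Qed.

Lemma derive_comp_proj U G x X : open U -> Ck 1 U G -> cone U x ->
  'D_X (G \o proj) x = rho x * 'D_X G (proj x) - rho x ^+ 3 * dot x X * 'D_x G (proj x).
Proof.
move=> oU G1 [x0 Ux]; have Gd := G1.1 _ Ux.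
rewrite derive_compE // => [|i]; last exact: (Ck_proj 1 i).1.
have -> : rho x * 'D_X G (proj x) - rho x ^+ 3 * dot x X * 'D_x G (proj x)
  = 'D_(rho x *: X - (rho x ^+ 3 * dot x X) *: x) G (proj x).
  by rewrite deriveBdir // !deriveZdir.
rewrite [in RHS](row_sum_delta (_ - _)) derive_sumdir //; apply: eq_bigr => i _; congr (_ * _).
have rd : derivable rho x X by apply: diff_derivable; exact: (Ck_rho 1).1.
have dc : derivable (fun y : V => y ord0 i) x X by exact/diff_derivable/differentiable_coord.
have -> : (fun y => proj y ord0 i) = (rho * (fun y : V => y ord0 i)) + cst (c ord0 i).
  by apply: funext => y; rewrite /proj !mxE.
rewrite (deriveD (derivableM rd dc) (derivable_cst _ _ _)) derive_cst addr0 (deriveM rd dc).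
rewrite derive_coord (derive_rho _ x0) /GRing.scale /= !mxE.
by move: (rho x) (dot x X) (x _ _) (X _ _) => p q r s; ring.
Qed.

Lemma derive_homE U G x Y : open U -> Ck 1 U G -> cone U x ->
  'D_Y (hom G) x = dot x Y * (rho x * G (proj x)) + 'D_Y G (proj x)
    - dot x Y * (rho x ^+ 2 * 'D_x G (proj x)).
Proof.
move=> oU G1 Kx; have [x0 Ux] := Kx.
have ld : derivable len x Y by apply: diff_derivable; exact: (Ck_len 1).1.
have gd : derivable (G \o proj) x Y by apply: diff_derivable; apply: (Ck_comp_proj oU G1).1.
rewrite (_ : hom G = len * (G \o proj)) // (deriveM ld gd) (derive_len _ x0) (derive_comp_proj _ oU G1 Kx).
have L0 := len_gt0 x0; rewrite /GRing.scale /= rhoE.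
move: (len x) L0 ('D_Y G _) ('D_x G _) (G _) (dot x Y) => L L0 p q r s.
by field; rewrite gt_eqF.
Qed.

Lemma derive_hom_unit U G x X : open U -> Ck 1 U G -> dot x x = 1 -> U (x + c) ->
  'D_X (hom G) x = 'D_X G (x + c) + dot x X * (G (x + c) - 'D_x G (x + c)).
Proof.
move=> oU G1 x1 Ux.
rewrite (derive_homE _ oU) //; last by split; [exact: unit_neq0|rewrite proj_unit].
by rewrite proj_unit // rho_unit //; ring.
Qed.

(** The part of the first derivative that involves the length carries the factor [dot y Y], which
    vanishes at [x]. Its cofactor [B] therefore contributes only its value there, and this value
    gives the terms of [Wform] in [dot X Y]. *)
Lemma derive2_hom_unit U G x X Y : open U -> Ck 2 U G -> dot x x = 1 -> U (x + c) ->
  dot x X = 0 -> dot x Y = 0 ->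
  'D_X ('D_Y (hom G)) x = 'D_X ('D_Y G) (x + c) - 'D_x G (x + c) * dot X Y + G (x + c) * dot X Y.
Proof.
move=> oU G2 x1 Ux xX xY; have oK := open_cone oU.
have Kx : cone U x by split; [exact: unit_neq0|rewrite proj_unit].
have G1 := CkW oU G2.
pose A (y : V) := dot y Y.
(* The derivative of [G] in the moving direction [y] is expanded in coordinates, which makes its
   differentiability in [y] visible. *)
pose B y := rho y * G (proj y) - rho y ^+ 2 * \sum_(i < n.+1) y ord0 i * ('D_('e_i) G \o proj) y.
have E y : cone U y -> 'D_Y (hom G) y = (A * B + ('D_Y G \o proj)) y.
  move=> Ky; rewrite (derive_homE _ oU) // !fctE /A /B /=.
  have Gd : differentiable G (proj y) by apply: G1.1; case: Ky.
  rewrite -(derive_sumdir _ (fun i => y ord0 i) (fun i => 'e_i) Gd) -row_sum_delta.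
  by move: (rho y) (dot y Y) (G _) ('D_Y G _) ('D_y G _) => p q r s t; ring.
have Ad : derivable A x X by apply: diff_derivable; apply: (Ck_dotl 1 Y openT).1.
have cP k F : Ck k punctured F -> Ck k (cone U) F.
  exact: (Ck_subset open_punctured oK (@cone_punctured U)).
have Bd : derivable B x X.
  apply: diff_derivable; apply: (@Ck_differentiable _ _ 0 (cone U)) => //.
  have r1 := cP 1 _ (Ck_rho 1).
  have B2i i := CkM oK (Ck_coord 1 (cone U) i) (Ck_comp_proj oU (Ck_D ('e_i) G2)).
  have B2 := Ck_sum (index_enum 'I_n.+1) oK B2i.
  have B3 := CkD oK (CkM oK r1 (Ck_comp_proj oU G1))
    (CkM oK (Ck_cst 1 (cone U) (-1)) (CkM oK (CkM oK r1 r1) B2)).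
  by apply: (@Ck_eq _ _ _ _ _ _ oK _ B3) => y _; rewrite /B !fctE /= mulN1r expr2.
have Cd : derivable ('D_Y G \o proj) x X.
  by apply: diff_derivable; apply: (Ck_differentiable (Ck_comp_proj oU (Ck_D Y G2)) Kx).
have e1 := eq_derive_on X oK E Kx.
apply: (etrans e1); rewrite (deriveD (derivableM Ad Bd) Cd) (deriveM Ad Bd).
rewrite (derive_comp_proj _ oU (Ck_D Y G2) Kx) derive_dotl /GRing.scale /=.
have A0 : A x = 0 := xY.
have Gd : differentiable G (proj x) by apply: G1.1; case: Kx.
have Bx : B x = G (x + c) - 'D_x G (x + c).
  rewrite /B /= -(derive_sumdir _ (fun i => x ord0 i) (fun i => 'e_i) Gd) -row_sum_delta.
  by rewrite (proj_unit x1) (rho_unit x1) expr1n !mul1r.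
rewrite A0 Bx xX (proj_unit x1) (rho_unit x1).
move: ('D_X B x) ('D_X ('D_Y G) (x + c)) ('D_x ('D_Y G) (x + c)) => p q r.
by move: ('D_x G (x + c)) (G (x + c)) (dot X Y) => s t w; ring.
Qed.

End Homogeneous.

Section Sigma.
Variables (R : realType).

Lemma coef_gen_sigma n (lam : 'I_n -> R) k : (gen lam [set: 'I_n]%SET)`_k = sigma k lam.
Proof.
rewrite /gen (eq_bigl predT) => [|i]; last by rewrite finset.inE.
under eq_bigr do rewrite addrC.
rewrite bigA_distr coef_sum /sigma [RHS]big_mkcond /=.
apply: eq_big => // J _.
have -> : \prod_i (if i \in J then lam i *: 'X else 1) = (\prod_(i in J) lam i) *: 'X^#|J| :> {poly R}.
  rewrite -big_mkcond /= -sum1_card; elim/big_rec3: _ => [|i p q r _ ->].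
    by rewrite expr0 scale1r.
  by rewrite exprS -scalerAl -scalerAr scalerA.
by rewrite coefZ coefXn eq_sym; case: eqP => _; rewrite ?mulr1 ?mulr0.
Qed.

Lemma gen_lift0 n (a : 'I_n.+1 -> R) : a ord0 = 0 ->
  gen a [set: 'I_n.+1]%SET = gen (fun i => a (lift ord0 i)) [set: 'I_n]%SET.
Proof.
move=> a0; rewrite /gen (eq_bigl predT) => [|i]; last by rewrite finset.inE.
rewrite big_ord_recl a0 scale0r addr0 mul1r; apply: eq_bigl => i.
by rewrite finset.inE.
Qed.

Lemma detX_conj n (Q M : 'M[R]_n) : Q *m Q^T = 1%:M -> detX (Q *m M *m Q^T) = detX M.
Proof.
move=> QQ; pose q : 'M[{poly R}]_n := map_mx polyC Q.
have E (A : 'M[R]_n) : detX A = \det (1%:M + 'X *: map_mx polyC A).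
  congr (\det _); apply/matrixP => i j; rewrite !mxE mulrC mul_polyC.
  by case: eqP.
have qq : q *m q^T = 1%:M by rewrite matrix.map_trmx -map_mxM QQ map_scalar_mx.
rewrite !E !map_mxM -matrix.map_trmx -/q; set m := map_mx _ M.
have -> : 1%:M + 'X *: (q *m m *m q^T) = q *m (1%:M + 'X *: m) *m q^T.
  by rewrite mulmxDr mulmxDl mulmx1 qq -scalemxAr -scalemxAl.
by rewrite !det_mulmx mulrAC -det_mulmx qq det1 mul1r.
Qed.

End Sigma.

Section Compactness.
Variables (R : realType) (n : nat).
Local Notation V := 'rV[R]_n.+1.

Lemma Ck0_continuous (F : V -> R) : Ck 0 setT F -> continuous F.
Proof. by move=> F0 x; apply: (Ck_continuous openT F0). Qed.

Lemma continuous_dotl (v : V) : continuous (fun x : V => dot x v).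
Proof. by apply: Ck0_continuous; apply: Ck_dotl; exact: openT. Qed.

Lemma continuous_dot2 : continuous (fun x : V => dot x x).
Proof. by apply: Ck0_continuous; apply: Ck_dot2; exact: openT. Qed.

Lemma compact_sphere : compact [set x : V | dot x x = 1].
Proof.
apply: bounded_closed_compact.
  exists 1; split => // M M1 x /= x1; apply: le_trans (ltW M1).
  rewrite /Num.Def.normr /= mx_normrE; apply/bigmax_leP; split=> // -[i j] _ /=.
  rewrite -(@ler_pXn2r _ 2) ?nnegrE // expr1n real_normK ?num_real //.
  rewrite -x1 /dot (bigD1 j) //= (ord1 i) expr2 lerDl.
  by apply: sumr_ge0 => k _; rewrite -expr2 sqr_ge0.
rewrite (_ : [set x | _] = (fun x : V => dot x x) @^-1` [set 1]) //.
by apply: closed_comp; [move=> x _; exact: continuous_dot2|exact: closed_eq].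
Qed.

End Compactness.

(** * Orthonormal eigenbases extending prescribed eigenvectors *)

Section Spectral.
Variables (R : realType) (n : nat).
Local Notation V := 'rV[R]_n.+1.
Implicit Types (v w : 'I_n.+1 -> V) (B : V -> V -> R).

Definition sym_bilin B : Prop :=
  (forall X Y, B X Y = B Y X) /\ (forall a X Y Z, B (a *: X + Y) Z = a * B X Z + B Y Z).

Section Bilin.
Variable B : V -> V -> R.
Hypothesis BB : sym_bilin B.

Lemma bilinC X Y : B X Y = B Y X. Proof. exact: BB.1. Qed.

Lemma bilin0 X : B 0 X = 0.
Proof. by have := BB.2 (-1) 0 0 X; rewrite scaler0 addr0; lra. Qed.

Lemma bilinD X Y Z : B (X + Y) Z = B X Z + B Y Z.
Proof. by rewrite -{1}(scale1r X) BB.2 mul1r. Qed.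

Lemma bilinZ a X Z : B (a *: X) Z = a * B X Z.
Proof. by rewrite -[a *: X]addr0 BB.2 bilin0 addr0. Qed.

Lemma bilin_sum (I : Type) (s : seq I) (F : I -> V) Z :
  B (\sum_(i <- s) F i) Z = \sum_(i <- s) B (F i) Z.
Proof. by elim/big_rec2: _ => [|i y z _ <-]; rewrite ?bilin0 ?bilinD. Qed.

Lemma bilin_line X Y t :
  B (X + t *: Y) (X + t *: Y) = B X X + 2 * t * B X Y + t ^+ 2 * B Y Y.
Proof.
rewrite bilinD bilinZ (bilinC X) (bilinC Y) !bilinD !bilinZ (bilinC Y X).
by ring.
Qed.

End Bilin.

Definition onb v : Prop := forall i j, dot (v i) (v j) = (i == j)%:R.

Lemma onb_mx v : onb v -> (\matrix_i v i) *m (\matrix_i v i)^T = 1%:M.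
Proof.
move=> vo; apply/matrixP => i j; rewrite !mxE -vo.
by apply: eq_bigr => k _; rewrite !mxE.
Qed.

Lemma onb_expand v x : onb v -> x = \sum_i dot x (v i) *: v i.
Proof.
move=> vo; have /mulmx1C vo' := onb_mx vo.
rewrite -[LHS]mulmx1 -vo' mulmxA mulmx_sum_row; apply: eq_bigr => i _.
rewrite rowK; congr (_ *: _); rewrite !mxE; apply: eq_bigr => k _.
by rewrite !mxE.
Qed.

Lemma onb_parseval v x y : onb v -> dot x y = \sum_i dot x (v i) * dot y (v i).
Proof.
move=> vo; rewrite {1}(onb_expand x vo) dot_suml; apply: eq_bigr => i _.
by rewrite dotZl (dotC y).
Qed.

Lemma detX_onb B v w : sym_bilin B -> onb v -> onb w ->
  detX (\matrix_(i, j) B (v i) (v j)) = detX (\matrix_(i, j) B (w i) (w j)).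
Proof.
move=> BB vo wo; pose Q : 'M[R]_n.+1 := \matrix_(i, a) dot (v i) (w a).
have QQ : Q *m Q^T = 1%:M.
  apply/matrixP => i j; rewrite !mxE -vo (onb_parseval _ _ wo).
  by apply: eq_bigr => k _; rewrite !mxE.
rewrite -(detX_conj (\matrix_(i, j) B (w i) (w j)) QQ); congr detX.
apply/matrixP => i j; rewrite !mxE {1}(onb_expand (v j) wo) (bilinC BB) (bilin_sum BB).
apply: eq_bigr => b _; rewrite (bilinZ BB) !mxE mulrC; congr (_ * _).
rewrite (bilinC BB) {1}(onb_expand (v i) wo) (bilin_sum BB).
by apply: eq_bigr => a _; rewrite (bilinZ BB) !mxE.
Qed.

Lemma continuous_bilin2 B : sym_bilin B -> continuous (fun x => B x x).
Proof.
move=> BB; apply: Ck0_continuous.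
have E (x : V) : B x x = \sum_i (fun y : V => y ord0 i) x * (\sum_j (fun y : V => y ord0 j) x * B 'e_j 'e_i).
  rewrite {1}(row_sum_delta x) (bilin_sum BB); apply: eq_bigr => i _.
  rewrite (bilinZ BB); congr (_ * _); rewrite (bilinC BB) {1}(row_sum_delta x) (bilin_sum BB).
  by apply: eq_bigr => j _; rewrite (bilinZ BB).
apply: (@Ck_eq _ _ 0 setT _ _ openT (fun x _ => esym (E x))).
apply: Ck_sum; first exact: openT.
move=> i; apply: (CkM openT); first exact: Ck_coord.
apply: Ck_sum; first exact: openT.
by move=> j; apply: (CkM openT); [exact: Ck_coord|exact: Ck_cst].
Qed.

Let orth_on (m : nat) (v : nat -> V) := forall i j, (i < m)%N -> (j < m)%N -> dot (v i) (v j) = (i == j)%:R.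

Let eigen_on B (m : nat) (v : nat -> V) := forall i, (i < m)%N ->
  exists a, forall Y, B (v i) Y = a * dot (v i) Y.

(** The Rayleigh quotient is minimized over unit vectors orthogonal to the given eigenvectors. The
    prescribed list matters because later bases must contain the base point and the contact
    vector. *)
Lemma eigen_extend B m (v : nat -> V) : sym_bilin B -> (m < n.+1)%N ->
  orth_on m v -> eigen_on B m v -> exists w : V, [/\ dot w w = 1,
    forall i, (i < m)%N -> dot w (v i) = 0 & exists a, forall Y, B w Y = a * dot w Y].
Proof.
move=> BB mn vo ve.
pose A := [set x : V | dot x x = 1] `&` [set x : V | forall i : 'I_m, dot x (v i) = 0].
have A0 : A !=set0.
  pose P : 'M[R]_(m, n.+1) := \matrix_(i < m) v i.
  have : kermx P^T != 0.
    rewrite kermx_eq0 /row_free mxrank_tr; apply: contraTneq mn => e.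
    by rewrite -leqNgt -e rank_leq_row.
  rewrite -nz_row_eq0; set x := nz_row _ => x0.
  have xP : x *m P^T = 0 by apply/sub_kermxP; exact: nz_row_sub.
  have xx : 0 < dot x x by rewrite dot_gt0.
  exists ((Num.sqrt (dot x x))^-1 *: x); split => /=.
    by rewrite dotZl dotZr mulrA -expr2 exprVn sqr_sqrtr ?ltW // mulVf // gt_eqF.
  move=> i; rewrite dotZl; have /matrixP/(_ ord0 i) := xP.
  rewrite !mxE => e; rewrite (_ : dot x (v i) = 0) ?mulr0 //.
  by rewrite -e; apply: eq_bigr => k _; rewrite !mxE.
have cA : compact A.
  apply: subclosed_compact (@compact_sphere R n) _; last by move=> x [].
  apply: closedI.
    rewrite (_ : [set x | _] = (fun x : V => dot x x) @^-1` [set 1]) //.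
    by apply: closed_comp; [move=> x _; exact: continuous_dot2|exact: closed_eq].
  rewrite (_ : [set x | _] = \bigcap_(i in [set: 'I_m]) [set x : V | dot x (v i) = 0]); last first.
    by apply/seteqP; split=> [x h i _|x h i]; [exact: h|exact: h].
  apply: closed_bigI => i _.
  rewrite (_ : [set x | _] = (fun x : V => dot x (v i)) @^-1` [set 0]) //.
  by apply: closed_comp; [move=> x _; exact: continuous_dotl|exact: closed_eq].
have [x /set_mem [/= x1 xv] xmin] := compact_EVT_min A0 cA
  (continuous_subspaceT (continuous_bilin2 BB)).
have min y : (forall i : 'I_m, dot y (v i) = 0) -> B x x * dot y y <= B y y.
  move=> yv; have [->|y0] := eqVneq y 0; first by rewrite dot0l mulr0 (bilin0 BB).
  have yy : 0 < dot y y by rewrite dot_gt0.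
  have s2 : Num.sqrt (dot y y) ^+ 2 = dot y y by rewrite sqr_sqrtr // ltW.
  have := xmin ((Num.sqrt (dot y y))^-1 *: y).
  rewrite (bilinZ BB) (bilinC BB) (bilinZ BB) mulrA -expr2 exprVn s2 mulrC ler_pdivlMr //.
  apply; apply/mem_set; split=> /=; last by move=> i; rewrite dotZl yv mulr0.
  by rewrite dotZl dotZr mulrA -expr2 exprVn s2 mulVf // gt_eqF.
have orth y : (forall i : 'I_m, dot y (v i) = 0) -> dot x y = 0 -> B x y = 0.
  move=> yv xy; pose q := B y y - B x x * dot y y.
  have H (t : R) : 0 <= 2 * t * B x y + t ^+ 2 * q.
    have z0 i : dot (x + t *: y) (v (nat_of_ord (i : 'I_m))) = 0.
      by rewrite dotDl dotZl xv yv mulr0 addr0.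
    have := min _ z0; rewrite -subr_ge0 /q.
    have -> : dot (x + t *: y) (x + t *: y) = 1 + t ^+ 2 * dot y y.
      by rewrite !(dotDl, dotDr, dotZl, dotZr) (dotC y) xy x1; ring.
    have -> : B (x + t *: y) (x + t *: y) = B x x + 2 * t * B x y + t ^+ 2 * B y y.
      rewrite (bilinD BB) (bilinZ BB) (bilinC BB x) (bilinC BB y) !(bilinD BB) !(bilinZ BB).
      by rewrite (bilinC BB y x); ring.
    by congr (_ <= _); ring.
  have q1 : 0 < 1 + q ^+ 2 by rewrite ltr_wpDr ?sqr_ge0.
  apply/eqP; apply: contraT => b0.
  have b2 : 0 < B x y ^+ 2 by rewrite exprn_even_gt0.
  (* This time makes the expression negative whatever the sign of [q], because [2 + 2 q^2 - q] is
     positive. *)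
  have := H (- B x y / (1 + q ^+ 2)).
  have -> : 2 * (- B x y / (1 + q ^+ 2)) * B x y + (- B x y / (1 + q ^+ 2)) ^+ 2 * q
    = - (B x y ^+ 2 * (2 + 2 * q ^+ 2 - q) / (1 + q ^+ 2) ^+ 2).
    by field; rewrite gt_eqF.
  rewrite oppr_ge0 leNgt divr_gt0 ?exprn_gt0 // mulr_gt0 //.
  by have := sqr_ge0 (q - 1); have := sqr_ge0 q; move: q {H q1} => q; nra.
exists x; split=> // [i im|]; first exact: (xv (Ordinal im)).
exists (B x x) => Y; pose Z := Y - dot x Y *: x - \sum_(i < m) dot (v i) Y *: v i.
have xvs (i : 'I_m) : B x (v i) = 0.
  by have [a av] := ve i (ltn_ord i); rewrite (bilinC BB) av dotC xv mulr0.
have Zv (i : 'I_m) : dot Z (v i) = 0.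
  rewrite !dotDl !dotNl dotZl xv mulr0 subr0 dot_suml (bigD1 i) //= big1 => [|j ji].
    by rewrite dotZl vo // eqxx mulr1 addr0 dotC subrr.
  by rewrite dotZl vo // (negbTE (_ : nat_of_ord j != i)) ?mulr0.
have xZ : dot x Z = 0.
  rewrite dotC !dotDl !dotNl dotZl x1 mulr1 (dotC Y) subrr sub0r dot_suml big1 ?oppr0 // => i _.
  by rewrite dotZl [dot (v i) x]dotC xv mulr0.
have YE : Y = dot x Y *: x + (\sum_(i < m) dot (v i) Y *: v i + Z).
  by rewrite /Z addrA -[Y - _ - _]addrA -opprD addrC subrK.
rewrite {1}YE (bilinC BB) (bilinD BB) (bilinZ BB) (bilinD BB) (bilin_sum BB).
rewrite big1 => [|i _]; last by rewrite (bilinZ BB) (bilinC BB) xvs mulr0.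
by rewrite (bilinC BB Z) (orth _ Zv xZ) !addr0 mulrC.
Qed.

Lemma eigenbasis B m (v : nat -> V) : sym_bilin B -> (m <= n.+1)%N ->
  orth_on m v -> eigen_on B m v -> exists w : 'I_n.+1 -> V, [/\ onb w,
    forall i : 'I_n.+1, (i < m)%N -> w i = v i &
    forall i, exists a, forall Y, B (w i) Y = a * dot (w i) Y].
Proof.
move=> BB; move Ed : (n.+1 - m)%N => d; elim: d m v Ed => [|d IH] m v Ed mn vo ve.
  have mE : m = n.+1 by apply/eqP; rewrite eqn_leq mn -subn_eq0 Ed.
  exists (fun i => v (nat_of_ord i)); split=> // [i j|i].
    by rewrite vo ?mE // (inj_eq (@ord_inj _)).
  by apply: ve; rewrite mE.
have mn' : (m < n.+1)%N by rewrite -subn_gt0 Ed.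
have [x [x1 xv xe]] := eigen_extend BB mn' vo ve.
pose v' i := if (i < m)%N then v i else x.
have [||||w [wo wv we]] := IH m.+1 v'.
- by rewrite subnS Ed.
- by [].
- move=> i j; rewrite !ltnS /v' => im' jm'; case: (ltnP i m) => im; case: (ltnP j m) => jm.
  + exact: vo.
  + by rewrite dotC xv // (_ : (i == j) = false) // ltn_eqF // (leq_trans im jm).
  + by rewrite xv // (_ : (i == j) = false) // gtn_eqF // (leq_trans jm im).
  + by rewrite x1 (_ : i = j) ?eqxx //; apply/eqP; rewrite eqn_leq (leq_trans im' jm) (leq_trans jm' im).
- by move=> i _; rewrite /v'; case: ltnP => // /ve.
exists w; split=> // i im; rewrite wv ?ltnS; last exact: ltnW.
by rewrite /v' im.
Qed.

End Spectral.

(** * Uniform bounds on the linearized operator *)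

Section AlgBounds.
Variables (R : realType) (n : nat) (a : 'I_n -> R) (k l : nat) (s r0 : R).
Local Notation full := [set: 'I_n]%SET.
Local Notation e m := ((gen a full)`_m).
Hypotheses (a_ge0 : forall i, 0 <= a i) (lk : (l < k)%N) (ek0 : 0 < e k).
Hypotheses (s0 : 0 < s) (r00 : 0 < r0) (as_ : \sum_(i in full) a i <= s) (rk : r0 * e l <= e k).

(** [slope] bounds [e_(k-1) / e_k]: a power of [s] leads from [e_(k-1)] to [e_l], and [r0] bounds
    [e_k / e_l] from below. In [bound], first derivatives are covered by [slope] and mixed ones by
    its square; [low] is [r0] over the constant of [ell_lower]. *)
Definition slope : R := s ^+ (k.-1 - l) / r0.
Definition bound : R := slope + 2 * slope ^+ 2.
Definition low : R := r0 / (k%:R * (s + s) ^+ 2 * s ^+ (k.-1 - l)).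

Lemma slope_gt0 : 0 < slope.
Proof. by rewrite divr_gt0 // exprn_gt0. Qed.

Lemma low_gt0 : 0 < low.
Proof.
have k0 : 0 < k%:R :> R by rewrite ltr0n (leq_ltn_trans _ lk).
by rewrite divr_gt0 // !mulr_gt0 ?exprn_gt0 ?addr_gt0.
Qed.

Let el0 : 0 < e l.
Proof. by apply: (coef_gen_gt0 a_ge0 ek0); exact: ltnW. Qed.

(** By log-concavity the quotients [e_j / e_(j+1)] increase with [j], so the last of them bounds
    all. *)
Let e_slope j : (j < k)%N -> e j <= slope * e j.+1.
Proof.
have kE : k.-1.+1 = k by rewrite prednK // (leq_ltn_trans _ lk).
have lk' : (l <= k.-1)%N by rewrite -ltnS kE.
move=> jk; have jk' : (j <= k.-1)%N by rewrite -ltnS kE.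
have ek1 : e k.-1 <= slope * e k.
  have H : e k.-1 <= s ^+ (k.-1 - l) * e l.
    by rewrite -{1}(subnKC lk'); exact: coef_gen_le.
  apply: le_trans H _; rewrite /slope -mulrA; apply: ler_wpM2l; first exact/exprn_ge0/ltW.
  by rewrite mulrC ler_pdivlMr // mulrC.
have [_ /(_ j k.-1 1 jk')] := gen_log_concave full a_ge0.
rewrite /gap !addn1 kE subr_ge0 => L.
have ej := coef_gen_ge0 full j.+1 a_ge0.
rewrite -(ler_pM2r ek0); apply: le_trans L _; rewrite [X in X <= _]mulrC [X in _ <= X]mulrAC.
exact: (ler_wpM2r ej ek1).
Qed.

Let e_ge0 j : 0 <= e j. Proof. exact: coef_gen_ge0. Qed.

Let X1_bound m i : (m <= k)%N -> 0 < e m -> 0 <= ('X * gen a (full :\ i))`_m / e m <= slope.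
Proof.
move=> mk em; apply/andP; split.
  exact: divr_ge0 (coef_genX_ge0 _ _ a_ge0) (ltW em).
rewrite ler_pdivrMr // coefXM; case: m mk em => [|m] mk em /=.
  exact: mulr_ge0 (ltW slope_gt0) (e_ge0 _).
by apply: le_trans (e_slope mk); exact: coef_gen_sub.
Qed.

Let X2_bound m i j : (m <= k)%N -> 0 < e m ->
  0 <= ('X * ('X * gen a (full :\ i :\ j)))`_m / e m <= slope ^+ 2.
Proof.
move=> mk em; have sl := slope_gt0.
have g0 d : 0 <= (gen a (full :\ i :\ j))`_d by exact: coef_gen_ge0.
apply/andP; split.
  apply: divr_ge0 (ltW em); rewrite !coefXM; clear mk em; case: m => [|[|m]] //=.
rewrite ler_pdivrMr // !coefXM.
have z0 m' : 0 <= slope ^+ 2 * e m' by apply: mulr_ge0; [exact: sqr_ge0|].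
case: m mk em => [|[|m]] mk em //=.
apply: le_trans (coef_gen_sub _ _ _ _) _ => //; apply: le_trans (coef_gen_sub _ _ _ _) _ => //.
apply: le_trans (e_slope (ltnW mk)) _.
rewrite (_ : slope ^+ 2 * e m.+2 = slope * (slope * e m.+2)); last by rewrite expr2 mulrA.
by apply: ler_wpM2l; [exact: ltW|exact: e_slope].
Qed.

Lemma bound_gt0 : 0 < bound.
Proof. by have := slope_gt0; rewrite /bound => h; have := sqr_ge0 slope; lra. Qed.

Lemma lin_bound m i : (m <= k)%N -> 0 < e m -> 0 <= ('X * gen a (full :\ i))`_m / e m <= bound.
Proof.
move=> mk em; have /andP[-> h] := X1_bound i mk em; apply: le_trans h _.
by rewrite /bound; have := sqr_ge0 slope; lra.
Qed.

Lemma offq_bound i j : `|offq a k l i j| <= bound.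
Proof.
have /andP[p1 p2] := X2_bound i j (leqnn k) ek0.
have /andP[p3 p4] := X2_bound i j (ltnW lk) el0.
have -> : offq a k l i j = ('X * ('X * gen a (full :\ i :\ j)))`_k / e k
   - ('X * ('X * gen a (full :\ i :\ j)))`_l / e l.
  by rewrite /offq /off; field; rewrite !gt_eqF.
have := slope_gt0; move: p1 p2 p3 p4; rewrite /bound.
set x := _ / e k; set y := _ / e l; move: (slope ^+ 2) => z p1 p2 p3 p4 p5.
by rewrite ler_norml; apply/andP; split; lra.
Qed.

Lemma ellq_bound i : ellq a k l i <= bound.
Proof.
have /andP[p1 p2] := lin_bound i (leqnn k) ek0; have /andP[p3 p4] := lin_bound i (ltnW lk) el0.
have -> : ellq a k l i = ('X * gen a (full :\ i))`_k / e k - ('X * gen a (full :\ i))`_l / e l.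
  by rewrite /ellq /ell; field; rewrite !gt_eqF.
lra.
Qed.

Lemma ellq_low i : low <= ellq a k l i.
Proof.
have iI : i \in full by rewrite finset.inE.
have := ell_lower a_ge0 lk s0 iI as_; set c := _ * s ^+ _ => H.
have c0 : 0 < c by rewrite !mulr_gt0 ?exprn_gt0 ?addr_gt0 // ltr0n (leq_ltn_trans _ lk).
rewrite /low /ellq -/c ler_pdivrMr // mulrAC ler_pdivlMr ?mulr_gt0 //.
rewrite [_ * c]mulrC; apply: le_trans H; rewrite expr2 mulrCA ler_pM2l //.
Qed.

End AlgBounds.

Lemma jet_uniq (R : realType) (f : R -> R) (a b c a' b' c' : R) :
  jet f a b c -> jet f a' b' c' -> [/\ a = a', b = b' & c = c'].
Proof.
move=> j1 j2; have aa : a = a' by rewrite -(jet_at0 j1) (jet_at0 j2).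
rewrite -aa in j2; have ff : \forall t \near (0 : R), f t <= f t by near=> t.
have [bb cc] := jet_le j1 j2 ff; have [_ cc'] := jet_le j2 j1 ff.
by split=> //; apply: le_anti; rewrite cc cc'.
Unshelve. all: by end_near. Qed.

(** * Homogeneity and Euler relations for the derivatives of [h] *)

Section HomogeneousDerivatives.
Variables (R : realType) (n : nat) (K : set 'rV[R]_n.+1).
Local Notation V := 'rV[R]_n.+1.
Hypotheses (oK : open K) (KZ : forall (r : R) x, 0 < r -> K x -> K (r *: x)).
Implicit Types (x X Y a b c : V) (G : V -> R).

Lemma derive_homog G (c : R -> R) (r : R) x X : Ck 1 K G ->
  (forall (s : R) y, 0 < s -> K y -> G (s *: y) = c s * G y) -> 0 < r -> K x ->
  'D_X G (r *: x) = c r / r * 'D_X G x.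
Proof.
move=> G1 Gc r0 Kx; have Gd := G1.1 _ Kx; have Gd' := G1.1 _ (KZ r0 Kx).
have x0 : x + 0 *: X = x by rewrite scale0r addr0.
have rx0 : r *: x + 0 *: (r *: X) = r *: x by rewrite scale0r addr0.
have d1 := is_derive_comp_curve (is_derive_line x X 0) (eq_rect_r (fun z => differentiable G z) Gd x0).
have d2 := is_derive_comp_curve (is_derive_line (r *: x) (r *: X) 0)
  (eq_rect_r (fun z => differentiable G z) Gd' rx0).
rewrite x0 in d1; rewrite rx0 deriveZdir // in d2.
have d3 : is_derive (0 : R) 1 (fun t => c r * G (x + t *: X)) (c r * 'D_X G x).
  have h := is_deriveZ (c r) (df := 'D_X G x) (f := fun t : R => G (x + t *: X)) (x := 0) (v := 1).
  exact: h.
have nK : \forall t \near (0 : R), K (x + t *: X).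
  by have := near_parabola X 0 oK Kx; apply: filterS => t; rewrite scaler0 addr0.
have d4 : is_derive (0 : R) 1 (G \o (fun s => r *: x + s *: (r *: X))) (c r * 'D_X G x).
  apply: near_eq_is_derive d3; near=> t; rewrite /= -Gc //.
    by rewrite scalerDr !scalerA mulrC.
  by near: t.
have := @derive_val _ _ _ _ _ _ _ d2; rewrite (@derive_val _ _ _ _ _ _ _ d4) => e.
by apply: (mulfI (lt0r_neq0 r0)); rewrite -e mulrA mulrCA mulfV ?mulr1 // gt_eqF.
Unshelve. all: by end_near. Qed.

(** On the ray through [x] the function is [c (1 + t) * G x]; comparing expansions gives Euler's
    relations to second order, with the direction frozen at [x]. *)
Lemma jet_radial G (c : R -> R) x (b d : R) : Ck 2 K G ->
  (forall (s : R) y, 0 < s -> K y -> G (s *: y) = c s * G y) -> K x ->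
  jet (fun t => c (1 + t)) 1 b d -> 'D_x G x = b * G x /\ 'D_x ('D_x G) x = 2 * d * G x.
Proof.
move=> G2 Gc Kx cj; have j1 := jet_line x oK G2 Kx.
have j2 : jet (fun t => G (x + t *: x)) (G x * 1) (G x * b) (G x * d).
  apply: jet_near (jetZ (G x) cj); near=> t.
  have t0 : 0 < 1 + t.
    have : `|t| < 1 by near: t; exists 1 => //= y; rewrite /ball_ /= sub0r normrN.
    by rewrite ltr_norml => /andP[]; lra.
  have -> : x + t *: x = (1 + t) *: x by rewrite scalerDl scale1r.
  by rewrite Gc // mulrC.
have [_ -> e] := jet_uniq j1 j2; split; first by rewrite mulrC.
by rewrite -[LHS](@divfK _ 2) ?pnatr_eq0 // e; ring.
Unshelve. all: by end_near. Qed.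

Variable h : V -> R.
Hypotheses (h4 : Ck 4 K h) (hZ : forall (r : R) x, 0 < r -> K x -> h (r *: x) = r * h x).

Lemma CD1 Y : Ck 3 K ('D_Y h). Proof. exact: Ck_D h4. Qed.
Lemma CD2 X Y : Ck 2 K ('D_X ('D_Y h)). Proof. exact: Ck_D (CD1 Y). Qed.

Lemma D1_homog (r : R) x Y : 0 < r -> K x -> 'D_Y h (r *: x) = 1 * 'D_Y h x.
Proof.
move=> r0 Kx; rewrite (derive_homog _ (Ck_le oK (isT : (1 <= 4)%N) h4) hZ r0 Kx).
by rewrite divff // gt_eqF.
Qed.

Lemma D2_homog (r : R) x X Y : 0 < r -> K x -> 'D_X ('D_Y h) (r *: x) = r^-1 * 'D_X ('D_Y h) x.
Proof.
move=> r0 Kx.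
have := @derive_homog ('D_Y h) (fun=> 1) r x X (Ck_le oK (isT : (1 <= 3)%N) (CD1 Y)).
by move=> ->; rewrite ?div1r // => s y s0 Ky; rewrite D1_homog.
Qed.

Lemma euler_D1 x Y : K x -> 'D_x ('D_Y h) x = 0.
Proof.
move=> Kx.
have Gc (s : R) y : 0 < s -> K y -> 'D_Y h (s *: y) = (fun=> 1) s * 'D_Y h y by exact: D1_homog.
have [-> _] := jet_radial (Ck_le oK (isT : (2 <= 3)%N) (CD1 Y)) Gc Kx (jet_cst 1).
by rewrite mul0r.
Qed.

Lemma euler_D2 x X Y : K x -> 'D_x ('D_X ('D_Y h)) x = - 'D_X ('D_Y h) x /\
  'D_x ('D_x ('D_X ('D_Y h))) x = 2 * 'D_X ('D_Y h) x.
Proof.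
move=> Kx.
have Gc (s : R) y : 0 < s -> K y -> 'D_X ('D_Y h) (s *: y) = s^-1 * 'D_X ('D_Y h) y.
  exact: D2_homog.
have J : jet (fun t : R => (1 + t)^-1) 1 (-1) 1.
  have := jet_div_lin (1 : R) (-1); rewrite mulrN1 sqrrN expr1n mulr1.
  by apply: jet_near; near=> t; rewrite mulrN1 opprK div1r.
have [e1 e2] := jet_radial (CD2 X Y) Gc Kx J; rewrite mulN1r in e1; rewrite mulr1 in e2.
by split; [exact: e1 | exact: e2].
Unshelve. all: by end_near. Qed.

Lemma D2_bilin x : K x -> sym_bilin (fun X Y => 'D_X ('D_Y h) x).
Proof.
move=> Kx; split=> [X Y|a X Y Z]; first exact: derive_comm oK (Ck_le oK (isT : (2 <= 4)%N) h4) Kx.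
have Gd : differentiable ('D_Z h) x by exact: (CD1 Z).1.
by rewrite deriveDdir // deriveZdir.
Qed.

Lemma D2C a b x : K x -> 'D_a ('D_b h) x = 'D_b ('D_a h) x.
Proof. by move=> Kx; exact: (bilinC (D2_bilin Kx)). Qed.

Lemma D3C12 a b c x : K x -> 'D_a ('D_b ('D_c h)) x = 'D_b ('D_a ('D_c h)) x.
Proof. by move=> Kx; exact: derive_comm oK (Ck_le oK (isT : (2 <= 3)%N) (CD1 c)) Kx. Qed.

Lemma D3C23 a b c x : K x -> 'D_a ('D_b ('D_c h)) x = 'D_a ('D_c ('D_b h)) x.
Proof. by move=> Kx; apply: (eq_derive_on a oK _ Kx) => y; exact: D2C. Qed.

(** The exchange of fourth derivatives brings no curvature terms: this is the gain of replacing the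
    tensor on the sphere by the flat Hessian of the extension. *)
Lemma D4C a b x : K x -> 'D_a ('D_a ('D_b ('D_b h))) x = 'D_b ('D_b ('D_a ('D_a h))) x.
Proof.
move=> Kx.
transitivity ('D_a ('D_b ('D_a ('D_b h))) x).
  by apply: (eq_derive_on a oK _ Kx) => y; exact: D3C12.
transitivity ('D_b ('D_a ('D_a ('D_b h))) x); first exact: derive_comm oK (CD2 a b) Kx.
transitivity ('D_b ('D_a ('D_b ('D_a h))) x).
  by apply: (eq_derive_on b oK _ Kx) => y; exact: D3C23.
by apply: (eq_derive_on b oK _ Kx) => y; exact: D3C12.
Qed.

End HomogeneousDerivatives.

(** * The touching barrier *)

Section Contact.
Variables (R : realType) (n : nat) (K : set 'rV[R]_n.+1).
Local Notation V := 'rV[R]_n.+1.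
Hypotheses (oK : open K) (KZ : forall (r : R) x, 0 < r -> K x -> K (r *: x)).
Variable h : V -> R.
Hypotheses (h4 : Ck 4 K h) (hZ : forall (r : R) x, 0 < r -> K x -> h (r *: x) = r * h x).
Variable ct : R.
Implicit Types (x X Y Z xi : V).

Definition capS : set V := [set x | dot x x = 1 /\ ct <= x ord0 ord_max].
Hypothesis SK : capS `<=` K.

Local Notation B x X Y := ('D_X ('D_Y h) x).

(** For orthonormal [x0] and [xi] this is [1 + t ^+ 2] times a rational parametrization of the great
    circle with initial velocity [2 *: xi]. Being polynomial it is within reach of [jet_parabola],
    and homogeneity takes care of the length. *)
Definition arc x0 xi (t : R) : V := x0 + t *: (2 *: xi) + t ^+ 2 *: (- x0).

Lemma jet_sq : jet (fun t : R => t ^+ 2) 0 0 1.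
Proof.
by apply: jet_eq (jetM (jet_id R) (jet_id R)) _ _ _; ring.
Qed.

Lemma jet_inv_sq : jet (fun t : R => (1 + t ^+ 2)^-1) 1 0 (-1).
Proof.
have g : jet (fun s : R => (1 + (0 + s))^-1) 1 (-1) 1.
  have := jet_div_lin (1 : R) (-1); rewrite mulrN1 sqrrN expr1n mulr1.
  by apply: jet_near; near=> t; rewrite mulrN1 opprK div1r add0r.
apply: jet_eq (@jet_comp R (fun s => (1 + s)^-1) _ _ _ _ _ _ _ g jet_sq) _ _ _ => //; ring.
Unshelve. all: by end_near. Qed.

Lemma jet_weighted (f g w : R -> R) (a b c b' c' z b'' c'' : R) :
  jet f a b c -> jet g 0 b' c' -> jet w z b'' c'' ->
  jet (fun t => (1 + t ^+ 2) * (f t + 2 * (t * g t) + t ^+ 2 * w t)) a b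
    (c + 2 * b' + z + a).
Proof.
move=> jf jg jw.
have J := jetM (jetD (jet_cst 1) jet_sq)
  (jetD (jetD jf (jetZ 2 (jetM (jet_id R) jg))) (jetM jet_sq jw)).
by apply: jet_eq J _ _ _; ring.
Qed.

Section Arc.
Variables (x0 xi : V).
Hypotheses (x01 : dot x0 x0 = 1) (xi1 : dot xi xi = 1) (x0xi : dot x0 xi = 0).

Lemma dot_arcl t Y : dot (arc x0 xi t) Y = (1 - t ^+ 2) * dot x0 Y + 2 * t * dot xi Y.
Proof. by rewrite /arc !dotDl !dotZl dotNl; ring. Qed.

Lemma dot_arc t : dot (arc x0 xi t) (arc x0 xi t) = (1 + t ^+ 2) ^+ 2.
Proof.
by rewrite dot_arcl !(dotC _ (arc _ _ _)) !dot_arcl x01 xi1 (dotC xi) x0xi; ring.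
Qed.

Lemma sq1_gt0 (t : R) : 0 < 1 + t ^+ 2.
Proof. by rewrite ltr_wpDr ?sqr_ge0. Qed.

Lemma jet_arc G : Ck 2 K G -> K x0 ->
  jet (fun t => G (arc x0 xi t)) (G x0) (2 * 'D_xi G x0) (2 * 'D_xi ('D_xi G) x0 - 'D_x0 G x0).
Proof.
move=> G2 Kx; apply: jet_eq (jet_parabola (2 *: xi) (- x0) oK G2 Kx) _ _ _ => //.
  by rewrite deriveZdir //; exact: G2.1.
rewrite deriveNdir; last exact: G2.1.
rewrite (derive2Zdir _ _ _ oK G2 Kx) deriveZdir; last exact: (Ck_differentiable (Ck_D xi G2) Kx).
by congr (_ - _); move: ('D_xi _ _) => z; field.
Qed.

Lemma jet_dot_arc Y : jet (fun t => dot (arc x0 xi t) Y) (dot x0 Y) (2 * dot xi Y) (- dot x0 Y).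
Proof.
apply: (@jet_near _ (fun t => dot x0 Y + dot xi Y * 2 * t + t ^+ 2 * (- dot x0 Y))).
  by near=> t; rewrite dot_arcl; ring.
exists (fun=> - dot x0 Y); split=> [||t]; [exact: cvg_cst|by []|].
by rewrite [2 * _]mulrC.
Unshelve. all: by end_near. Qed.

Lemma arc_capS t : ct * (1 + t ^+ 2) <= arc x0 xi t ord0 ord_max ->
  capS ((1 + t ^+ 2)^-1 *: arc x0 xi t).
Proof.
have t0 := sq1_gt0 t; move=> tm; split=> /=.
  by rewrite dotZl dotZr dot_arc; field; rewrite gt_eqF.
by rewrite mxE mulrC ler_pdivlMr.
Qed.

Lemma arc_last t : arc x0 xi t ord0 ord_max
  = (1 - t ^+ 2) * x0 ord0 ord_max + 2 * t * xi ord0 ord_max.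
Proof. by rewrite -!dot_Elast dot_arcl. Qed.

Lemma near_arc_interior : ct < x0 ord0 ord_max ->
  \forall t \near (0 : R), capS ((1 + t ^+ 2)^-1 *: arc x0 xi t).
Proof.
move=> x0m.
have J := jetD (jet_dot_arc (Elast R n)) (jetZ (- ct) (jetD (jet_cst 1) jet_sq)).
have pos : 0 < dot x0 (Elast R n) + - ct * (1 + 0) by rewrite dot_Elast addr0 mulr1; lra.
near=> t; apply: arc_capS.
have : 0 < dot (arc x0 xi t) (Elast R n) + - ct * (1 + t ^+ 2).
  by near: t; exact: jet_gt0 J pos.
by rewrite dot_Elast; lra.
Unshelve. all: by end_near. Qed.

Lemma near_arc_boundary : ct = x0 ord0 ord_max -> 0 < xi ord0 ord_max ->
  \forall t \near (0 : R)^'+, capS ((1 + t ^+ 2)^-1 *: arc x0 xi t).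
Proof.
move=> x0m xim.
have c : {for 0, continuous (fun t : R => xi ord0 ord_max - t * ct)}.
  by apply: cvgB; [exact: cvg_cst|apply: cvgM; [exact: cvg_id|exact: cvg_cst]].
have pos0 : \forall t \near (0 : R), 0 < xi ord0 ord_max - t * ct.
  by apply: (cvgr_gt _ c); rewrite mul0r subr0.
have pos : \forall t \near (0 : R)^'+, 0 < xi ord0 ord_max - t * ct.
  exact: cvg_at_right_filter pos0.
near=> t; apply: arc_capS; rewrite arc_last -x0m.
have t0 : 0 < t by [].
have : 0 < t * (xi ord0 ord_max - t * ct) by rewrite mulr_gt0 //; near: t.
lra.
Unshelve. all: by end_near. Qed.

End Arc.

Variables (xs : V) (eps alpha m0 : R).
Definition barrier x : R := eps * expR (alpha * dot x xs) - m0.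
Hypothesis touch : forall x X, capS x -> dot x X = 0 -> barrier x * dot X X <= B x X X.

(** The Hessian vanishes on the radial direction, so [X] may be replaced by its tangential part.
    Hence test vectors need not be kept tangent along the arc. *)
Lemma touch_cone r x X : 0 < r -> capS x ->
  barrier x * (dot X X - dot x X ^+ 2) <= r * B (r *: x) X X.
Proof.
move=> r0 Sx; have Kx := SK Sx; have [x1 _] := Sx.
have BB := D2_bilin oK h4 Kx.
rewrite (D2_homog oK KZ h4 hZ _ _ r0 Kx) mulrA mulfV ?mul1r; last by rewrite gt_eqF.
have xX : dot x (X - dot x X *: x) = 0 by rewrite dotDr dotNr dotZr x1 mulr1 subrr.
have := touch Sx xX.
have -> : dot (X - dot x X *: x) (X - dot x X *: x) = dot X X - dot x X ^+ 2.
  by rewrite !(dotDl, dotDr, dotNl, dotNr, dotZl, dotZr) x1 (dotC X x); ring.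
have Bx Y : B x x Y = 0 := euler_D1 oK KZ h4 hZ Y Kx.
have -> : B x (X - dot x X *: x) (X - dot x X *: x) = B x X X.
  have BXx : B x X x = 0 := etrans (D2C oK h4 X x Kx) (Bx X).
  rewrite -scaleNr; apply: etrans (bilin_line BB X x (- dot x X)) _.
  transitivity (B x X X + 2 * (- dot x X) * 0 + (- dot x X) ^+ 2 * 0).
    by congr (_ + _ * _ + _ * _); [exact: BXx|exact: Bx].
  by rewrite !mulr0 !addr0.
by [].
Qed.

Variables (x0 e1 : V).
Hypotheses (Sx0 : capS x0) (e11 : dot e1 e1 = 1) (x0e1 : dot x0 e1 = 0).
Hypothesis contact : B x0 e1 e1 = barrier x0.

Local Notation lam := (B x0 e1 e1).
Local Notation phi := (eps * expR (alpha * dot x0 xs)).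

Section Test.
Variables (xi Z : V).
Hypotheses (xi1 : dot xi xi = 1) (x0xi : dot x0 xi = 0).
Hypotheses (Zx0 : dot x0 Z = 0) (Ze1 : dot e1 Z = 0) (BZ : B x0 e1 Z = 0).

Let Kx0 : K x0 := SK Sx0.
Let x01 : dot x0 x0 = 1 := Sx0.1.

Let Rt t := (1 + t ^+ 2) * B (arc x0 xi t) (e1 + t *: Z) (e1 + t *: Z).
Let Lt t := barrier ((1 + t ^+ 2)^-1 *: arc x0 xi t)
  * (dot (e1 + t *: Z) (e1 + t *: Z) - dot ((1 + t ^+ 2)^-1 *: arc x0 xi t) (e1 + t *: Z) ^+ 2).

Let Lt_le_Rt t : capS ((1 + t ^+ 2)^-1 *: arc x0 xi t) -> Lt t <= Rt t.
Proof.
move=> St; have := touch_cone (e1 + t *: Z) (sq1_gt0 t) St.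
by rewrite scalerA mulfV ?scale1r // gt_eqF // sq1_gt0.
Qed.

Let jetL : jet Lt lam (phi * (2 * alpha * dot xi xs))
  (lam * (dot Z Z - 4 * dot xi e1 ^+ 2)
   + phi * (2 * alpha ^+ 2 * dot xi xs ^+ 2 - 2 * alpha * dot x0 xs)).
Proof.
have js := jetM jet_inv_sq (jet_dot_arc x0 xi xs).
have jb := jetD (jetZ eps (jet_exp (jetZ alpha js))) (jet_cst (- m0)).
have jX := jetD (jet_cst 1) (jetZ (dot Z Z) jet_sq).
have jd := jetD (jet_dot_arc x0 xi e1) (jetM (jet_id R) (jet_dot_arc x0 xi Z)).
have jD := jetM jet_inv_sq jd.
have jN := jetD jX (jetN (jetM jD jD)).
have J := jetM jb jN.
rewrite !mul0r !mul1r !add0r !addr0 x0e1 Zx0 in J.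
apply: jet_near (jet_eq J _ _ _).
- near=> t; rewrite /Lt /barrier dotZl; congr (_ * _).
  rewrite !dotZl !dotDr !dotDl !dotZr !dotZl e11 (dotC Z e1) Ze1; ring.
- by rewrite ?contact /barrier; ring.
- by rewrite ?contact /barrier; ring.
- by rewrite ?contact /barrier; field.
Unshelve. all: by end_near. Qed.

Let jetR : jet Rt lam (2 * 'D_xi ('D_e1 ('D_e1 h)) x0)
  (2 * 'D_xi ('D_xi ('D_e1 ('D_e1 h))) x0 + lam + 2 * (2 * 'D_xi ('D_e1 ('D_Z h)) x0)
   + B x0 Z Z + lam).
Proof.
have J11 := jet_arc xi (CD2 h4 e1 e1) Kx0.
have J1Z := jet_arc xi (CD2 h4 e1 Z) Kx0.
have JZZ := jet_arc xi (CD2 h4 Z Z) Kx0.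
have {}J11 : jet (fun t => 'D_e1 ('D_e1 h) (arc x0 xi t)) lam (2 * 'D_xi ('D_e1 ('D_e1 h)) x0)
    (2 * 'D_xi ('D_xi ('D_e1 ('D_e1 h))) x0 + lam).
  apply: jet_eq J11 (erefl _) (erefl _) _; congr (_ + _).
  by have [e _] := euler_D2 oK KZ h4 hZ e1 e1 Kx0; rewrite (congr1 -%R e) opprK.
have {}J1Z : jet (fun t => 'D_e1 ('D_Z h) (arc x0 xi t)) 0 (2 * 'D_xi ('D_e1 ('D_Z h)) x0)
    (2 * 'D_xi ('D_xi ('D_e1 ('D_Z h))) x0 - 'D_x0 ('D_e1 ('D_Z h)) x0).
  exact: jet_eq J1Z BZ (erefl _) (erefl _).
apply: jet_near (jet_weighted J11 J1Z JZZ); near=> t; rewrite /Rt; congr (_ * _).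
have Kt : K (arc x0 xi t) by near: t; exact: near_parabola.
apply: etrans (esym (bilin_line (D2_bilin oK h4 Kt) e1 Z t)).
by congr (_ + _ + _); rewrite mulrA.
Unshelve. all: by end_near. Qed.

(** The point moves along the arc while [e1] becomes [e1 + t *: Z]. The conditions on [Z] keep it
    out of the first order relation; at second order it brings the mixed third derivative and
    [B x0 Z Z], to be optimized, and a multiple of [dot Z Z] of harmless sign. *)
Lemma contact_interior : ct < x0 ord0 ord_max ->
  'D_xi ('D_e1 ('D_e1 h)) x0 = phi * alpha * dot xi xs /\
  lam * (dot Z Z - 4 * dot xi e1 ^+ 2)
   + phi * (2 * alpha ^+ 2 * dot xi xs ^+ 2 - 2 * alpha * dot x0 xs)
  <= 2 * 'D_xi ('D_xi ('D_e1 ('D_e1 h))) x0 + lam + 2 * (2 * 'D_xi ('D_e1 ('D_Z h)) x0)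
   + B x0 Z Z + lam.
Proof.
move=> x0m; have LR : \forall t \near (0 : R), Lt t <= Rt t.
  by apply: filterS (near_arc_interior x01 xi1 x0xi x0m) => t; exact: Lt_le_Rt.
have [e c] := jet_le jetL jetR LR; split; last exact: c.
have two : (2 : R) != 0 by rewrite pnatr_eq0.
apply: (mulfI two); apply: etrans (esym e) _.
by ring.
Qed.

Lemma contact_boundary : ct = x0 ord0 ord_max -> 0 < xi ord0 ord_max ->
  phi * alpha * dot xi xs <= 'D_xi ('D_e1 ('D_e1 h)) x0.
Proof.
move=> x0m xim; have LR : \forall t \near (0 : R)^'+, Lt t <= Rt t.
  by apply: filterS (near_arc_boundary x01 xi1 x0xi x0m xim) => t; exact: Lt_le_Rt.
have two : (0 : R) < 2 by [].
rewrite -(ler_pM2l two); apply: le_trans (jet_le_right jetL jetR LR).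
by rewrite le_eqVlt; apply/orP; left; apply/eqP; ring.
Qed.

End Test.

End Contact.

(** * Scalar inequalities for the estimates *)

Lemma esp_scale (R : realType) n (a : 'I_n -> R) (c : R) m :
  (gen (fun i => c * a i) [set: 'I_n]%SET)`_m = c ^+ m * (gen a [set: 'I_n]%SET)`_m.
Proof.
rewrite !coef_gen_sigma /sigma mulr_sumr; apply: eq_bigr => I /eqP Im.
by rewrite big_split /= prodr_const Im.
Qed.

Lemma mulr_pos_eq0 (R : realType) (a b : R) : 0 < a -> a * b = 0 -> b = 0.
Proof. by move=> a0 /eqP; rewrite mulf_eq0 gt_eqF // => /eqP. Qed.

Lemma tangential_algebra (R : realType) (st ct d f : R) : 0 < st -> st ^+ 2 = 1 - ct ^+ 2 ->
  2 * st * (2 * st * d) / 2 + 2 * ct * f = 0 -> (1 - ct ^+ 2) * d = - ct * f.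
Proof.
move=> s0 <- c.
have -> : st ^+ 2 * d = (2 * st * (2 * st * d) / 2 + 2 * ct * f) / 2 - ct * f by field.
by rewrite c; field.
Qed.

Lemma scaled_equation (R : realType) (k l : nat) (r p ek el hx ux ek' el' hx' ux' : R) :
  0 < r -> (l < k)%N -> 0 < ek -> 0 < el -> 0 < hx -> 0 < ux ->
  ek' = r^-1 ^+ k * ek -> el' = r^-1 ^+ l * el -> ux' = r * ux -> hx' = r * hx ->
  ln ek - ln el = - (p - 1 + (k - l)%:R) * ln ux + (p - 1) * ln hx ->
  [/\ 0 < ek', 0 < el' &
    ln ek' - ln el' = - (p - 1 + (k - l)%:R) * ln ux' + (p - 1) * ln hx'].
Proof.
move=> r0 lk k0 l0 h0 u0 -> -> -> -> e.
have ri m : 0 < r^-1 ^+ m by rewrite exprn_gt0 // invr_gt0.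
split; [exact: mulr_gt0|exact: mulr_gt0|].
rewrite !lnM ?posrE // !lnXn ?invr_gt0 // lnV ?posrE //.
have kl : k%:R = l%:R + (k - l)%:R :> R by rewrite -natrD subnKC // ltnW.
rewrite -(mulr_natl (- ln r) k) -(mulr_natl (- ln r) l) kl.
have -> : ln ek = ln el + (- (p - 1 + (k - l)%:R) * ln ux + (p - 1) * ln hx) by rewrite -e addrC subrK.
by ring.
Qed.

(** This is the origin of the exponent [- 1 / (p + k - l - 1)]: with [P = p - 1] and [d = k - l],
    the logarithmic gradients of [u] and [h] fit exactly under the square left over by inverse
    concavity, with a defect proportional to [(x - y) ^+ 2]. *)
Lemma convexity_defect (R : realType) (d P x y : R) : 0 < d -> 0 <= P ->
  (P + d) * x ^+ 2 / 2 - P * y ^+ 2 / 2 <= ((P + d) * x - P * y) ^+ 2 / (2 * d).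
Proof.
move=> d0 P0; have d2 : 0 < 2 * d by rewrite mulr_gt0.
rewrite ler_pdivlMr // -subr_ge0.
rewrite (_ : _ - _ = (P + d) * P * (x - y) ^+ 2); last by field.
by rewrite mulr_ge0 ?sqr_ge0 // mulr_ge0 // addr_ge0 // ltW.
Qed.

Lemma second_order_bound (R : realType) (d P ux u1 u2 hx h1 lam y1 y2 : R) : 0 < d -> 0 <= P ->
  0 < ux -> 0 <= u2 ->
  y1 = - (P + d) * (u1 / ux) + P * (h1 / hx) ->
  y2 = - (P + d) * (u2 / 2 / ux - (u1 / ux) ^+ 2 / 2) + P * (lam / 2 / hx - (h1 / hx) ^+ 2 / 2) ->
  y2 <= y1 ^+ 2 / (2 * d) + P * (lam / 2) / hx.
Proof.
move=> d0 P0 ux0 u20 -> ->.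
have c := convexity_defect (u1 / ux) (h1 / hx) d0 P0.
have -> : (- (P + d) * (u1 / ux) + P * (h1 / hx)) ^+ 2 = ((P + d) * (u1 / ux) - P * (h1 / hx)) ^+ 2 by ring.
have U : 0 <= (P + d) * (u2 / 2 / ux).
  by rewrite mulr_ge0 ?divr_ge0 ?addr_ge0 // ltW.
apply: le_trans (lerD c (lexx _)); rewrite -subr_ge0.
by rewrite (_ : _ - _ = (P + d) * (u2 / 2 / ux)) //; ring.
Qed.

Lemma derive_lincomb (R : realType) n (F : 'rV[R]_n.+1 -> R) (x Z : 'rV[R]_n.+1) (c : 'I_n.+1 -> R)
  (v : 'I_n.+1 -> 'rV[R]_n.+1) : differentiable F x -> Z = \sum_j c j *: v j ->
  'D_Z F x = \sum_j c j * 'D_(v j) F x.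
Proof.
move=> Fd ->; exact: derive_sumdir.
Qed.

Lemma bilin_lincomb (R : realType) n (B : 'rV[R]_n.+1 -> 'rV[R]_n.+1 -> R) (Z : 'rV[R]_n.+1)
  (y a : 'I_n.+1 -> R) (v : 'I_n.+1 -> 'rV[R]_n.+1) : sym_bilin B -> Z = \sum_j y j *: v j ->
  (forall j, B (v j) Z = a j * y j) -> B Z Z = \sum_j y j ^+ 2 * a j.
Proof.
move=> BB ZE BvZ; rewrite {1}ZE (bilin_sum BB); apply: eq_bigr => j _.
by rewrite (bilinZ BB) BvZ; ring.
Qed.

Lemma contact_algebra (R : realType) (L zz d b z4 t c z4' t' c' : R) :
  0 <= L -> 0 <= zz -> d <= 1 -> z4 = z4' -> t = t' -> c = c' ->
  L * (zz - 4 * d) + b <= 2 * z4 + L + 2 * (2 * t) + c + L ->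
  - 4 * L + b <= 2 * z4' + 2 * L + 4 * t' + c'.
Proof.
move=> L0 z0 d1 <- <- <- H.
have := mulr_ge0 L0 z0; have := ler_wpM2l L0 d1.
by move: H; rewrite mulr1 mulrBr; lra.
Qed.

Lemma affine_bounded_below (R : realType) (c d b : R) : (forall r, c <= d + r * b) -> b = 0.
Proof.
move=> H; apply/eqP; apply: contraT => b0.
by have := H ((c - d - 1) / b); rewrite divfK //; lra.
Qed.

Lemma ratio_of_logs (R : realType) (ek el r0 c : R) : 0 < ek -> 0 < el ->
  ln ek - ln el = c -> r0 <= expR c -> r0 * el <= ek.
Proof.
move=> k0 l0 <-; rewrite expRD expRN !lnK ?posrE // => H.
by apply: le_trans (ler_wpM2r (ltW l0) H) _; rewrite mulfVK // gt_eqF.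
Qed.

Lemma unit_dot_le1 (R : realType) n (x y : 'rV[R]_n.+1) : dot x x = 1 -> dot y y = 1 -> `|dot x y| <= 1.
Proof.
move=> x1 y1; rewrite -(@ler_pXn2r _ 2) ?nnegrE // expr1n real_normK ?num_real //.
by apply: le_trans (cauchy_schwarz x y) _; rewrite x1 y1 mulr1.
Qed.

Lemma complete_square (R : realType) (x a : R) (y := - 2 * x / a) :
  4 * (y * x) + y ^+ 2 * a = - 4 * (x ^+ 2 / a).
Proof.
rewrite {}/y; have [->|a0] := eqVneq a 0; first by rewrite invr0 !(mulr0, mul0r) addr0.
by field.
Qed.

(** The good term [al ^+ 2 * s i ^+ 2] is weighted by the lower bound [low], the others by the upper
    bound [G], and [lam <= ph] makes everything a multiple of [ph]. The radial index has no barrier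
    term, whence [1 - s0 ^+ 2]. *)
Lemma barrier_sum (R : realType) n (ell s : 'I_n.+1 -> R) (low G al lam ph s0 Q : R) :
  (forall i, low <= ell i <= G) -> 0 < low -> 0 <= al -> 0 <= lam -> lam <= ph ->
  \sum_i s i ^+ 2 = 1 -> s ord0 = s0 -> `|s0| <= 1 ->
  (\sum_i ell i * (if i == ord0 then 0 else - 3 * lam + ph * (al ^+ 2 * s i ^+ 2 - al * s0))) / 2 <= Q ->
  ph * (al ^+ 2 * low * (1 - s0 ^+ 2) - n.+1%:R * (G * (al + 3))) <= 2 * Q.
Proof.
move=> lG low0 al0 lam0 lp s1 s00; rewrite ler_norml => /andP[sl su] H.
have ph0 : 0 <= ph by exact: le_trans lp.
have G0 : 0 <= G by have /andP[H1 H2] := lG ord0; apply: le_trans (ltW low0) (le_trans H1 H2).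
apply: le_trans (_ : \sum_i ell i * (if i == ord0 then 0 else - 3 * lam + ph * (al ^+ 2 * s i ^+ 2 - al * s0)) <= _); last by lra.
have -> : ph * (al ^+ 2 * low * (1 - s0 ^+ 2) - n.+1%:R * (G * (al + 3)))
  = \sum_(i < n.+1) (ph * al ^+ 2 * low * (if i == ord0 then 0 else s i ^+ 2) - ph * (G * (al + 3))).
  rewrite sumrB -mulr_sumr sumr_const card_ord -mulr_natl.
  have -> : \sum_(i < n.+1) (if i == ord0 then 0 else s i ^+ 2) = 1 - s0 ^+ 2.
    rewrite -s1 -s00 (bigD1 ord0) //= add0r [in RHS](bigD1 ord0) //= addrAC subrr add0r.
    by apply: eq_bigr => i /negbTE ->.
  by ring.
apply: ler_sum => i _; have /andP[l1 l2] := lG i.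
have e0 : 0 <= ell i by exact: le_trans (ltW low0) l1.
case: eqP => _.
  by rewrite !mulr0 sub0r oppr_le0; apply: mulr_ge0 => //; apply: mulr_ge0 => //; exact: addr_ge0.
have A1 : ell i * lam <= G * ph by apply: ler_pM.
have A2 : low * (ph * al ^+ 2 * s i ^+ 2) <= ell i * (ph * al ^+ 2 * s i ^+ 2).
  by apply: ler_wpM2r => //; apply: mulr_ge0; [apply: mulr_ge0 => //|]; exact: sqr_ge0.
have A3 : ell i * (ph * al) * s0 <= G * (ph * al) * 1.
  have pa : 0 <= ph * al by exact: mulr_ge0.
  apply: le_trans (ler_wpM2l (mulr_ge0 e0 pa) su) _.
  by rewrite !mulr1; apply: ler_wpM2r.
move: A1 A2 A3; clear; move: (ell i) (s i) => b c A1 A2 A3; lra.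
Qed.

Lemma barrier_divide (R : realType) (P hx lam ph X Y M G C al : R) :
  0 < ph -> lam <= ph -> 0 <= P -> 0 < hx ->
  ph * (X - Y) <= 2 * (P * (lam / 2) / hx + M * (G * C * (ph * (1 + al)) * (1 + 6 * G))) ->
  X <= Y + P / hx + 2 * (M * (G * C * (1 + 6 * G))) * (1 + al).
Proof.
move=> ph0 lp P0 h0 H; rewrite -(ler_pM2l ph0).
have A : P / hx * lam <= P / hx * ph by apply: ler_wpM2l => //; apply: divr_ge0 => //; exact: ltW.
have e : 2 * (P * (lam / 2) / hx + M * (G * C * (ph * (1 + al)) * (1 + 6 * G)))
  = P / hx * lam + 2 * (M * (G * C * (1 + 6 * G))) * (ph * (1 + al)).
  by field; rewrite gt_eqF.
rewrite e in H; move: (2 * (M * _)) (P / hx) H A => Z D H A.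
have {}H : ph * X <= ph * Y + D * lam + Z * (ph * (1 + al)) by move: H; rewrite mulrBr; lra.
apply: le_trans H _; rewrite -subr_ge0.
rewrite (_ : _ - _ = D * ph - D * lam); last by ring.
by rewrite subr_ge0.
Qed.

Lemma radial_small (R : realType) (lam ph al : R) (b : bool) :
  0 <= lam -> lam <= ph -> 0 <= al -> `|- (lam * b%:R)| <= ph * (1 + al).
Proof.
move=> L0 Lp a0; have := mulr_ge0 (le_trans L0 Lp) a0.
case: b; first by rewrite mulr1 normrN ger0_norm //; lra.
by rewrite mulr0 oppr0 normr0; lra.
Qed.

Lemma tangential_small (R : realType) (d ph al : R) :
  0 <= ph -> 0 <= al -> `|d| <= 1 -> `|ph * al * d| <= ph * (1 + al).
Proof.
move=> p0 a0 d1; have pa := mulr_ge0 p0 a0.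
rewrite normrM ger0_norm //; apply: le_trans (ler_wpM2l pa d1) _; lra.
Qed.

Lemma boundary_sum (R : realType) n (d g : 'I_n.+1 -> R) (i1 : 'I_n.+1) (low G c : R) :
  \sum_i d i * g i <= 0 -> (forall i, low <= g i <= G) -> 0 < low -> 0 <= c ->
  (forall i, i != i1 -> - c <= d i) -> d i1 <= c * (n.+1%:R * G / low).
Proof.
move=> H gb low0 c0 dc.
have G0 : 0 <= G by have /andP[H1 H2] := gb ord0; apply: le_trans (ltW low0) (le_trans H1 H2).
have S1 : d i1 * g i1 - n.+1%:R * (c * G) <= 0.
  apply: le_trans H.
  have -> : d i1 * g i1 - n.+1%:R * (c * G) = \sum_i ((if i == i1 then d i1 * g i1 else 0) - c * G).
    by rewrite sumrB -big_mkcond big_pred1_eq sumr_const card_ord mulr_natl.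
  apply: ler_sum => i _; have /andP[g1 g2] := gb i.
  have g0 : 0 <= g i by exact: le_trans (ltW low0) g1.
  have cG : 0 <= c * G by exact: mulr_ge0.
  case: eqP => [->|/eqP ii]; first by rewrite lerBlDr lerDl.
  rewrite sub0r; apply: le_trans (ler_wpM2r g0 (dc i ii)).
  by rewrite mulNr lerN2; apply: ler_wpM2l.
have [d0|d0] := leP (d i1) 0.
  by apply: le_trans d0 _; rewrite mulr_ge0 // divr_ge0 ?mulr_ge0 // ltW.
rewrite mulrA ler_pdivlMr //.
have /andP[g1 _] := gb i1.
apply: le_trans (ler_wpM2l (ltW d0) g1) _.
by move: S1; rewrite mulrCA; lra.
Qed.

Lemma sum_single (R : realType) n (F : 'I_n -> R) j r :
  \sum_m (if m == j then r else 0) * F m = r * F j.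
Proof.
rewrite (bigD1 j) //= eqxx big1 ?addr0 // => m /negbTE ->; exact: mul0r.
Qed.

Lemma sum_single2 (R : realType) n (F : 'I_n -> R) j r :
  \sum_m (if m == j then r else 0) ^+ 2 * F m = r ^+ 2 * F j.
Proof.
rewrite (bigD1 j) //= eqxx big1 ?addr0 // => m /negbTE ->; by rewrite expr0n mul0r.
Qed.

Lemma null_algebra (R : realType) (c d r b s t a : R) : c <= d + 4 * s + t ->
  s = r / 4 * b -> t = (r / 4) ^+ 2 * a -> a = 0 -> c <= d + r * b.
Proof.
move=> c0 sE tE aE; move: c0; rewrite sE tE aE mulr0 addr0.
by rewrite (_ : 4 * (r / 4 * b) = r * b) //; field.
Qed.

Lemma fourth_algebra (R : realType) (L ph A D z s t Q : R) : 0 <= L ->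
  4 * s + t = - 4 * Q -> - 4 * L + ph * (2 * A - 2 * D) <= 2 * z + 2 * L + 4 * s + t ->
  2 * Q + (- 3 * L + ph * (A - D)) <= z.
Proof. by move=> L0 e c; lra. Qed.

Lemma double_sub (R : realType) (a b c d : R) : 2 * a * b - 2 * c * d = 2 * (a * b) - 2 * (c * d).
Proof. by rewrite !mulrA. Qed.

Lemma square_completion (R : realType) n (J : {set 'I_n}) (x a : 'I_n -> R) :
  4 * (\sum_j (if j \in J then - 2 * x j / a j else 0) * x j)
  + \sum_j (if j \in J then - 2 * x j / a j else 0) ^+ 2 * a j
  = - 4 * (\sum_(j in J) x j ^+ 2 / a j).
Proof.
rewrite !mulr_sumr -big_split [RHS]big_mkcond; apply: eq_bigr => j _ /=.
by case: ifP => _; [exact: complete_square|rewrite mul0r mulr0 expr0n mul0r addr0].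
Qed.

Lemma conormal_algebra (R : realType) (st ct ph D DE Dc Dx Dxi m s0 L t : R) :
  0 < st -> 0 < ct -> 0 <= ph -> s0 <= 1 -> t = st^-1 * (m - ct * s0) ->
  Dxi = st^-1 * D -> D = DE - Dc -> Dc = ct * Dx -> Dx = - L ->
  ph * t <= Dxi -> ph * (m - ct) <= DE + ct * L.
Proof.
move=> st0 c0 p0 s1 -> -> -> -> ->; rewrite mulrCA ler_pM2l ?invr_gt0 // mulrN opprK.
apply: le_trans; apply: ler_wpM2l => //; rewrite lerD2l lerN2.
by rewrite -[leRHS]mulr1 ler_pM2l.
Qed.

Lemma psd_shift (R : realType) (P b c d t : R) : 0 <= P -> P = b + 2 * t * c + t ^+ 2 * d ->
  c = 0 -> d = 0 -> 0 <= b.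
Proof. by move=> P0 e c0 d0; move: P0; rewrite e c0 d0 !mulr0 !addr0. Qed.

Lemma tangent_sign (R : realType) (ct s D f : R) : 0 < ct -> 0 < s -> 0 <= f ->
  s * D = - ct * f -> D <= 0.
Proof.
move=> c0 s0 f0 e; rewrite -(ler_pM2l s0) e mulr0 mulNr oppr_le0.
by apply: mulr_ge0 => //; exact: ltW.
Qed.

Lemma conormal_EE (R : realType) (st ct L F b c bx d f : R) : st ^+ 2 = 1 - ct ^+ 2 ->
  F = b + c -> b = ct * bx -> c = - st * d -> bx = 0 -> d = L * f -> f = - st ->
  F = (1 - ct ^+ 2) * L.
Proof. by move=> <- -> -> -> -> -> ->; ring. Qed.

Lemma radial_zero (R : realType) (ct L D D' f : R) : 0 < ct -> 0 <= L -> D = D' -> D' = - f -> f = 0 ->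
  - (ct * L) <= D.
Proof.
by move=> c0 L0 -> -> ->; rewrite oppr0 oppr_le0; apply: mulr_ge0 => //; exact: ltW.
Qed.

Lemma tangent_third (R : realType) (ct s L D F : R) : 0 < s -> F = s * L -> s * D = - ct * F ->
  - (ct * L) <= D.
Proof. by move=> s0 -> e; rewrite -(ler_pM2l s0) e; rewrite le_eqVlt; apply/orP; left; apply/eqP; ring. Qed.

Lemma conormal_value (R : realType) (st ct a L e b c d f g gm ga gt : R) : 0 < st -> a != 0 ->
  e = b + c -> b = ct * d -> c = - st * f -> e = 0 -> d = 0 ->
  g = gt + ga -> ga = a * gm -> g = L * a -> gt = f -> gm = L.
Proof.
move=> s0 a0 e1 e2 e3 e4 e5 g1 g2 g4 g5.
have f0 : f = 0.
  apply: (mulr_pos_eq0 s0); move: e1; rewrite e2 e3 e4 e5 mulr0 add0r => /esym/eqP.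
  by rewrite mulNr oppr_eq0 => /eqP.
by apply: (mulfI a0); rewrite -g2 mulrC -g4 g1 g5 f0 add0r.
Qed.

(** * Extrema on compact sets, and the unit tangent bundle of the cap *)

Section Extrema.
Variables (R : realType) (T : topologicalType).
Implicit Types (A : set T) (f : T -> R).

Lemma min_on A f : compact A -> A !=set0 -> (forall x, A x -> {for x, continuous f}) ->
  exists2 c, A c & forall t, A t -> f c <= f t.
Proof.
move=> cA A0 fc.
have fA : {within A, continuous f} by apply: continuous_in_subspaceT => x /set_mem; exact: fc.
have [c /set_mem Ac cmin] := compact_EVT_min A0 cA fA.
by exists c => // t At; apply: cmin; exact: mem_set.
Qed.

Lemma bounded_on A f : compact A -> (forall x, A x -> {for x, continuous f}) ->
  exists2 M, 0 <= M & forall t, A t -> `|f t| <= M.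
Proof.
move=> cA fc; have [A0|/set0P] := eqVneq A set0.
  by exists 0 => // t; rewrite A0.
move=> A0; have gc x : A x -> {for x, continuous (fun t => - `|f t|)}.
  by move=> Ax; apply: cvgN; apply: cvg_norm; exact: fc.
have [c Ac cmin] := min_on cA A0 gc.
by exists `|f c| => // t /cmin; rewrite lerN2.
Qed.

Lemma continuous_sum_at (I : Type) (s : seq I) (F : I -> T -> R) x :
  (forall i, {for x, continuous (F i)}) -> {for x, continuous (fun t => \sum_(i <- s) F i t)}.
Proof.
move=> Fc; elim: s => [|i s IH].
  rewrite (_ : (fun t => _) = cst 0); first exact: cst_continuous.
  by apply: funext => t; rewrite big_nil.
rewrite (_ : (fun t => _) = (fun t => F i t + \sum_(j <- s) F j t)).
  by apply: cvgD; [exact: Fc|exact: IH].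
by apply: funext => t; rewrite big_cons.
Qed.

Lemma continuous_mul f g x : {for x, continuous f} -> {for x, continuous g} ->
  {for x, continuous (fun t => f t * g t)}.
Proof. by move=> cf cg; apply: cvgM; [exact: cf|exact: cg]. Qed.

Lemma continuous_lin (a b : R) f g x : {for x, continuous f} -> {for x, continuous g} ->
  {for x, continuous (fun t => a * f t + b * g t)}.
Proof.
have c (r : R) : {for x, continuous (fun _ : T => r)} by exact: cst_continuous.
move=> cf cg; have cf' := continuous_mul (c a) cf; have cg' := continuous_mul (c b) cg.
by apply: cvgD; [exact: cf'|exact: cg'].
Qed.

End Extrema.

Section Flags.
Variables (R : realType) (n : nat) (ct : R).
Local Notation V := 'rV[R]_n.+1.
Local Notation S := (capS (n := n) ct).

Lemma compact_capS : compact S.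
Proof.
have cl : closed ((fun x : V => x ord0 ord_max) @^-1` [set r | ct <= r]).
  by apply: closed_comp; [move=> x _; exact: coord_continuous|exact: closed_ge].
exact (compact_closedI (@compact_sphere R n) cl).
Qed.

Lemma continuous_coord1 i (z : V * V) : {for z, continuous (fun z : V * V => z.1 ord0 i)}.
Proof. by apply: (@continuous_comp _ _ _ fst (fun x : V => x ord0 i)); [exact: cvg_fst|exact: coord_continuous]. Qed.

Lemma continuous_coord2 i (z : V * V) : {for z, continuous (fun z : V * V => z.2 ord0 i)}.
Proof. by apply: (@continuous_comp _ _ _ snd (fun x : V => x ord0 i)); [exact: cvg_snd|exact: coord_continuous]. Qed.

Definition flags : set (V * V) := [set z | S z.1 /\ dot z.2 z.2 = 1 /\ dot z.1 z.2 = 0].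

Lemma compact_flags : compact flags.
Proof.
rewrite (_ : flags = (S `*` [set x | dot x x = 1]) `&` [set z | dot z.1 z.2 = 0]).
  have cl : closed ((fun z : V * V => dot z.1 z.2) @^-1` [set 0]).
    apply: closed_comp; last exact: closed_eq.
    move=> z _; apply: continuous_sum_at => i.
    by apply: cvgM; [exact: continuous_coord1|exact: continuous_coord2].
  exact (compact_closedI (compact_setX compact_capS (@compact_sphere R n)) cl).
by apply/seteqP; split=> z; [move=> [? []]|move=> [[? ?] ?]].
Qed.

End Flags.

Section Linear.
Variables (R : realType) (n : nat).
Local Notation V := 'rV[R]_n.+1.

Lemma derive_coords (F : V -> R) x X : differentiable F x ->
  'D_X F x = \sum_i X ord0 i * 'D_('e_i) F x.
Proof. by move=> Fd; apply: derive_lincomb Fd _; exact: row_sum_delta. Qed.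

Lemma coord_le1 (X : V) i : dot X X = 1 -> `|X ord0 i| <= 1.
Proof.
move=> X1; rewrite -(@ler_pXn2r _ 2) ?nnegrE // expr1n real_normK ?num_real //.
rewrite -X1 /dot (bigD1 i) //= expr2 lerDl.
by apply: sumr_ge0 => j _; rewrite -expr2 sqr_ge0.
Qed.

Lemma derive_coords_le (F : V -> R) x X M : differentiable F x -> dot X X = 1 ->
  (forall i : 'I_n.+1, `|'D_('e_i) F x| <= M) -> `|'D_X F x| <= n.+1%:R * M.
Proof.
move=> Fd X1 FM; rewrite derive_coords //; apply: le_trans (ler_norm_sum _ _ _) _.
have -> : n.+1%:R * M = \sum_(i < n.+1) M by rewrite sumr_const card_ord mulr_natl.
apply: ler_sum => i _; rewrite normrM -[M]mul1r.
by apply: ler_pM => //; exact: coord_le1.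
Qed.

End Linear.

Lemma large_parameter (R : realType) (A B1 B2 D c : R) : 0 < A -> 0 <= B1 -> 0 <= B2 -> 0 <= D -> 0 < c ->
  exists al, [/\ 0 <= al, B1 * al + B2 < al ^+ 2 * A & D < al * c].
Proof.
(* The first quotient makes [al * A] exceed [B1 + B2], the summand 1 gives [1 <= al], and the last
   quotient serves the condition on [c]. *)
move=> A0 b1 b2 D0 c0; exists (1 + (B1 + B2) / A + D / c).
have x0 : 0 <= (B1 + B2) / A by rewrite divr_ge0 ?addr_ge0 // ltW.
have y0 : 0 <= D / c by rewrite divr_ge0 // ltW.
have xA : (B1 + B2) / A * A = B1 + B2 by rewrite divfK // gt_eqF.
have yc : D / c * c = D by rewrite divfK // gt_eqF.
move: ((B1 + B2) / A) (D / c) x0 y0 xA yc => x y x0 y0 xA yc.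
have h1 : 0 <= (x + y) * B2 by rewrite mulr_ge0 // addr_ge0.
have h2 : 0 <= (1 + x + y) * (A * y) by rewrite mulr_ge0 ?addr_ge0 // mulr_ge0 // ltW.
have h3 : 0 <= (x + y) * A by rewrite mulr_ge0 ?addr_ge0 // ltW.
have h4 : 0 <= x * c by rewrite mulr_ge0 // ltW.
split; first lra.
  have -> : (1 + x + y) ^+ 2 * A = (1 + x + y) * (A + x * A + A * y) by ring.
  by rewrite xA; lra.
by rewrite !mulrDl yc mul1r; lra.
Qed.

Lemma touch_algebra (R : realType) (le dd Bn BZ ph g : R) : 0 < le -> dd = le ^+ 2 ->
  Bn = le^-1 * (le^-1 * BZ) -> g <= Bn - ph -> (ph - - g) * dd <= BZ.
Proof.
move=> l0 -> -> H; have l2 : 0 < le ^+ 2 by rewrite exprn_gt0.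
have -> : BZ = (le^-1 * (le^-1 * BZ)) * le ^+ 2 by field; rewrite gt_eqF.
by rewrite ler_pM2r // opprK; lra.
Qed.

Lemma contact_value (R : realType) (g Bz ph : R) : g = Bz - ph -> Bz = ph - - g.
Proof. by move=> ->; ring. Qed.

Lemma interior_contradiction (R : realType) (hm hy P lo ct s kap al N G M : R) :
  0 < hm -> hm <= hy -> 0 <= P -> 0 < lo -> 0 < ct ->
  2 * ct ^+ 2 * (1 - s) <= 1 - s ^+ 2 -> kap <= 1 - s ->
  (N * G + M) * al + (3 * (N * G) + P / hm + M) < al ^+ 2 * (lo * (2 * ct ^+ 2 * kap)) ->
  al ^+ 2 * lo * (1 - s ^+ 2) <= N * (G * (al + 3)) + P / hy + M * (1 + al) -> False.
Proof.
move=> h0 hx P0 l0 c0 g1 g2 H1 H2.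
have Ph : P / hy <= P / hm.
  by apply: ler_wpM2l => //; rewrite lef_pV2 // posrE // (lt_le_trans h0).
have g3 : 2 * ct ^+ 2 * kap <= 1 - s ^+ 2.
  by apply: le_trans g1; apply: ler_wpM2l => //; rewrite mulr_ge0 // sqr_ge0.
have g4 : al ^+ 2 * lo * (2 * ct ^+ 2 * kap) <= al ^+ 2 * lo * (1 - s ^+ 2).
  by apply: ler_wpM2l => //; rewrite mulr_ge0 ?sqr_ge0 // ltW.
rewrite [ltRHS]mulrA in H1; move: (lt_le_trans H1 (le_trans g4 H2)).
by rewrite ltNge => /negP; apply; lra.
Qed.

Lemma gap_algebra (R : realType) (c a b d : R) : 0 < c -> c <= a -> c <= b -> d <= 1 ->
  (a + b) ^+ 2 <= 1 + d + (d + 1) -> 2 * c ^+ 2 * (1 - d) <= 1 - d ^+ 2.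
Proof.
move=> c0 ca cb d1 H.
have H2 : (2 * c) ^+ 2 <= (a + b) ^+ 2 by rewrite ler_pXn2r ?nnegrE //; lra.
have e : (2 * c) ^+ 2 = 4 * c ^+ 2 by ring.
have H3 : 2 * c ^+ 2 <= 1 + d by move: (le_trans H2 H); rewrite e; move: (c ^+ 2) => c2 H3; lra.
have H4 : 0 <= 1 - d by lra.
by have := ler_wpM2r H4 H3; lra.
Qed.

Lemma parameter_choice (R : realType) (N C G lo P hm ct kap c : R) (M := 2 * (N ^+ 2 * (G * C * (1 + 6 * G)))) :
  0 <= N -> 0 <= C -> 0 < G -> 0 < lo -> 0 <= P -> 0 < hm -> 0 < ct -> 0 < kap -> 0 < c ->
  exists al, [/\ 0 <= al,
    (N * G + M) * al + (3 * (N * G) + P / hm + M) < al ^+ 2 * (lo * (2 * ct ^+ 2 * kap)) &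
    N * G / lo + 1 < al * c].
Proof.
move=> N0 C0 G0 l0 P0 h0 t0 k0 c0.
have G1 : 0 <= 1 + 6 * G by lra.
have M0 : 0 <= M.
  by apply: mulr_ge0 => //; apply: mulr_ge0; [exact: sqr_ge0|apply: mulr_ge0 => //; apply: mulr_ge0 => //; exact: ltW].
have NG : 0 <= N * G by apply: mulr_ge0 => //; exact: ltW.
have Ph : 0 <= P / hm by apply: divr_ge0 => //; exact: ltW.
have Nl : 0 <= N * G / lo by apply: divr_ge0 => //; exact: ltW.
apply: large_parameter => //; [|lra|lra|lra].
by apply: mulr_gt0 => //; apply: mulr_gt0 => //; apply: mulr_gt0 => //; exact: exprn_gt0.
Qed.

Lemma barrier_le_half (R : realType) (al d hm : R) : 0 <= al -> 0 < hm -> d <= 1 ->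
  hm / 2 * expR (- al) * expR (al * d) <= hm / 2.
Proof.
move=> a0 h0 d1; rewrite -mulrA -expRD.
rewrite -[leRHS]mulr1 ler_pM2l ?divr_gt0 // -expR0 ler_expR.
by have := ler_wpM2l a0 d1; lra.
Qed.

Lemma boundary_algebra (R : realType) (ph al c ct L D Q : R) : 0 < ph -> 0 <= L -> L <= ph ->
  0 < ct -> ct < 1 -> 0 <= Q -> ph * al * c <= D + ct * L -> D <= ct * L * Q -> al * c <= Q + 1.
Proof.
move=> p0 L0 Lp c0 c1 Q0 H1 H2; rewrite -(ler_pM2l p0) mulrA; apply: le_trans H1 _.
have A : ct * L <= 1 * ph by apply: ler_pM => //; exact: ltW.
have B : ct * L * (Q + 1) <= ph * (Q + 1) by apply: ler_wpM2r; [lra|rewrite -[ph]mul1r].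
apply: le_trans B; rewrite mulrDr mulr1; lra.
Qed.

(** * The equation on the flat cone *)

Section Flat.
Variables (R : realType) (n k l : nat) (K : set 'rV[R]_n.+1) (ct p : R).
Local Notation V := 'rV[R]_n.+1.
Local Notation E := (Elast R n).
Variables (h u : V -> R).
Local Notation B x X Y := ('D_X ('D_Y h) x).
Local Notation S := (capS (n := n) ct).
Local Notation q := (p - 1 + (k - l)%:R).
Implicit Types (x X Y Z xi : V).

Hypotheses (oK : open K) (KZ : forall (r : R) x, 0 < r -> K x -> K (r *: x)).
Hypotheses (h4 : Ck 4 K h) (hZ : forall (r : R) x, 0 < r -> K x -> h (r *: x) = r * h x).
Hypotheses (u2 : Ck 2 K u) (uZ : forall (r : R) x, 0 < r -> K x -> u (r *: x) = r * u x).
Hypothesis SK : S `<=` K.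
Hypotheses (lk : (l < k)%N) (ct0 : 0 < ct) (ct1 : ct < 1) (p1 : 1 <= p).
Hypotheses (h0 : forall x, S x -> 0 < h x) (u0 : forall x, S x -> 0 < u x).
Hypothesis hpsd : forall x X, S x -> dot x X = 0 -> 0 <= B x X X.
Hypothesis upsd : forall x X, S x -> dot x X = 0 -> 0 <= 'D_X ('D_X u) x.
Hypothesis heq : forall x (v : 'I_n.+1 -> V), S x -> onb v ->
  [/\ 0 < esp (\matrix_(i, j) B x (v i) (v j)) k, 0 < esp (\matrix_(i, j) B x (v i) (v j)) l &
    ln (esp (\matrix_(i, j) B x (v i) (v j)) k) - ln (esp (\matrix_(i, j) B x (v i) (v j)) l)
    = - q * ln (u x) + (p - 1) * ln (h x)].
Hypothesis hbd : forall x, S x -> x ord0 ord_max = ct -> 'D_E h x = 0.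
Hypothesis ubd : forall x, S x -> x ord0 ord_max = ct -> 0 <= 'D_E u x.

Lemma eigenframe x m (v : nat -> V) : K x -> (m <= n.+1)%N ->
  (forall i j, (i < m)%N -> (j < m)%N -> dot (v i) (v j) = (i == j)%:R) ->
  (forall i, (i < m)%N -> exists a, forall Y, B x (v i) Y = a * dot (v i) Y) ->
  exists w : 'I_n.+1 -> V, [/\ onb w, forall i : 'I_n.+1, (i < m)%N -> w i = v i &
    forall i Y, B x (w i) Y = B x (w i) (w i) * dot (w i) Y].
Proof.
move=> Kx mn vo ve.
have [w [wo wv we]] := @eigenbasis R n (fun X Y => B x X Y) m v (D2_bilin oK h4 Kx) mn vo ve.
exists w; split=> // i Y; have [a aE] := we i.
by rewrite [LHS]aE [in RHS]aE wo eqxx mulr1.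
Qed.

Lemma frame_matrix x (w : 'I_n.+1 -> V) : onb w ->
  (forall i Y, B x (w i) Y = B x (w i) (w i) * dot (w i) Y) ->
  \matrix_(i, j) B x (w i) (w j) = \matrix_(i, j) if i == j then B x (w i) (w i) else 0.
Proof.
move=> wo we; apply/matrixP => i j; rewrite !mxE.
by rewrite [LHS]we wo; case: eqP => _; rewrite ?mulr1 ?mulr0.
Qed.

Lemma esp_frame x (v w : 'I_n.+1 -> V) m : K x -> onb v -> onb w ->
  (forall i Y, B x (w i) Y = B x (w i) (w i) * dot (w i) Y) ->
  esp (\matrix_(i, j) B x (v i) (v j)) m = (gen (fun i => B x (w i) (w i)) [set: 'I_n.+1]%SET)`_m.
Proof.
move=> Kx vo wo we.
rewrite /esp (@detX_onb R n (fun X Y => B x X Y) v w (D2_bilin oK h4 Kx) vo wo).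
by rewrite frame_matrix // detX_diag.
Qed.

Lemma esp_homog x (r : R) (v : 'I_n.+1 -> V) m : K x -> 0 < r -> onb v ->
  esp (\matrix_(i, j) B (r *: x) (v i) (v j)) m = r^-1 ^+ m * esp (\matrix_(i, j) B x (v i) (v j)) m.
Proof.
move=> Kx r0 vo.
have [w [wo _ we]] := @eigenframe x 0 (fun=> 0) Kx isT (fun i j im => False_rect _ (Bool.diff_false_true im))
  (fun i im => False_rect _ (Bool.diff_false_true im)).
have Ew X Y : B (r *: x) X Y = r^-1 * B x X Y := D2_homog oK KZ h4 hZ X Y r0 Kx.
have we' i Y : B (r *: x) (w i) Y = B (r *: x) (w i) (w i) * dot (w i) Y.
  by rewrite [LHS]Ew we [in RHS]Ew mulrA.
apply: etrans (esp_frame m (KZ r0 Kx) vo wo we') _.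
apply: (etrans _ (congr1 (fun y => r^-1 ^+ m * y) (esym (esp_frame m Kx vo wo we)))).
apply: (etrans _ (esp_scale (fun i => B x (w i) (w i)) r^-1 m)).
have ww : (fun i => B (r *: x) (w i) (w i)) = (fun i => r^-1 * B x (w i) (w i)).
  by apply: funext => i; exact: Ew.
by rewrite ww.
Qed.

(** Both sides scale alike because [- q + (p - 1) = - (k - l)], so the equation holds on the whole
    cone. It holds for every orthonormal basis, which allows one basis to stay fixed while the point
    moves along a line. *)
Lemma heq_cone x (r : R) (v : 'I_n.+1 -> V) : S x -> 0 < r -> onb v ->
  [/\ 0 < esp (\matrix_(i, j) B (r *: x) (v i) (v j)) k,
      0 < esp (\matrix_(i, j) B (r *: x) (v i) (v j)) l &
    ln (esp (\matrix_(i, j) B (r *: x) (v i) (v j)) k) - ln (esp (\matrix_(i, j) B (r *: x) (v i) (v j)) l)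
    = - q * ln (u (r *: x)) + (p - 1) * ln (h (r *: x))].
Proof.
move=> Sx r0 vo; have [ek el e] := heq Sx vo; have Kx := SK Sx.
exact: (scaled_equation r0 lk ek el (h0 Sx) (u0 Sx) (esp_homog k Kx r0 vo) (esp_homog l Kx r0 vo)
  (uZ r0 Kx) (hZ r0 Kx) e).
Qed.

Lemma cone_point x : 0 < dot x x -> ct * len x <= x ord0 ord_max ->
  exists r y, [/\ 0 < r, S y & x = r *: y].
Proof.
move=> x0 xm; have l0 : 0 < len x by rewrite len_gt0 // -dot_gt0.
exists (len x), ((len x)^-1 *: x); split=> //; last first.
  by rewrite scalerA mulfV ?scale1r // gt_eqF.
have l2 : dot x x = len x ^+ 2.
  by rewrite /len powR12_sqrt ?dot_ge0 // sqr_sqrtr // dot_ge0.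
split; first by rewrite dotZl dotZr l2; field; rewrite gt_eqF.
by rewrite mxE mulrC ler_pdivlMr.
Qed.

Lemma near_line_interior x X : S x -> ct < x ord0 ord_max ->
  \forall t \near (0 : R), exists r y, [/\ 0 < r, S y & x + t *: X = r *: y].
Proof.
move=> [x1 _] xm.
have x0 : x != 0 by exact: unit_neq0.
have cl : {for (0 : R), continuous (fun t : R => x + t *: X)}.
  by apply: differentiable_continuous; apply/derivable1_diffP; apply: ex_derive; exact: is_derive_line.
have e0 : x + 0 *: X = x by rewrite scale0r addr0.
have clen : {for x, continuous (@len R n)}.
  exact: (Ck_continuous (@open_punctured R n) (@Ck_len R n 0) x0).
have clt : len (x + t *: X) @[t --> (0 : R)] --> len x.
  have cl' : {for x + 0 *: X, continuous (@len R n)} by rewrite e0; exact: clen.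
  have cc : len (x + t *: X) @[t --> (0 : R)] --> len (x + 0 *: X) :=
    @continuous_comp _ _ _ (fun t : R => x + t *: X) (@len R n) 0 cl cl'.
  by rewrite e0 in cc.
have jm := jet_line X openT (Ck_dotl (U := setT) 2 E openT) (I : setT x).
have cm := jet_cvg jm.
have cd : dot (x + t *: X) E - ct * len (x + t *: X) @[t --> (0 : R)] --> dot x E - ct * len x.
  by apply: cvgB => //; apply: cvgM => //; exact: cvg_cst.
have jd : \forall t \near (0 : R), 0 < dot (x + t *: X) (x + t *: X).
  have J := jet_line X openT (Ck_dot2 (U := setT) 2 openT) (I : setT x).
  by apply: jet_gt0 J _; rewrite x1.
have jp : \forall t \near (0 : R), 0 < dot (x + t *: X) E - ct * len (x + t *: X).
  by apply: (cvgr_gt _ cd); rewrite dot_Elast (len_unit x1) mulr1 subr_gt0.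
near=> t; apply: cone_point; first by near: t.
have : 0 < dot (x + t *: X) E - ct * len (x + t *: X) by near: t.
by rewrite dot_Elast subr_gt0 => /ltW.
Unshelve. all: by end_near. Qed.

(** The height grows by [t], the length by at most [t], and [ct < 1]: moving up from the rim stays
    in the cone over the cap. *)
Lemma line_boundary x (t : R) : S x -> x ord0 ord_max = ct -> 0 < t ->
  exists r y, [/\ 0 < r, S y & x + t *: E = r *: y].
Proof.
move=> [x1 _] xm t0.
have D : dot (x + t *: E) (x + t *: E) = 1 + 2 * t * ct + t ^+ 2.
  by rewrite !(dotDl, dotDr, dotZl, dotZr) x1 (dotC E) dot_Elast xm dot_Elast2; ring.
have D0 : 0 < dot (x + t *: E) (x + t *: E).
  by rewrite D; have := mulr_gt0 t0 ct0; have := sqr_ge0 t; lra.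
apply: cone_point D0 _; rewrite !mxE eqxx mulr1 xm.
have L : len (x + t *: E) <= 1 + t.
  rewrite /len powR12_sqrt ?dot_ge0 // D -(ler_pXn2r (n := 2)) ?nnegrE ?sqrtr_ge0 //; last by lra.
  rewrite sqr_sqrtr; last by rewrite -D dot_ge0.
  have := mulr_gt0 t0 ct0; have : t * ct < t * 1 by rewrite ltr_pM2l.
  by lra.
apply: le_trans (ler_wpM2l (ltW ct0) L) _.
have : ct * t < 1 * t by rewrite ltr_pM2r.
lra.
Qed.

(** Both sides of the minimum inequality are expanded at [e + t *: Z]. Equality of slopes is the
    eigenvector equation on tangent vectors, and homogeneity covers the radial part. *)
Lemma min_eigenvector x e (lam : R) : S x -> dot x e = 0 -> dot e e = 1 -> B x e e = lam ->
  (forall X, dot x X = 0 -> lam * dot X X <= B x X X) -> forall Y, B x e Y = lam * dot e Y.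
Proof.
move=> Sx xe e1 el min Y; have Kx := SK Sx; have [x1 _] := Sx.
have BB := D2_bilin oK h4 Kx.
have Bx Z : B x Z x = 0 := etrans (D2C oK h4 Z x Kx) (euler_D1 oK KZ h4 hZ Z Kx).
have [Z [xZ YZ]] : exists Z, dot x Z = 0 /\ Y = Z + dot x Y *: x.
  exists (Y - dot x Y *: x); split; last by rewrite subrK.
  by rewrite dotDr dotNr dotZr x1 mulr1 subrr.
have J1 : jet (fun t : R => B x (e + t *: Z) (e + t *: Z)) lam (2 * B x e Z) (B x Z Z).
  apply: (@jet_near _ (fun t => lam + 2 * B x e Z * t + t ^+ 2 * B x Z Z)).
    near=> t; apply: etrans (esym (bilin_line BB e Z t)).
    by congr (_ + _ + _); [exact: esym|rewrite mulrAC].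
  by exists (fun=> B x Z Z); split=> [||t]; [exact: cvg_cst|by []|by []].
have J2 : jet (fun t : R => lam * dot (e + t *: Z) (e + t *: Z)) lam (2 * (lam * dot e Z)) (lam * dot Z Z).
  apply: (@jet_near _ (fun t => lam + 2 * (lam * dot e Z) * t + t ^+ 2 * (lam * dot Z Z))).
    by near=> t; rewrite !(dotDl, dotDr, dotZl, dotZr) (dotC Z e) e1; ring.
  by exists (fun=> lam * dot Z Z); split=> [||t]; [exact: cvg_cst|by []|by []].
have [b _] : 2 * (lam * dot e Z) = 2 * B x e Z /\ lam * dot Z Z <= B x Z Z.
  apply: jet_le J2 J1 _; near=> t; apply: min.
  by rewrite dotDr dotZr xe xZ mulr0 addr0.
have {}b : lam * dot e Z = B x e Z by apply: (mulfI (_ : (2 : R) != 0)) b; rewrite pnatr_eq0.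
have eY : dot e Y = dot e Z by rewrite YZ dotDr dotZr (dotC e x) xe mulr0 addr0.
have BY : B x Y e = B x Z e.
  rewrite {1}YZ; apply: etrans (bilinD BB Z _ e) _.
  have xxe : B x (dot x Y *: x) e = 0.
    by apply: etrans (bilinZ BB _ x e) _; rewrite (euler_D1 oK KZ h4 hZ e Kx) mulr0.
  exact: etrans (congr1 (+%R (B x Z e)) xxe) (addr0 _).
have c1 : B x e Y = B x Y e := D2C oK h4 e Y Kx.
have c2 : B x Z e = B x e Z := D2C oK h4 Z e Kx.
have c3 : B x e Y = B x e Z := etrans c1 (etrans BY c2).
have c4 : B x e Z = lam * dot e Y := etrans (esym b) (congr1 ( *%R lam) (esym eY)).
exact: etrans c3 c4.
Unshelve. all: by end_near. Qed.

(** The curve is [1 + t ^+ 2] times a circle inside the boundary, where ['D_E h] vanishes; the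
    factor does no harm because ['D_E h] is homogeneous of degree 0. *)
Lemma boundary_circle x tau st : S x -> x ord0 ord_max = ct -> dot x tau = 0 ->
  tau ord0 ord_max = 0 -> dot tau tau = 1 -> st ^+ 2 = 1 - ct ^+ 2 ->
  jet (fun t => 'D_E h (x + t *: ((2 * st) *: tau) + t ^+ 2 *: ((2 * ct) *: E - x))) 0 0 0.
Proof.
move=> Sx xm xt tm t1 st2; have [x1 _] := Sx.
apply: jet_near (jet_cst 0); near=> t.
have t20 := sq1_gt0 t.
set w := x + t *: ((2 * st) *: tau) + t ^+ 2 *: ((2 * ct) *: E - x).
pose y := (1 + t ^+ 2)^-1 *: w.
have xy : w = (1 + t ^+ 2) *: y by rewrite [RHS]scalerA mulfV ?scale1r // gt_eqF.
have ym : y ord0 ord_max = ct.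
  by rewrite /y /w !mxE eqxx tm xm; field; rewrite gt_eqF.
have Sy : S y.
  split; last by rewrite ym.
  have D : dot w w = (1 + t ^+ 2) ^+ 2.
    rewrite /w !(dotDl, dotDr, dotZl, dotZr, dotNl, dotNr) x1 t1 xt (dotC tau x) xt.
    rewrite (dotC E x) (dotC E tau) dot_Elast2 !dot_Elast xm tm.
    rewrite (_ : _ + _ = 1 - 2 * t ^+ 2 + 4 * (st ^+ 2 + ct ^+ 2) * t ^+ 2 + t ^+ 4); last by ring.
    by rewrite st2; ring.
  by rewrite /y dotZl dotZr D; field; rewrite gt_eqF.
apply: esym; apply: etrans (congr1 ('D_E h) xy) _.
by rewrite (D1_homog oK KZ h4 hZ _ t20 (SK Sy)) (hbd Sy ym) mulr0.
Unshelve. all: by end_near. Qed.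

(* Differentiating [D_E h = 0] twice along the circle of the boundary in
   direction [tau], whose curvature vector brings in the derivative in [E]. *)
Lemma boundary_tangential x tau : S x -> x ord0 ord_max = ct -> dot x tau = 0 ->
  tau ord0 ord_max = 0 -> dot tau tau = 1 ->
  B x tau E = 0 /\ (1 - ct ^+ 2) * 'D_E ('D_tau ('D_tau h)) x = - ct * B x E E.
Proof.
move=> Sx xm xt tm t1; have Kx := SK Sx; have [x1 _] := Sx.
have st0 : 0 < 1 - ct ^+ 2.
  by rewrite (_ : 1 - ct ^+ 2 = (1 - ct) * (1 + ct)); [by rewrite mulr_gt0 ?subr_gt0 ?addr_gt0|ring].
have [st stp st2] : exists2 st, 0 < st & st ^+ 2 = 1 - ct ^+ 2.
  by exists (Num.sqrt (1 - ct ^+ 2)); rewrite ?sqrtr_gt0 // sqr_sqrtr // ltW.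
have C2 : Ck 2 K ('D_E h) := CkW oK (CD1 h4 E).
have J := jet_parabola ((2 * st) *: tau) ((2 * ct) *: E - x) oK C2 Kx.
have [_ b c] := jet_uniq J (boundary_circle Sx xm xt tm t1 st2).
have Ct := Ck_D tau C2.
have b' : B x tau E = 0.
  have bU : 'D_((2 * st) *: tau) ('D_E h) x = 2 * st * B x tau E by apply: deriveZdir; exact: C2.1.
  have s2 : 0 < 2 * st by rewrite mulr_gt0.
  exact: mulr_pos_eq0 s2 (etrans (esym bU) b).
split; first exact: b'.
have y1 := D3C12 oK h4 E tau tau Kx; have y2 := D3C23 oK h4 tau E tau Kx.
have y3 := etrans y1 y2.
have cW : 'D_((2 * ct) *: E - x) ('D_E h) x = 2 * ct * B x E E.
  rewrite deriveBdir; last exact: C2.1.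
  rewrite deriveZdir; last exact: C2.1.
  have -> : 'D_x ('D_E h) x = 0 := euler_D1 oK KZ h4 hZ E Kx.
  exact: subr0.
have cU : 'D_((2 * st) *: tau) ('D_((2 * st) *: tau) ('D_E h)) x = (2 * st) * ((2 * st) * 'D_tau ('D_tau ('D_E h)) x).
  apply: etrans (derive2Zdir _ _ _ oK C2 Kx) _; congr (_ * _).
  apply: deriveZdir; exact: (Ck_differentiable Ct Kx).
apply: etrans (congr1 ( *%R (1 - ct ^+ 2)) y3) _.
exact: (tangential_algebra stp st2 (etrans (esym (f_equal2 (fun a b => a / 2 + b) cU cW)) c)).
Qed.

(** * The equation differentiated in an eigenframe *)

Section Frame.
Variables (x0 : V) (w : 'I_n.+1 -> V).
Hypotheses (Sx0 : S x0) (wo : onb w) (w0 : w ord0 = x0).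
Hypothesis we : forall i Y, B x0 (w i) Y = B x0 (w i) (w i) * dot (w i) Y.
Local Notation a := (fun i => B x0 (w i) (w i)).
Local Notation full := [set: 'I_n.+1]%SET.
Let Kx0 : K x0 := SK Sx0.

Lemma frame_orth i : i != ord0 -> dot x0 (w i) = 0.
Proof. by move=> /negbTE i0; rewrite -w0 wo eq_sym i0. Qed.

Lemma frame_ge0 i : 0 <= a i.
Proof.
have [->|i0] := eqVneq i ord0; last by apply: hpsd Sx0 (frame_orth i0).
have e : B x0 x0 x0 = 0 := euler_D1 oK KZ h4 hZ x0 Kx0.
by rewrite w0 e.
Qed.

Lemma frame_eq : [/\ 0 < (gen a full)`_k, 0 < (gen a full)`_l &
  ln (gen a full)`_k - ln (gen a full)`_l = - q * ln (u x0) + (p - 1) * ln (h x0)].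
Proof. by have := heq Sx0 wo; rewrite !(esp_frame _ Kx0 wo wo we). Qed.

Lemma jet_entry X i j :
  jet (fun t => (\matrix_(i, j) B (x0 + t *: X) (w i) (w j)) i j) (if i == j then a i else 0)
    ('D_X ('D_(w i) ('D_(w j) h)) x0) ('D_X ('D_X ('D_(w i) ('D_(w j) h))) x0 / 2).
Proof.
have J := jet_line X oK (CD2 h4 (w i) (w j)) Kx0.
have e : B x0 (w i) (w j) = if i == j then a i else 0.
  by apply: etrans (we i (w j)) _; rewrite wo; case: eqP => _; rewrite ?mulr1 ?mulr0.
apply: jet_near (jet_eq J e (erefl _) (erefl _)).
by near=> t; rewrite mxE.
Unshelve. all: by end_near. Qed.

Lemma jet_log_esp X m : 0 < (gen a full)`_m ->
  jet (fun t => ln (esp (\matrix_(i, j) B (x0 + t *: X) (w i) (w j)) m)) (ln (gen a full)`_m)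
    (ln_lin a m (fun i => 'D_X ('D_(w i) ('D_(w i) h)) x0))
    (ln_quad a m (fun i => 'D_X ('D_X ('D_(w i) ('D_(w i) h))) x0 / 2)
       (fun i j => 'D_X ('D_(w i) ('D_(w j) h)) x0)).
Proof.
move=> em; exact: jet_ln em (jet_esp m (jet_entry X)).
Qed.

Lemma jet_rhs X :
  jet (fun t => - q * ln (u (x0 + t *: X)) + (p - 1) * ln (h (x0 + t *: X)))
    (- q * ln (u x0) + (p - 1) * ln (h x0))
    (- q * ('D_X u x0 / u x0) + (p - 1) * ('D_X h x0 / h x0))
    (- q * ('D_X ('D_X u) x0 / 2 / u x0 - ('D_X u x0 / u x0) ^+ 2 / 2)
     + (p - 1) * (B x0 X X / 2 / h x0 - ('D_X h x0 / h x0) ^+ 2 / 2)).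
Proof.
have h2 : Ck 2 K h := Ck_le oK (isT : (2 <= 4)%N) h4.
have Ju := jet_ln (u0 Sx0) (jet_line X oK u2 Kx0).
have Jh := jet_ln (h0 Sx0) (jet_line X oK h2 Kx0).
exact: jetD (jetZ (- q) Ju) (jetZ (p - 1) Jh).
Qed.

Lemma near_equation X : ct < x0 ord0 ord_max -> \forall t \near (0 : R),
  ln (esp (\matrix_(i, j) B (x0 + t *: X) (w i) (w j)) k)
  - ln (esp (\matrix_(i, j) B (x0 + t *: X) (w i) (w j)) l)
  = - q * ln (u (x0 + t *: X)) + (p - 1) * ln (h (x0 + t *: X)).
Proof.
move=> xm; apply: filterS (near_line_interior X Sx0 xm) => t [r [y [r0 Sy ->]]].
by have [_ _] := heq_cone Sy r0 wo.
Qed.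

Let q0 : 0 <= p - 1. Proof. by rewrite subr_ge0. Qed.
Let d0 : 0 < (k - l)%:R :> R. Proof. by rewrite ltr0n subn_gt0. Qed.

Lemma second_order X : ct < x0 ord0 ord_max -> dot x0 X = 0 ->
  ln_quad a k (fun i => 'D_X ('D_X ('D_(w i) ('D_(w i) h))) x0 / 2) (fun i j => 'D_X ('D_(w i) ('D_(w j) h)) x0)
  - ln_quad a l (fun i => 'D_X ('D_X ('D_(w i) ('D_(w i) h))) x0 / 2) (fun i j => 'D_X ('D_(w i) ('D_(w j) h)) x0)
  <= (ln_lin a k (fun i => 'D_X ('D_(w i) ('D_(w i) h)) x0)
      - ln_lin a l (fun i => 'D_X ('D_(w i) ('D_(w i) h)) x0)) ^+ 2 / (2 * (k - l)%:R)
     + (p - 1) * (B x0 X X / 2) / h x0.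
Proof.
move=> xm xX; have [ek el _] := frame_eq.
have JL := jetD (jet_log_esp X ek) (jetN (jet_log_esp X el)).
have JR := jet_near (near_equation X xm) JL.
have [_ e1 e2] := jet_uniq JR (jet_rhs X).
exact: second_order_bound d0 q0 (u0 Sx0) (upsd Sx0 xX) e1 e2.
Qed.

(** Equality at the rim and along the inward line in direction [E] compares one-sided slopes; the
    term with ['D_E h] vanishes and the one with ['D_E u] has a sign. *)
Lemma first_order_boundary : x0 ord0 ord_max = ct ->
  \sum_i 'D_E ('D_(w i) ('D_(w i) h)) x0 * ellq a k l i <= 0.
Proof.
move=> xm; have [ek el e0] := frame_eq.
have JL := jetD (jet_log_esp E ek) (jetN (jet_log_esp E el)).
have LR : \forall t \near (0 : R)^'+,
  - q * ln (u (x0 + t *: E)) + (p - 1) * ln (h (x0 + t *: E))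
  = ln (esp (\matrix_(i, j) B (x0 + t *: E) (w i) (w j)) k)
  - ln (esp (\matrix_(i, j) B (x0 + t *: E) (w i) (w j)) l).
  apply: filterS (nbhs_right_gt (0 : R)) => t t0.
  have [r [y [r0 Sy ->]]] := line_boundary Sx0 xm t0.
  by have [_ _ ->] := heq_cone Sy r0 wo.
have JR := jet_eq (jet_rhs E) (esym e0) (erefl _) (erefl _).
have RL : \forall t \near (0 : R)^'+,
  ln (esp (\matrix_(i, j) B (x0 + t *: E) (w i) (w j)) k)
  - ln (esp (\matrix_(i, j) B (x0 + t *: E) (w i) (w j)) l)
  <= - q * ln (u (x0 + t *: E)) + (p - 1) * ln (h (x0 + t *: E)).
  by apply: filterS LR => t ->.
have b := jet_le_right JL JR RL.
have lE : ln_lin a k (fun i => 'D_E ('D_(w i) ('D_(w i) h)) x0)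
  - ln_lin a l (fun i => 'D_E ('D_(w i) ('D_(w i) h)) x0)
  = \sum_i 'D_E ('D_(w i) ('D_(w i) h)) x0 * ellq a k l i := lin_diff frame_ge0 lk ek _.
suff r : - q * ('D_E u x0 / u x0) + (p - 1) * ('D_E h x0 / h x0) <= 0.
  by rewrite -lE; exact: le_trans b r.
rewrite (hbd Sx0 xm) mul0r mulr0 addr0 mulNr oppr_le0.
apply: mulr_ge0; first by rewrite addr_ge0 // ltW.
by rewrite divr_ge0 ?(ubd Sx0 xm) // ltW // u0.
Qed.

End Frame.

(** * Third and fourth derivatives at a contact point *)

Section Contact.
Variables (xs x0 e1 : V) (eps alpha m0 : R).
Hypotheses (xs1 : dot xs xs = 1) (eps0 : 0 < eps) (alpha0 : 0 <= alpha).
Hypothesis touch : forall x X, S x -> dot x X = 0 -> barrier xs eps alpha m0 x * dot X X <= B x X X.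
Hypotheses (Sx0 : S x0) (e11 : dot e1 e1 = 1) (x0e1 : dot x0 e1 = 0).
Hypothesis contact : B x0 e1 e1 = barrier xs eps alpha m0 x0.
Local Notation lam := (B x0 e1 e1).
Local Notation phi := (eps * expR (alpha * dot x0 xs)).
Hypotheses (lam0 : 0 <= lam) (lamphi : lam <= phi).
Let Kx0 : K x0 := SK Sx0.

Lemma contact_eigen Y : B x0 e1 Y = lam * dot e1 Y.
Proof.
apply: min_eigenvector Sx0 x0e1 e11 (erefl _) _ _ => X xX.
by rewrite contact; exact: touch.
Qed.

(** Index 0 carries the radial direction and index 1 the contact vector, eigenvectors with
    eigenvalues 0 and [lam]. *)
Lemma contact_frame i1 : i1 != ord0 :> 'I_n.+1 -> nat_of_ord i1 = 1%N -> exists w : 'I_n.+1 -> V,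
  [/\ onb w, w ord0 = x0, w i1 = e1 & forall i Y, B x0 (w i) Y = B x0 (w i) (w i) * dot (w i) Y].
Proof.
move=> i10 i1E; pose v (i : nat) := if i == 0%N then x0 else e1.
have [x01 _] := Sx0.
have vo i j : (i < 2)%N -> (j < 2)%N -> dot (v i) (v j) = (i == j)%:R.
  by case: i => [|[|]] //; case: j => [|[|]] // _ _; rewrite /v /= ?x01 ?e11 // dotC.
have ve i : (i < 2)%N -> exists b, forall Y, B x0 (v i) Y = b * dot (v i) Y.
  case: i => [|[|]] // _; last by exists lam; exact: contact_eigen.
  exists 0 => Y; rewrite mul0r.
  have e : B x0 x0 Y = 0 := euler_D1 oK KZ h4 hZ Y Kx0.
  exact: e.
have n2 : (2 <= n.+1)%N by rewrite -i1E ltn_ord.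
have [w [wo wv we]] := eigenframe Kx0 n2 vo ve.
by exists w; split=> //; rewrite wv ?i1E.
Qed.

Section Framed.
Variables (w : 'I_n.+1 -> V) (i1 : 'I_n.+1).
Hypotheses (wo : onb w) (w0 : w ord0 = x0) (w1 : w i1 = e1).
Hypothesis we : forall i Y, B x0 (w i) Y = B x0 (w i) (w i) * dot (w i) Y.
Local Notation a i := (B x0 (w i) (w i)).
Local Notation H i j := ('D_e1 ('D_(w i) ('D_(w j) h)) x0).
Local Notation z i := ('D_e1 ('D_e1 ('D_(w i) ('D_(w i) h))) x0).

Lemma third_sym i j : H i j = H j i.
Proof. by have e := D3C23 oK h4 e1 (w i) (w j) Kx0; exact: e. Qed.

Lemma third_radial j : H ord0 j = - (lam * (i1 == j)%:R).
Proof.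
have e : B x0 e1 (w j) = lam * (i1 == j)%:R.
  by apply: etrans (contact_eigen (w j)) _; rewrite -wo w1.
have [r _] := euler_D2 oK KZ h4 hZ e1 (w j) Kx0.
rewrite w0; exact: etrans (D3C12 oK h4 e1 x0 (w j) Kx0) (etrans r (congr1 -%R e)).
Qed.

Lemma fourth_radial : z ord0 = 2 * lam.
Proof.
rewrite w0; apply: etrans (D4C oK h4 e1 x0 Kx0) _.
by have [_ e] := euler_D2 oK KZ h4 hZ e1 e1 Kx0; exact: e.
Qed.

Section Test.
Variables (i : 'I_n.+1) (y : 'I_n.+1 -> R).
Variable Z : V.
Hypotheses (i0 : i != ord0) (y0 : y ord0 = 0) (y1 : y i1 = 0) (ZE : Z = \sum_j y j *: w j).

Lemma frame_coord j : dot (w j) Z = y j.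
Proof.
rewrite ZE dotC dot_suml (bigD1 j) //= big1 ?addr0 => [|m /negbTE mj].
  by rewrite dotZl wo eqxx mulr1.
by rewrite dotZl wo mj mulr0.
Qed.

Lemma frame_quad : B x0 Z Z = \sum_j y j ^+ 2 * a j.
Proof.
have e j : B x0 (w j) Z = a j * y j := etrans (we j Z) (congr1 ( *%R (a j)) (frame_coord j)).
exact: (@bilin_lincomb R n (fun X Y => B x0 X Y) Z y (fun j => a j) w (D2_bilin oK h4 Kx0) ZE e).
Qed.

Lemma frame_third : 'D_(w i) ('D_e1 ('D_Z h)) x0 = \sum_j y j * H i j.
Proof.
have s1 := D3C23 oK h4 (w i) e1 Z Kx0.
have s2 := D3C12 oK h4 (w i) Z e1 Kx0.
have s3 := derive_lincomb (Ck_differentiable (CD2 h4 (w i) e1) Kx0) ZE.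
have s123 := etrans (etrans s1 s2) s3.
have e j : 'D_(w j) ('D_(w i) ('D_e1 h)) x0 = H i j.
  have t1 := D3C23 oK h4 (w j) (w i) e1 Kx0; have t2 := D3C12 oK h4 (w j) e1 (w i) Kx0.
  have t3 := D3C23 oK h4 e1 (w j) (w i) Kx0.
  have t123 := etrans (etrans t1 t2) t3; exact t123.
have f : (fun j => y j * 'D_(w j) ('D_(w i) ('D_e1 h)) x0) = (fun j => y j * H i j).
  apply: funext => j; exact (f_equal (fun r => y j * r) (e j)).
exact (etrans s123 (congr1 (fun f : 'I_n.+1 -> R => \sum_j f j) f)).
Qed.

Lemma contact_test : ct < x0 ord0 ord_max ->
  H i1 i = phi * alpha * dot (w i) xs /\
  - 4 * lam + phi * (2 * alpha ^+ 2 * dot (w i) xs ^+ 2 - 2 * alpha * dot x0 xs)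
  <= 2 * z i + 2 * lam + 4 * (\sum_j y j * H i j) + \sum_j y j ^+ 2 * a j.
Proof.
move=> xm.
have xi1 : dot (w i) (w i) = 1 by rewrite wo eqxx.
have x0xi : dot x0 (w i) = 0 := frame_orth wo w0 i0.
have Zx0 : dot x0 Z = 0 by rewrite -w0 frame_coord.
have Ze1 : dot e1 Z = 0 by rewrite -w1 frame_coord.
have BZ : B x0 e1 Z = 0.
  have e : B x0 e1 Z = lam * dot e1 Z := contact_eigen Z.
  by rewrite e Ze1 mulr0.
have d1 : dot (w i) e1 ^+ 2 <= 1 by apply: le_trans (cauchy_schwarz _ _) _; rewrite xi1 e11 mulr1.
have [c1 c2] := contact_interior oK KZ h4 hZ SK touch Sx0 e11 x0e1 contact xi1 x0xi Zx0 Ze1 BZ xm.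
split.
  have t1 := D3C23 oK h4 e1 e1 (w i) Kx0; have t2 := D3C12 oK h4 e1 (w i) e1 Kx0.
  rewrite w1; exact (etrans (etrans t1 t2) c1).
have zE : 'D_(w i) ('D_(w i) ('D_e1 ('D_e1 h))) x0 = z i := esym (D4C oK h4 e1 (w i) Kx0).
exact (contact_algebra lam0 (dot_ge0 Z) d1 zE frame_third frame_quad c2).
Qed.

End Test.

Hypothesis xm : ct < x0 ord0 ord_max.
Local Notation J := [set j | (j != ord0) && (j != i1)]%SET.

(** A tilt along a null direction costs no quadratic term, so the second order condition is affine
    in the size of the tilt and cannot hold for all sizes unless [H i j = 0]. *)
Lemma third_null i j : j \in J -> a j = 0 -> H i j = 0.
Proof.
rewrite finset.inE => /andP[j0 j1] aj.
have [->|i0] := eqVneq i ord0.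
  apply: etrans (third_radial j) _; rewrite eq_sym (negbTE j1) mulr0 oppr0; reflexivity.
apply: (@affine_bounded_below R
  (- 4 * lam + phi * (2 * alpha ^+ 2 * dot (w i) xs ^+ 2 - 2 * alpha * dot x0 xs))
  (2 * z i + 2 * lam)) => r.
(* The quarter compensates the factor 4 of third derivatives in [contact_test]. *)
pose y m : R := if m == j then r / 4 else 0.
have y0 : y ord0 = 0 by rewrite /y eq_sym (negbTE j0).
have y1 : y i1 = 0 by rewrite /y eq_sym (negbTE j1).
have [_ c] := contact_test i0 y0 y1 (erefl _) xm.
have f1 : \sum_m y m * H i m = r / 4 * H i j := sum_single (fun m => H i m) j (r / 4).
have f2 : \sum_m y m ^+ 2 * a m = (r / 4) ^+ 2 * a j := sum_single2 (fun m => a m) j (r / 4).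
exact (null_algebra c f1 f2 aj).
Qed.

Lemma fourth_bound i :
  2 * (\sum_(j in J) H i j ^+ 2 / a j)
  + (if i == ord0 then 0 else - 3 * lam + phi * (alpha ^+ 2 * dot (w i) xs ^+ 2 - alpha * dot x0 xs)) <= z i.
Proof.
have [->|i0] := eqVneq i ord0.
  have e : \sum_(j in J) H ord0 j ^+ 2 / a j = 0.
    apply: big1 => j; rewrite finset.inE => /andP[j0 j1].
    have r : H ord0 j = 0.
      apply: etrans (third_radial j) _; rewrite eq_sym (negbTE j1) mulr0 oppr0; reflexivity.
    rewrite r expr0n mul0r; reflexivity.
  rewrite e mulr0 addr0 fourth_radial; exact: mulr_ge0.
(* The minimizer of [4 * y * H i m + y ^+ 2 * a m]; where [a m = 0] the quotient is 0, and so is the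
   completed square. *)
pose y m : R := if m \in J then - 2 * H i m / a m else 0.
have y0 : y ord0 = 0 by rewrite /y finset.inE eqxx.
have y1 : y i1 = 0 by rewrite /y finset.inE eqxx andbF.
have [_ c] := contact_test i0 y0 y1 (erefl _) xm.
have e := square_completion J (fun j => H i j) (fun j => a j).
have c' := eq_ind _ (fun b => - 4 * lam + phi * b <= _) c _ (double_sub (alpha ^+ 2) _ alpha _).
exact (fourth_algebra lam0 e c').
Qed.

Variables (b C r0 : R).
Hypotheses (b0 : 0 < b) (C0 : 0 <= C) (r00 : 0 < r0).
Hypothesis bB : forall X, dot X X = 1 -> B x0 X X <= b.
Hypothesis bC : forall X Y Z, dot X X = 1 -> dot Y Y = 1 -> dot Z Z = 1 -> `|'D_X ('D_Y ('D_Z h)) x0| <= C.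
Hypothesis br : r0 <= expR (- q * ln (u x0) + (p - 1) * ln (h x0)).
Local Notation s := (n.+1%:R * b).
Local Notation low := (low k l s r0).
Local Notation G := (bound k l s r0).

Lemma frame_bounds :
  [/\ 0 < G, 0 < low, (forall i, low <= ellq (fun i => a i) k l i <= G),
    (forall i j, `|offq (fun i => a i) k l i j| <= G) &
    (forall m i, (m <= k)%N -> 0 < (gen (fun i => a i) [set: 'I_n.+1]%SET)`_m ->
      0 <= ('X * gen (fun i => a i) ([set: 'I_n.+1]%SET :\ i)%SET)`_m
        / (gen (fun i => a i) [set: 'I_n.+1]%SET)`_m <= G)].
Proof.
have [ek el e] := frame_eq Sx0 wo we.
have a0 : forall i, 0 <= a i := frame_ge0 Sx0 wo w0.
have s0 : 0 < s by rewrite mulr_gt0.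
have as_ : \sum_(i in [set: 'I_n.+1]%SET) a i <= s.
  have -> : s = \sum_(i in [set: 'I_n.+1]%SET) b by rewrite sumr_const cardsT card_ord mulr_natl.
  apply: ler_sum => i _; apply: bB; rewrite wo eqxx; reflexivity.
have rk := ratio_of_logs ek el e br.
split.
- exact: bound_gt0.
- exact: low_gt0.
- move=> i; apply/andP; split.
    exact (ellq_low a0 lk ek s0 as_ rk i).
  exact (ellq_bound a0 lk ek s0 r00 as_ rk i).
- move=> i j; exact (offq_bound a0 lk ek s0 r00 as_ rk i j).
- move=> m i mk em; exact (lin_bound a0 lk ek s0 r00 as_ rk i mk em).
Qed.

(** The radial row is [- lam] or 0 by Euler's relation, with [lam <= phi]; the contact row is given
    by the first order contact condition. Both are proportional to [phi], not merely bounded. *)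
Lemma third_small i j : i \notin J -> `|H i j| <= phi * (1 + alpha).
Proof.
have p0 : 0 <= phi := le_trans lam0 lamphi.
have [->|j0] := eqVneq j ord0.
  move=> _; have -> : H i ord0 = H ord0 i := third_sym i ord0.
  have -> : H ord0 i = - (lam * (i1 == i)%:R) := third_radial i.
  exact: radial_small.
rewrite finset.inE negb_and !negbK => /orP[/eqP ->|/eqP ->].
  have -> : H ord0 j = - (lam * (i1 == j)%:R) := third_radial j.
  exact: radial_small.
have [e _] := @contact_test j (fun=> 0) _ j0 (erefl _) (erefl _) (erefl _) xm.
rewrite e; apply: tangential_small => //; apply: unit_dot_le1 => //; rewrite wo eqxx; reflexivity.
Qed.

(** [interior_ineq] is used with [delta = phi * (1 + alpha)]. Parseval turns the squares of
    [dot (w i) xs], without the radial one, into [1 - dot x0 xs ^+ 2], and [phi] divides out. *)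
Lemma framed_estimate :
  alpha ^+ 2 * low * (1 - dot x0 xs ^+ 2) <= n.+1%:R * (G * (alpha + 3)) + (p - 1) / h x0
    + 2 * (n.+1%:R ^+ 2 * (G * C * (1 + 6 * G))) * (1 + alpha).
Proof.
have [G0 low0 gb ob lb] := frame_bounds.
have [ek el _] := frame_eq Sx0 wo we.
have ph0 : 0 < phi by rewrite mulr_gt0 // expR_gt0.
have P0 : 0 <= p - 1 by rewrite subr_ge0.
have d0 : 0 <= phi * (1 + alpha) by rewrite mulr_ge0 ?(ltW ph0) // addr_ge0.
have HC i j : `|H i j| <= C by apply: bC; rewrite ?e11 ?wo ?eqxx; reflexivity.
have eqn := second_order Sx0 wo we xm x0e1.
have I := interior_ineq (frame_ge0 Sx0 wo w0) lk ek third_sym fourth_bound third_null third_small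
  HC ob (fun i => lb k i (leqnn k) ek) (fun i => lb l i (ltnW lk) el) C0 (ltW G0) d0 eqn.
have s1 : \sum_i dot (w i) xs ^+ 2 = 1.
  rewrite -xs1 (onb_parseval xs xs wo); apply: eq_bigr => i _; rewrite expr2 (dotC (w i)); reflexivity.
have x01 : `|dot x0 xs| <= 1 := unit_dot_le1 Sx0.1 xs1.
have w00 : dot (w ord0) xs = dot x0 xs by rewrite w0.
have M := barrier_sum gb low0 alpha0 lam0 lamphi s1 w00 x01 I.
exact (barrier_divide ph0 lamphi P0 (h0 Sx0) M).
Qed.

End Framed.

Variables (b C r0 : R).
Hypotheses (b0 : 0 < b) (C0 : 0 <= C) (r00 : 0 < r0).
Hypothesis bB : forall X, dot X X = 1 -> B x0 X X <= b.
Hypothesis bC : forall X Y Z, dot X X = 1 -> dot Y Y = 1 -> dot Z Z = 1 -> `|'D_X ('D_Y ('D_Z h)) x0| <= C.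
Hypothesis br : r0 <= expR (- q * ln (u x0) + (p - 1) * ln (h x0)).
Hypothesis n1 : (1 <= n)%N.
Local Notation s := (n.+1%:R * b).
Local Notation low := (low k l s r0).
Local Notation G := (bound k l s r0).

Lemma interior_estimate : ct < x0 ord0 ord_max ->
  alpha ^+ 2 * low * (1 - dot x0 xs ^+ 2) <= n.+1%:R * (G * (alpha + 3)) + (p - 1) / h x0
    + 2 * (n.+1%:R ^+ 2 * (G * C * (1 + 6 * G))) * (1 + alpha).
Proof.
move=> xm; pose i1 : 'I_n.+1 := Ordinal (n1 : (1 < n.+1)%N).
have i10 : i1 != ord0 by [].
have [w [wo w0 w1 we]] := contact_frame i10 (erefl _).
exact (framed_estimate wo w0 w1 we xm b0 C0 r00 bB bC br).
Qed.

Hypothesis xm : x0 ord0 ord_max = ct.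
Let Ex0 : dot x0 E = ct. Proof. by rewrite dot_Elast. Qed.
Let x01 : dot x0 x0 = 1 := Sx0.1.
Let st0 : 0 < 1 - ct ^+ 2.
Proof. by rewrite (_ : 1 - ct ^+ 2 = (1 - ct) * (1 + ct)); [rewrite mulr_gt0 ?subr_gt0 ?addr_gt0|ring]. Qed.
Let x0B Y : B x0 x0 Y = 0. Proof. exact (euler_D1 oK KZ h4 hZ Y Kx0). Qed.

(** [xi] is the inward unit conormal. The derivative along [E] is [st] times that along [xi] plus
    [ct] times the radial one, which is [- lam] by homogeneity. *)
Lemma conormal_third :
  phi * alpha * (xs ord0 ord_max - ct) <= 'D_E ('D_e1 ('D_e1 h)) x0 + ct * lam.
Proof.
have [st stp st2] : exists2 st, 0 < st & st ^+ 2 = 1 - ct ^+ 2.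
  by exists (Num.sqrt (1 - ct ^+ 2)); rewrite ?sqrtr_gt0 // sqr_sqrtr // ltW.
pose xi : V := st^-1 *: (E - ct *: x0).
have xi1 : dot xi xi = 1.
  rewrite /xi !(dotDl, dotDr, dotZl, dotZr, dotNl, dotNr) dot_Elast2 (dotC E) Ex0 x01.
  transitivity (st^-1 * (st^-1 * st ^+ 2)); last by field; rewrite gt_eqF.
  by rewrite st2; ring.
have x0xi : dot x0 xi = 0.
  by rewrite /xi !(dotDr, dotZr, dotNr) Ex0 x01 mulr1 subrr mulr0.
have xim : 0 < xi ord0 ord_max.
  by rewrite /xi !mxE eqxx xm mulr_gt0 ?invr_gt0 // -expr2.
have B0 : B x0 e1 0 = 0.
  by have e : B x0 e1 0 = lam * dot e1 0 := contact_eigen 0; rewrite e dot0r mulr0.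
have c := contact_boundary oK KZ h4 hZ SK touch Sx0 e11 x0e1 contact xi1 x0xi (dot0r x0) (dot0r e1) B0 (esym xm) xim.
have T := Ck_differentiable (CD2 h4 e1 e1) Kx0.
have [r _] := euler_D2 oK KZ h4 hZ e1 e1 Kx0.
have d1 := deriveZdir st^-1 (E - ct *: x0) T.
have d2 := deriveBdir E (ct *: x0) T.
have d3 := deriveZdir ct x0 T.
have xs1' : dot x0 xs <= 1 := le_trans (ler_norm _) (unit_dot_le1 x01 xs1).
have xe : dot xi xs = st^-1 * (xs ord0 ord_max - ct * dot x0 xs).
  by rewrite /xi dotZl dotDl dotNl dotZl (dotC E) dot_Elast.
have pa : 0 <= phi * alpha := mulr_ge0 (le_trans lam0 lamphi) alpha0.
exact (conormal_algebra stp ct0 pa xs1' xe d1 d2 d3 r c).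
Qed.

Lemma boundary_EE : 0 <= B x0 E E.
Proof.
have xX : dot x0 (E - ct *: x0) = 0 by rewrite dotDr dotNr dotZr Ex0 x01 mulr1 subrr.
have e := bilin_line (D2_bilin oK h4 Kx0) E x0 (- ct).
have z : B x0 E x0 = 0 := etrans (D2C oK h4 E x0 Kx0) (x0B E).
have H := hpsd Sx0 xX.
rewrite -scaleNr in H.
exact (psd_shift H e z (x0B x0)).
Qed.

Lemma boundary_tangent_third : e1 ord0 ord_max = 0 -> 'D_E ('D_e1 ('D_e1 h)) x0 <= 0.
Proof.
move=> em; have [_ e] := boundary_tangential Sx0 xm x0e1 em e11.
exact (tangent_sign ct0 st0 boundary_EE e).
Qed.

Variable st : R.
Hypotheses (stp : 0 < st) (st2 : st ^+ 2 = 1 - ct ^+ 2).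

(** Here [e1] is the outward conormal, whose third derivative [boundary_tangential] does not reach.
    The directions tangent to the boundary have derivative [- (ct * lam)] by that lemma, and the
    differentiated equation then bounds the remaining one from above. *)
Lemma boundary_conormal_third : E = ct *: x0 - st *: e1 ->
  'D_E ('D_e1 ('D_e1 h)) x0 <= ct * lam * (n.+1%:R * G / low).
Proof.
move=> Ee; pose i1 : 'I_n.+1 := Ordinal (n1 : (1 < n.+1)%N).
have i10 : i1 != ord0 by [].
have [w [wo w0 w1 we]] := contact_frame i10 (erefl _).
have [G0 low0 gb _ _] := frame_bounds wo w0 we b0 r00 bB br.
have H := first_order_boundary Sx0 wo w0 we xm.
have e1E : dot e1 E = - st by rewrite {1}Ee dotDr dotNr !dotZr e11 (dotC e1) x0e1 mulr0 mulr1 add0r.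
have EE : B x0 E E = (1 - ct ^+ 2) * lam.
  have f1 : B x0 e1 E = lam * dot e1 E := contact_eigen E.
  have f2 := bilinD (D2_bilin oK h4 Kx0) (ct *: x0) (- st *: e1) E.
  have f3 := bilinZ (D2_bilin oK h4 Kx0) ct x0 E.
  have f4 := bilinZ (D2_bilin oK h4 Kx0) (- st) e1 E.
  have f5 : ct *: x0 + - st *: e1 = E by rewrite scaleNr -Ee.
  rewrite f5 in f2.
  exact (conormal_EE st2 f2 f3 f4 (x0B E) f1 e1E).
have dj j : j != i1 -> - (ct * lam) <= 'D_E ('D_(w j) ('D_(w j) h)) x0.
  move=> j1; have [->|j0] := eqVneq j ord0.
    have t1 := D3C12 oK h4 E x0 x0 Kx0; have [t2 _] := euler_D2 oK KZ h4 hZ E x0 Kx0.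
    have t3 : B x0 E x0 = 0 := etrans (D2C oK h4 E x0 Kx0) (x0B E).
    rewrite w0; exact (radial_zero ct0 lam0 t1 t2 t3).
  have wj1 : dot (w j) (w j) = 1 by rewrite wo eqxx.
  have x0wj : dot x0 (w j) = 0 := frame_orth wo w0 j0.
  have wjm : (w j) ord0 ord_max = 0.
    rewrite -dot_Elast Ee dotDr dotNr !dotZr (dotC _ x0) x0wj -w1 wo (negbTE j1) !mulr0 subrr; reflexivity.
  have [_ e] := boundary_tangential Sx0 xm x0wj wjm wj1.
  exact (tangent_third st0 EE e).
have c0 : 0 <= ct * lam by apply: mulr_ge0 => //; exact: ltW.
have F := boundary_sum H gb low0 c0 dj.
rewrite w1 in F; exact F.
Qed.

End Contact.

(** The Hessian does not mix the conormal with directions tangent to the boundary, so a nonzero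
    conormal component forces the conormal to carry the same eigenvalue. A contact vector that is
    not tangent to the boundary can thus be replaced by the conormal. *)
Lemma conormal_reduction x e (lam st : R) : S x -> x ord0 ord_max = ct -> dot x e = 0 -> dot e e = 1 ->
  0 < st -> st ^+ 2 = 1 - ct ^+ 2 -> (forall Y, B x e Y = lam * dot e Y) -> e ord0 ord_max != 0 ->
  exists m, [/\ dot x m = 0, dot m m = 1, B x m m = lam & E = ct *: x - st *: m].
Proof.
move=> Sx xm xe e11 stp st2 eig em; have Kx := SK Sx; have [x1 _] := Sx.
have Ex : dot x E = ct by rewrite dot_Elast.
pose m : V := st^-1 *: (ct *: x - E).
have Em : E = ct *: x - st *: m by rewrite /m scalerA mulfV ?gt_eqF // scale1r opprB addrC subrK.
have xm0 : dot x m = 0 by rewrite /m dotZr dotDr dotNr dotZr x1 Ex mulr1 subrr mulr0.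
have m1 : dot m m = 1.
  rewrite /m !(dotDl, dotDr, dotZl, dotZr, dotNl, dotNr) dot_Elast2 (dotC E) Ex x1.
  transitivity (st^-1 * (st^-1 * st ^+ 2)); last by field; rewrite gt_eqF.
  by rewrite st2; ring.
exists m; split=> //.
have BB := D2_bilin oK h4 Kx.
pose a := dot e m; pose tau : V := e - a *: m.
have a0 : a != 0.
  rewrite /a /m dotZr dotDr dotNr dotZr (dotC e) xe mulr0 add0r dot_Elast.
  by rewrite mulrN oppr_eq0 mulf_neq0 // invr_neq0 // gt_eqF.
have tx : dot x tau = 0 by rewrite /tau dotDr dotNr dotZr xe xm0 mulr0 subr0.
have tm : dot tau m = 0 by rewrite /tau dotDl dotNl dotZl m1 mulr1 subrr.
have tE : dot tau E = 0 by rewrite Em dotDr dotNr (dotZr ct) (dotZr st) (dotC tau x) tx tm !mulr0 subr0.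
have BtE : B x tau E = 0.
  have [t0|t0] := eqVneq tau 0; first by rewrite t0; exact (bilin0 BB E).
  have l0 := len_gt0 t0.
  have l2 : dot tau tau = len tau ^+ 2.
    by rewrite /len powR12_sqrt ?dot_ge0 // sqr_sqrtr // dot_ge0.
  pose v := (len tau)^-1 *: tau.
  have v1 : dot v v = 1 by rewrite /v dotZl dotZr l2; field; rewrite gt_eqF.
  have vx : dot x v = 0 by rewrite /v dotZr tx mulr0.
  have vm : v ord0 ord_max = 0 by rewrite -dot_Elast /v dotZl tE mulr0.
  have [e0 _] := boundary_tangential Sx xm vx vm v1.
  have z := bilinZ BB (len tau)^-1 tau E.
  have li : 0 < (len tau)^-1 by rewrite invr_gt0.
  exact (mulr_pos_eq0 li (etrans (esym z) e0)).
have Btx : B x tau x = 0 := etrans (D2C oK h4 tau x Kx) (euler_D1 oK KZ h4 hZ tau Kx).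
have f1 := bilinD BB (ct *: x) (- st *: m) tau.
have f2 := bilinZ BB ct x tau.
have f3 := bilinZ BB (- st) m tau.
have f4 : ct *: x + - st *: m = E by rewrite scaleNr -Em.
have f5 : B x E tau = 0 := etrans (D2C oK h4 E tau Kx) BtE.
have f6 : B x x tau = 0 := etrans (D2C oK h4 x tau Kx) Btx.
rewrite f4 in f1.
have g1 := bilinD BB tau (a *: m) m.
have g2 := bilinZ BB a m m.
have g3 : tau + a *: m = e by rewrite /tau subrK.
rewrite g3 in g1.
have g4 : B x e m = lam * a := eig m.
have g5 : B x tau m = B x m tau := D2C oK h4 tau m Kx.
exact (conormal_value stp a0 f1 f2 f3 f5 f6 g1 g2 g4 g5).
Qed.

Lemma boundary_estimate xs x0 e1 eps alpha m0 b r0 : dot xs xs = 1 -> 0 < eps -> 0 <= alpha ->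
  (forall x X, S x -> dot x X = 0 -> barrier xs eps alpha m0 x * dot X X <= B x X X) ->
  S x0 -> dot e1 e1 = 1 -> dot x0 e1 = 0 -> B x0 e1 e1 = barrier xs eps alpha m0 x0 ->
  0 <= B x0 e1 e1 -> B x0 e1 e1 <= eps * expR (alpha * dot x0 xs) -> 0 < b -> 0 < r0 ->
  (forall X, dot X X = 1 -> B x0 X X <= b) ->
  r0 <= expR (- q * ln (u x0) + (p - 1) * ln (h x0)) -> (1 <= n)%N -> x0 ord0 ord_max = ct ->
  alpha * (xs ord0 ord_max - ct)
    <= n.+1%:R * bound k l (n.+1%:R * b) r0 / low k l (n.+1%:R * b) r0 + 1.
Proof.
move=> xs1 eps0 al0 touch Sx0 e11 x0e1 contact lam0 lamphi b0 r00 bB br n1 xm.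
have ph0 : 0 < eps * expR (alpha * dot x0 xs) by rewrite mulr_gt0 // expR_gt0.
have s0 : 0 < n.+1%:R * b by rewrite mulr_gt0.
have Q0 : 0 <= n.+1%:R * bound k l (n.+1%:R * b) r0 / low k l (n.+1%:R * b) r0.
  apply: divr_ge0; last exact: ltW (low_gt0 lk s0 r00).
  apply: mulr_ge0 => //; exact: ltW (bound_gt0 k l s0 r00).
have [em|em] := eqVneq (e1 ord0 ord_max) 0.
  have H1 := conormal_third xs1 al0 touch Sx0 e11 x0e1 contact lam0 lamphi xm.
  have H2 := boundary_tangent_third Sx0 e11 x0e1 xm em.
  have H3 : 0 <= ct * B x0 e1 e1 * (n.+1%:R * bound k l (n.+1%:R * b) r0 / low k l (n.+1%:R * b) r0).
    apply: mulr_ge0; last exact Q0. apply: mulr_ge0; [exact (ltW ct0)|exact lam0].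
  exact (boundary_algebra ph0 lam0 lamphi ct0 ct1 Q0 H1 (le_trans H2 H3)).
have st0 : 0 < 1 - ct ^+ 2.
  by rewrite (_ : 1 - ct ^+ 2 = (1 - ct) * (1 + ct)); [rewrite mulr_gt0 ?subr_gt0 ?addr_gt0|ring].
have [st stp st2] : exists2 st, 0 < st & st ^+ 2 = 1 - ct ^+ 2.
  by exists (Num.sqrt (1 - ct ^+ 2)); rewrite ?sqrtr_gt0 // sqr_sqrtr // ltW.
have eig := contact_eigen touch Sx0 e11 x0e1 contact.
have [m [xm0 m1 Bm Em]] := conormal_reduction Sx0 xm x0e1 e11 stp st2 eig em.
have contact' := etrans Bm contact.
have lam0' : 0 <= B x0 m m by rewrite Bm; exact lam0.
have lamphi' : B x0 m m <= eps * expR (alpha * dot x0 xs) by rewrite Bm; exact lamphi.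
have H1 := conormal_third xs1 al0 touch Sx0 m1 xm0 contact' lam0' lamphi' xm.
have H2 := boundary_conormal_third touch Sx0 m1 xm0
  contact' lam0' b0 r00 bB br n1 xm st2 Em.
exact (boundary_algebra ph0 lam0' lamphi' ct0 ct1 Q0 H1 H2).
Qed.

(** * Constants independent of the weight *)

Lemma third_bound : exists2 C, 0 <= C & forall x X Y Z, S x -> dot X X = 1 -> dot Y Y = 1 -> dot Z Z = 1 ->
  `|'D_X ('D_Y ('D_Z h)) x| <= C.
Proof.
have bd (t : 'I_n.+1 * 'I_n.+1 * 'I_n.+1) : exists M, 0 <= M /\ forall x, S x ->
    `|'D_('e_(t.1.1)) ('D_('e_(t.1.2)) ('D_('e_(t.2)) h)) x| <= M.
  have c x : S x -> {for x, continuous ('D_('e_(t.1.1)) ('D_('e_(t.1.2)) ('D_('e_(t.2)) h)))}.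
    by move=> Sx; exact: (Ck_continuous oK (Ck_D _ (CD2 h4 _ _)) (SK Sx)).
  have [M M0 MM] := bounded_on (@compact_capS R n ct) c.
  by exists M; split.
have [M HM] := choice bd.
pose M0 := \sum_t M t.
have MM t : M t <= M0.
  by rewrite /M0 (bigD1 t) //= lerDl; apply: sumr_ge0 => t' _; exact: (HM t').1.
have M00 : 0 <= M0 by apply: sumr_ge0 => t _; exact: (HM t).1.
exists (n.+1%:R * (n.+1%:R * (n.+1%:R * M0))); first by rewrite !mulr_ge0.
move=> x X Y Z Sx X1 Y1 Z1; have Kx := SK Sx.
apply: (derive_coords_le (Ck_differentiable (CD2 h4 Y Z) Kx) X1) => i.
rewrite (D3C12 oK h4 'e_i Y Z Kx).
apply: (derive_coords_le (Ck_differentiable (CD2 h4 'e_i Z) Kx) Y1) => j.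
rewrite (etrans (D3C23 oK h4 'e_j 'e_i Z Kx) (D3C12 oK h4 'e_j Z 'e_i Kx)).
apply: (derive_coords_le (Ck_differentiable (CD2 h4 'e_j 'e_i) Kx) Z1) => m.
exact (le_trans ((HM (m, j, i)).2 x Sx) (MM _)).
Qed.

(** By Euler's relation a second derivative is, up to sign, a third derivative with one radial slot,
    so the same constant serves. *)
Lemma second_bound C x X : (forall x X Y Z, S x -> dot X X = 1 -> dot Y Y = 1 -> dot Z Z = 1 ->
  `|'D_X ('D_Y ('D_Z h)) x| <= C) -> S x -> dot X X = 1 -> B x X X <= C.
Proof.
move=> HC Sx X1; have H := HC x x X X Sx Sx.1 X1 X1.
have [e _] := euler_D2 oK KZ h4 hZ X X (SK Sx).
rewrite e normrN in H; exact (le_trans (ler_norm _) H).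
Qed.

Lemma ratio_bound : exists2 r0, 0 < r0 & forall x, S x -> r0 <= expR (- q * ln (u x) + (p - 1) * ln (h x)).
Proof.
have lc (F : V -> R) m x : Ck m K F -> (forall y, S y -> 0 < F y) -> S x -> {for x, continuous (fun y => ln (F y))}.
  move=> Fm F0 Sx; apply: (@continuous_comp _ _ _ F (@ln R)); first exact: (Ck_continuous oK Fm (SK Sx)).
  exact: continuous_ln (F0 _ Sx).
have c x : S x -> {for x, continuous (fun y => - q * ln (u y) + (p - 1) * ln (h y))}.
  move=> Sx; have cu := lc u 2 x u2 u0 Sx; have ch := lc h 4 x h4 h0 Sx.
  exact (@continuous_lin _ _ (- q) (p - 1) _ _ _ cu ch).
have [M _ MM] := bounded_on (@compact_capS R n ct) c.
exists (expR (- M)); first exact: expR_gt0.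
move=> x Sx; rewrite ler_expR; have := MM x Sx; rewrite ler_norml => /andP[]; done.
Qed.

(** The length, written as the extension of the constant 1 so that its Hessian comes from
    [derive2_hom_unit]. *)
Local Notation L := (@hom R n 0 (fun=> 1)).

Lemma jet_len x X : S x -> jet (fun t => L (x + t *: X)) 1 (dot x X) ('D_X ('D_X L) x / 2).
Proof.
move=> [x1 _].
have C2 : Ck 2 (@cone R n 0 setT) L := Ck_hom 0 openT (Ck_cst 2 setT (1 : R)).
have Kx : cone 0 setT x by split=> //; exact: unit_neq0.
apply: jet_eq (jet_line X (open_cone openT) C2 Kx) _ _ (erefl _); first by rewrite hom_unit.
have e := derive_hom_unit (c := 0) X openT (Ck_cst 1 setT (1 : R)) x1 I.
by rewrite e !derive_cst subr0 mulr1 add0r.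
Qed.

Lemma hess_len x X : S x -> dot x X = 0 -> 'D_X ('D_X L) x = dot X X.
Proof.
move=> [x1 _] xX.
have e := derive2_hom_unit (c := 0) openT (Ck_cst 2 setT (1 : R)) x1 I xX xX.
have z : 'D_X (cst (1 : R)) = cst 0 :> (V -> R) by apply: funext => y; exact: derive_cst.
by apply: etrans e _; rewrite z !derive_cst mul0r subr0 mul1r add0r.
Qed.

Lemma len_cone (r : R) y : 0 < r -> S y -> L (r *: y) = r.
Proof. by move=> r0 [y1 _]; rewrite homZ // hom_unit // mulr1. Qed.

Section Minimum.
Variable xs : V.
Hypotheses (Sxs : S xs) (hmin : forall x, S x -> h xs <= h x).

Let h_ge (r : R) y : 0 < r -> S y -> h xs * L (r *: y) <= h (r *: y).
Proof.
move=> r0 Sy; rewrite len_cone // hZ //; last exact: SK.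
by rewrite mulrC ler_pM2l //; exact: hmin.
Qed.

Let jL X : jet (fun t => h xs * L (xs + t *: X)) (h xs) (h xs * dot xs X) (h xs * ('D_X ('D_X L) xs / 2)).
Proof. exact: jet_eq (jetZ (h xs) (jet_len X Sxs)) (mulr1 _) (erefl _) (erefl _). Qed.

Let jh X := jet_line X oK (Ck_le oK (isT : (2 <= 4)%N) h4) (SK Sxs).

(** On the cone [h] stays above [h xs] times the length. At the rim the latter has the positive
    slope [h xs * ct] along [E], whereas ['D_E h] vanishes. *)
Lemma min_interior : ct < xs ord0 ord_max.
Proof.
have [_] := Sxs; rewrite le_eqVlt => /orP[/eqP xm|//].
have c : \forall t \near (0 : R)^'+, h xs * L (xs + t *: E) <= h (xs + t *: E).
  apply: filterS (nbhs_right_gt (0 : R)) => t t0.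
  by have [r [y [r0 Sy ->]]] := line_boundary Sxs (esym xm) t0; exact: h_ge.
have := jet_le_right (jL E) (jh E) c.
by rewrite (hbd Sxs (esym xm)) dot_Elast -xm leNgt mulr_gt0 // h0.
Qed.

Lemma min_hess X : dot xs X = 0 -> h xs * dot X X <= B xs X X.
Proof.
move=> xX.
have c : \forall t \near (0 : R), h xs * L (xs + t *: X) <= h (xs + t *: X).
  apply: filterS (near_line_interior X Sxs min_interior) => t [r [y [r0 Sy ->]]].
  exact: h_ge.
have [_ H] := jet_le (jL X) (jh X) c.
rewrite (hess_len Sxs xX) in H.
have two : (0 : R) < 2^-1 by rewrite invr_gt0.
by rewrite -(ler_pM2r two) -mulrA; exact H.
Qed.

End Minimum.

(** The Hessian form in coordinates, where its joint continuity in point and vector is visible. *)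
Definition quadform (z : V * V) : R :=
  \sum_i z.2 ord0 i * \sum_j z.2 ord0 j * 'D_('e_j) ('D_('e_i) h) z.1.

Lemma quadformE z : K z.1 -> quadform z = B z.1 z.2 z.2.
Proof.
move=> Kz; have h2 : Ck 2 K h := Ck_le oK (isT : (2 <= 4)%N) h4.
have e1 := derive_coords z.2 (Ck_differentiable (Ck_D z.2 h2) Kz).
have e2 : (fun i => z.2 ord0 i * 'D_('e_i) ('D_(z.2) h) z.1)
  = (fun i => z.2 ord0 i * \sum_j z.2 ord0 j * 'D_('e_j) ('D_('e_i) h) z.1).
  apply: funext => i.
  have f := etrans (D2C oK h4 'e_i z.2 Kz) (derive_coords z.2 (Ck_differentiable (Ck_D 'e_i h2) Kz)).
  exact (f_equal (fun r => z.2 ord0 i * r) f).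
exact (esym (etrans e1 (f_equal (fun f : 'I_n.+1 -> R => \sum_i f i) e2))).
Qed.

Lemma continuous_quadform z : K z.1 -> {for z, continuous quadform}.
Proof.
move=> Kz; apply: continuous_sum_at => i; apply: continuous_mul; first exact: continuous_coord2.
apply: continuous_sum_at => j; apply: continuous_mul; first exact: continuous_coord2.
apply: (@continuous_comp _ _ _ fst ('D_('e_j) ('D_('e_i) h))); first exact: cvg_fst.
exact: (Ck_continuous oK (CD2 h4 'e_j 'e_i) Kz).
Qed.

Lemma continuous_fst_dot xs (z : V * V) : {for z, continuous (fun z : V * V => dot z.1 xs)}.
Proof.
by apply: (@continuous_comp _ _ _ fst (fun x : V => dot x xs)); [exact: cvg_fst|exact: continuous_dotl].
Qed.

(** In [(1 - s) * (1 + s)] the second factor is at least [2 * ct ^+ 2], since both points have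
    height at least [ct]: the cap stays away from antipodal pairs. *)
Lemma capS_gap x y : S x -> S y -> 2 * ct ^+ 2 * (1 - dot x y) <= 1 - dot x y ^+ 2.
Proof.
move=> [x1 xm] [y1 ym].
have := cauchy_schwarz (x + y) E.
rewrite dot_Elast2 mulr1 !(dotDl, dotDr) (dotC y x) x1 y1 !dot_Elast => H.
have D1 : dot x y <= 1 := le_trans (ler_norm _) (unit_dot_le1 x1 y1).
exact (gap_algebra ct0 xm ym D1 H).
Qed.

Hypothesis n1 : (1 <= n)%N.

(* [|y| + y] vanishes exactly for [y <= 0], so the minimum of the function below
   is positive as soon as no flag has both [B <= h xs / 2] and [x = xs]. *)
Lemma degenerate_gap xs : S xs -> (forall x, S x -> h xs <= h x) -> @flags R n ct !=set0 ->
  exists2 kap, 0 < kap &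
    forall z, flags ct z -> B z.1 z.2 z.2 <= h xs / 2 -> kap <= 1 - dot z.1 xs.
Proof.
move=> Sxs hmin F0.
pose g z := `|quadform z - h xs / 2| + (quadform z - h xs / 2) + (1 - dot z.1 xs).
have gc z : flags ct z -> {for z, continuous g}.
  move=> [Sz _]; have c1 : {for z, continuous (fun z => quadform z - h xs / 2)}.
    by apply: cvgB; [exact: continuous_quadform (SK Sz)|exact: cst_continuous].
  have c2 : {for z, continuous (fun z : V * V => 1 - dot z.1 xs)}.
    by apply: cvgB; [exact: cst_continuous|exact: continuous_fst_dot].
  apply: cvgD; last exact: c2.
  by apply: cvgD; [apply: cvg_norm; exact: c1|exact: c1].
have [z0 Fz0 zmin] := min_on (@compact_flags R n ct) F0 gc.
have Dz z : flags ct z -> dot z.1 xs <= 1.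
  by move=> [[z1 _] _]; exact: le_trans (ler_norm _) (unit_dot_le1 z1 Sxs.1).
exists (g z0); last first.
  move=> z Fz; rewrite -quadformE; last by case: Fz => /SK.
  move=> Qz; apply: le_trans (zmin z Fz) _; rewrite /g ler0_norm; last by rewrite subr_le0.
  by rewrite addNr add0r.
rewrite ltNge; apply/negP => g0.
have N1 : 0 <= `|quadform z0 - h xs / 2| + (quadform z0 - h xs / 2).
  by rewrite -lerBlDr sub0r -normrN ler_norm.
have D1 := Dz _ Fz0.
have D0 : dot z0.1 xs = 1 by apply/eqP; rewrite eq_le D1 /=; move: g0; rewrite /g; lra.
have [[z1 zm] [z2 zz]] := Fz0.
have zx : z0.1 = xs.
  apply/eqP; rewrite -subr_eq0 -dot_eq0 !(dotDl, dotDr, dotNl, dotNr) (dotC xs) D0 z1 Sxs.1.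
  by apply/eqP; ring.
have Q : h xs <= quadform z0.
  have KK : K z0.1 by apply: SK; split.
  have H := min_hess Sxs hmin (X := z0.2).
  rewrite quadformE // zx -[h xs]mulr1 -z2; apply: H; rewrite -zx; exact: zz.
have h1 := h0 Sxs.
have P : 0 <= quadform z0 - h xs / 2 by lra.
by move: g0; rewrite /g (ger0_norm P); lra.
Qed.

Lemma flat_convexity x X : S x -> dot x X = 0 -> X != 0 -> 0 < B x X X.
Proof.
move=> Sx xX X0; rewrite ltNge; apply/negP => BX.
have len0 := len_gt0 X0.
have l2 : dot X X = len X ^+ 2.
  by rewrite /len powR12_sqrt ?dot_ge0 // sqr_sqrtr // dot_ge0.
have [Y [Y1 xY BY]] : exists Y, [/\ dot Y Y = 1, dot x Y = 0 & B x Y Y <= 0].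
  exists ((len X)^-1 *: X); split.
  - by rewrite dotZl dotZr l2; field; rewrite gt_eqF.
  - by rewrite dotZr xX mulr0.
  - have BB := D2_bilin oK h4 (SK Sx).
    have e := etrans (bilinZ BB (len X)^-1 X ((len X)^-1 *: X))
      (f_equal ( *%R (len X)^-1) (etrans (BB.1 X ((len X)^-1 *: X)) (bilinZ BB (len X)^-1 X X))).
    have i0 : 0 <= (len X)^-1 by rewrite invr_ge0 ltW.
    have e2 : B x ((len X)^-1 *: X) ((len X)^-1 *: X) = (len X)^-1 * ((len X)^-1 * B x X X) := e.
    rewrite e2; apply: mulr_ge0_le0 => //; exact: mulr_ge0_le0.
have Fz1 : flags ct (x, Y) by [].
have {BX BY} QY : quadform (x, Y) <= 0.
  have e : quadform (x, Y) = B x Y Y := quadformE (z := (x, Y)) (SK Sx).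
  rewrite e; exact BY.
have [xs Sxs hmin] : exists2 xs, S xs & forall y, S y -> h xs <= h y.
  apply: (min_on (@compact_capS R n ct)); first by exists x.
  by move=> y Sy; exact: (Ck_continuous oK h4 (SK Sy)).
have F0 : @flags R n ct !=set0 by exists (x, Y).
have [kap kap0 Hkap] := degenerate_gap Sxs hmin F0.
have [C C0 HC] := third_bound.
have [r0 r00 Hr] := ratio_bound.
(* Second derivatives are bounded by [C]; the added 1 makes the bound positive even if [C = 0]. *)
pose b := C + 1.
have b0 : 0 < b := ltr_wpDl C0 ltr01.
pose s := n.+1%:R * b; pose G := bound k l s r0; pose lo := low k l s r0.
have s0 : 0 < s by rewrite mulr_gt0.
have G0 : 0 < G := bound_gt0 k l s0 r00.
have lo0 : 0 < lo := low_gt0 lk s0 r00.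
have hm0 := h0 Sxs.
have P0 : 0 <= p - 1 by rewrite subr_ge0.
have c30 : 0 < xs ord0 ord_max - ct by rewrite subr_gt0; exact: min_interior Sxs hmin.
(* The order of choices matters: [kap], [C] and [r0] are fixed before the weight. [Hal1] will refute
   an interior contact and [Hal2] one at the boundary. *)
have [al [al0 Hal1 Hal2]] := parameter_choice (ler0n R n.+1) C0 G0 lo0 P0 hm0 ct0 kap0 c30.
(* The exponential factor keeps the weight below [h xs / 2] on the whole cap, however large [al]
   is. *)
pose eps := h xs / 2 * expR (- al).
have eps0 : 0 < eps by rewrite /eps mulr_gt0 ?expR_gt0 // divr_gt0.
pose phi y := eps * expR (al * dot y xs).
have phi_le y : S y -> phi y <= h xs / 2.
  move=> [y1 _]; exact (barrier_le_half al0 hm0 (le_trans (ler_norm _) (unit_dot_le1 y1 Sxs.1))).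
pose g z := quadform z - phi z.1.
have gc z : flags ct z -> {for z, continuous g}.
  move=> [Sz _].
  have c1 : {for z, continuous (fun z : V * V => al * dot z.1 xs)}.
    by apply: continuous_mul; [exact: cst_continuous|exact: continuous_fst_dot].
  have c2 : {for z, continuous (fun z : V * V => expR (al * dot z.1 xs))}.
    by apply: (@continuous_comp _ _ _ _ (@expR R) z c1); exact: continuous_expR.
  have c3 : {for z, continuous (fun z : V * V => eps * expR (al * dot z.1 xs))}.
    by apply: continuous_mul; [exact: cst_continuous|exact: c2].
  by apply: cvgB; [exact: continuous_quadform (SK Sz)|exact: c3].
have [z0 Fz0 zmin] := min_on (@compact_flags R n ct) F0 gc.
have gE z : flags ct z -> g z = B z.1 z.2 z.2 - phi z.1 by move=> [Sz _]; rewrite /g quadformE //; exact: SK.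
(* The degenerate flag [(x, Y)] makes the minimum negative, so the barrier lies strictly below the
   weight; this yields [lam <= phi] at the contact. *)
pose m0 := - g z0.
have m00 : 0 < m0.
  have ph1 : 0 < phi x := mulr_gt0 eps0 (expR_gt0 _).
  have H2 : g z0 <= quadform (x, Y) - phi x := zmin _ Fz1.
  rewrite /m0 oppr_gt0; apply: le_lt_trans H2 _; rewrite subr_lt0; exact: le_lt_trans QY ph1.
have touch y Z : S y -> dot y Z = 0 -> barrier xs eps al m0 y * dot Z Z <= B y Z Z.
  move=> Sy yZ; have [->|Z0] := eqVneq Z 0.
    rewrite dot0r mulr0; apply: hpsd Sy (dot0r y).
  have lZ := len_gt0 Z0.
  have l2Z : dot Z Z = len Z ^+ 2.
    by rewrite /len powR12_sqrt ?dot_ge0 // sqr_sqrtr // dot_ge0.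
  have Fz : flags ct (y, (len Z)^-1 *: Z).
    split=> //=; split; last by rewrite dotZr yZ mulr0.
    by rewrite dotZl dotZr l2Z; field; rewrite gt_eqF.
  have H := zmin _ Fz; rewrite (gE _ Fz) in H.
  have BB := D2_bilin oK h4 (SK Sy).
  have e : B y ((len Z)^-1 *: Z) ((len Z)^-1 *: Z) = (len Z)^-1 * ((len Z)^-1 * B y Z Z) :=
    etrans (bilinZ BB (len Z)^-1 Z ((len Z)^-1 *: Z))
      (f_equal ( *%R (len Z)^-1) (etrans (BB.1 Z ((len Z)^-1 *: Z)) (bilinZ BB (len Z)^-1 Z Z))).
  exact (touch_algebra lZ l2Z e H).
have [Sx0 [e11 x0e1]] := Fz0.
have g0E := gE _ Fz0.
have contact : B z0.1 z0.2 z0.2 = barrier xs eps al m0 z0.1.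
  exact (contact_value g0E).
have lam0 := hpsd Sx0 x0e1.
have lamphi : B z0.1 z0.2 z0.2 <= phi z0.1.
  rewrite contact /barrier gerBl; exact (ltW m00).
have bB Z : dot Z Z = 1 -> B z0.1 Z Z <= b.
  move=> Z1; apply: le_trans (second_bound HC Sx0 Z1) _; rewrite /b lerDl; exact ler01.
have bC Z1 Z2 Z3 : dot Z1 Z1 = 1 -> dot Z2 Z2 = 1 -> dot Z3 Z3 = 1 -> `|'D_Z1 ('D_Z2 ('D_Z3 h)) z0.1| <= C.
  exact: HC Sx0.
have br := Hr _ Sx0.
have [_] := Sx0; rewrite le_eqVlt => /orP[/eqP xm|xm].
  have H := boundary_estimate Sxs.1 eps0 al0 touch Sx0 e11 x0e1 contact lam0 lamphi b0 r00 bB br n1 (esym xm).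
  exact (elimF idP (ltxx _) (lt_le_trans Hal2 H)).
have H := interior_estimate Sxs.1 eps0 al0 touch Sx0 e11 x0e1
  contact lam0 lamphi b0 C0 r00 bB bC br n1 xm.
have kz := Hkap _ Fz0 (le_trans lamphi (phi_le _ Sx0)).
exact (interior_contradiction hm0 (hmin _ Sx0) P0 lo0 ct0 (capS_gap Sx0 Sxs) kz Hal1 H).
Qed.

End Flat.

(** * The capillary problem *)

Lemma derive_powR (R : realType) n (F : 'rV[R]_n.+1 -> R) (a : R) x X : differentiable F x -> 0 < F x ->
  'D_X (fun y => F y `^ a) x = a * F x `^ (a - 1) * 'D_X F x.
Proof.
move=> Fd p0; have [ed ev] := is_derive1_powR a p0.
have pd : differentiable (fun y : R => y `^ a) (F x) by exact/derivable1_diffP.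
rewrite deriveE; last by apply: (@differentiable_comp _ _ _ _ F (fun y : R => y `^ a)).
rewrite (@diff_comp _ _ _ _ F (fun y : R => y `^ a)) //=.
rewrite -(deriveE _ Fd) deriv1E // derive1E ev /GRing.scale /=.
by ring.
Qed.

(** With [e] the derivative along [E] of the extension, [e] is [- sn] times the Robin defect
    [Dm - ct / sn * Hx]. *)
Lemma robin_flat (R : realType) (sn ct DE Dx Dm Hx e : R) : 0 < sn ->
  Dm = sn^-1 * (ct * Dx - DE) -> Dm = ct / sn * Hx -> e = DE + ct * (Hx - Dx) -> e = 0.
Proof.
move=> s0 -> H ->; have {}H : ct * Dx - DE = ct * Hx.
  by rewrite -[LHS](mulVKf (lt0r_neq0 s0)) H; field; rewrite gt_eqF.
by rewrite mulrBr -H; ring.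
Qed.

(** By the chain rule the same combination for the power [- a^-1] of [F] is a nonnegative multiple
    of [Dm + ct / sn * a * Fx]; this is where the factor [a] of the boundary hypothesis comes
    from. *)
Lemma robin_power (R : realType) (sn ct DE Dx Dm Fx a P Q e : R) : 0 < sn -> 0 < a -> 0 <= P ->
  Dm = sn^-1 * (ct * Dx - DE) -> 0 <= Dm + ct / sn * a * Fx -> Q = P * Fx ->
  e = - a^-1 * P * DE + ct * (Q - - a^-1 * P * Dx) -> 0 <= e.
Proof.
move=> s0 a0 P0 -> H -> ->.
have -> : - a^-1 * P * DE + ct * (P * Fx - - a^-1 * P * Dx)
  = a^-1 * P * sn * (sn^-1 * (ct * Dx - DE) + ct / sn * a * Fx).
  by field; rewrite !gt_eqF.
apply: mulr_ge0 => //; apply: mulr_ge0; last exact: ltW.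
by apply: mulr_ge0 => //; rewrite invr_ge0 ltW.
Qed.

Lemma log_equation (R : realType) (sk sl Fx Hx P a : R) : 0 < sk -> 0 < sl -> 0 < Fx -> a != 0 ->
  sk / sl = Fx * Hx `^ P -> 0 < Hx ->
  ln sk - ln sl = - a * ln (Fx `^ (- a^-1)) + P * ln Hx.
Proof.
move=> k0 l0 F0 a0 e H0; rewrite -ln_div ?posrE // e lnM ?posrE ?powR_gt0 // !ln_powR.
by congr (_ + _); field.
Qed.

Section Capillary.
Variables (R : realType) (n k l : nat) (theta p : R) (Uf Uh : set 'rV[R]_n.+1) (F H : 'rV[R]_n.+1 -> R).
Local Notation V := 'rV[R]_n.+1.
Local Notation E := (Elast R n).
Local Notation ct := (cos theta).
Local Notation c := (capc n theta).
Local Notation S := (capS (n := n) ct).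
Local Notation a := (p + k%:R - l%:R - 1).
Hypotheses (n2 : (2 <= n)%N) (lk : (l < k)%N) (theta0 : 0 < theta) (theta1 : theta < pi / 2) (p1 : 1 <= p).
Hypotheses (oUf : open Uf) (capUf : cap theta `<=` Uf) (sF : smooth_on Uf F).
Hypothesis F0 : forall xi, cap theta xi -> 0 < F xi.
Hypothesis Fpsd : forall xi X, cap theta xi -> tangent theta xi X ->
  0 <= Wform theta (fun x => F x `^ (- a^-1)) xi X X.
Hypothesis Fbd : forall xi, bcap theta xi ->
  0 <= 'D_(mu theta xi) F xi + cos theta / sin theta * a * F xi.
Hypotheses (oUh : open Uh) (capUh : cap theta `<=` Uh) (H4 : Ck 4 Uh H).
Hypothesis H0 : forall xi, cap theta xi -> 0 < H xi.
Hypothesis Heq : forall xi lam, cap theta xi -> eigs theta (Wform theta H xi) xi lam ->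
  Gamma k lam /\ sigma k lam / sigma l lam = F xi * H xi `^ (p - 1).
Hypothesis Hbd : forall xi, bcap theta xi -> 'D_(mu theta xi) H xi = cos theta / sin theta * H xi.
Hypothesis Hpsd : forall xi X, cap theta xi -> tangent theta xi X -> 0 <= Wform theta H xi X X.

Let sn0 : 0 < sin theta.
Proof. by apply: sin_gt0_pi; rewrite theta0 /=; have := theta1; have := pi_gt0 R; lra. Qed.
Let ct0 : 0 < ct.
Proof. by apply: cos_gt0_pihalf; rewrite theta1 andbT; have := theta0; have := pi_gt0 R; lra. Qed.
Let ct1 : ct < 1.
Proof.
rewrite -(@ltr_pXn2r _ 2) ?nnegrE ?(ltW ct0) // expr1n -(cos2Dsin2 theta) ltrDl.
by rewrite exprn_gt0.
Qed.
Let aE : a = p - 1 + (k - l)%:R.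
Proof. by rewrite natrB; [ring|exact: ltnW]. Qed.
Let a0 : 0 < a.
Proof. by rewrite aE; apply: ltr_wpDl; rewrite ?subr_ge0 // ltr0n subn_gt0. Qed.

Lemma cap_capS x : S x -> cap theta (x + c).
Proof.
move=> [x1 xm]; split; last by rewrite addrK.
by rewrite !mxE eqxx mulr1 subr_ge0.
Qed.

Lemma capS_nu xi : cap theta xi -> S (nu theta xi).
Proof.
by move=> [xm x1]; split=> //; rewrite /nu /capc opprK !mxE eqxx mulr1 lerDr.
Qed.

Lemma bcap_capS x : S x -> x ord0 ord_max = ct -> bcap theta (x + c).
Proof. by move=> Sx xm; split; [exact: cap_capS|rewrite !mxE eqxx mulr1 xm subrr]. Qed.

Lemma nu_capc x : nu theta (x + c) = x. Proof. exact: addrK. Qed.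

Let G x := F x `^ (- a^-1).
(** Positivity of [F] is known only on the cap; on this smaller open set the real power of [F] is
    smooth as well. *)
Let Uf' := Uf `&` [set x | 0 < F x].
Let oU' : open Uf'.
Proof.
rewrite openE => x [Ux Fx]; apply: filterI; first exact: open_nbhs_nbhs.
exact: (cvgr_gt _ (Ck_continuous oUf (sF 0) Ux)).
Qed.
Let sF' m : Ck m Uf' F. Proof. exact: Ck_subset oUf oU' (@subIsetl _ _ _) (sF m). Qed.
Let G2 : Ck 2 Uf' G. Proof. by apply: (Ck_powR _ oU') => // x []. Qed.
Let U'cap : cap theta `<=` Uf'. Proof. by move=> x xc; split; [exact: capUf|exact: F0]. Qed.

Let K := cone c Uh `&` cone c Uf'.
Let h := hom c H.
Let u := hom c G.
Let oKh : open (cone c Uh). Proof. exact: open_cone. Qed.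
Let oKu : open (cone c Uf'). Proof. exact: open_cone. Qed.
Let oK : open K. Proof. exact: openI. Qed.
Let KZ (r : R) x : 0 < r -> K x -> K (r *: x).
Proof. by move=> r0 [K1 K2]; split; exact: coneZ. Qed.
Let h4 : Ck 4 K h. Proof. exact: Ck_subset oKh oK (@subIsetl _ _ _) (Ck_hom c oUh H4). Qed.
Let u2 : Ck 2 K u. Proof. exact: Ck_subset oKu oK (@subIsetr _ _ _) (Ck_hom c oU' G2). Qed.
Let hZ (r : R) x : 0 < r -> K x -> h (r *: x) = r * h x. Proof. by move=> r0 _; exact: homZ. Qed.
Let uZ (r : R) x : 0 < r -> K x -> u (r *: x) = r * u x. Proof. by move=> r0 _; exact: homZ. Qed.
Let SK : S `<=` K.
Proof.
move=> x Sx; have [x1 _] := Sx; have xc := cap_capS Sx.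
by split; split; rewrite ?proj_unit //; [exact: unit_neq0|exact: capUh|exact: unit_neq0|exact: U'cap].
Qed.
Let h0 x : S x -> 0 < h x.
Proof. by move=> Sx; rewrite /h hom_unit ?Sx.1 //; apply: H0; exact: cap_capS. Qed.
Let u0 x : S x -> 0 < u x.
Proof. by move=> Sx; rewrite /u hom_unit ?Sx.1 //; apply: powR_gt0; apply: F0; exact: cap_capS. Qed.

Lemma Wform_hom x X Y : S x -> dot x X = 0 -> dot x Y = 0 ->
  'D_X ('D_Y h) x = Wform theta H (x + c) X Y.
Proof.
move=> Sx xX xY; rewrite /Wform nu_capc.
exact: (derive2_hom_unit oUh (Ck_le oUh (isT : (2 <= 4)%N) H4) Sx.1 (capUh (cap_capS Sx)) xX xY).
Qed.

Let hpsd x X : S x -> dot x X = 0 -> 0 <= 'D_X ('D_X h) x.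
Proof.
move=> Sx xX; rewrite Wform_hom //; apply: Hpsd; first exact: cap_capS.
by rewrite /tangent nu_capc dotC.
Qed.
Let upsd x X : S x -> dot x X = 0 -> 0 <= 'D_X ('D_X u) x.
Proof.
move=> Sx xX; have Xt : tangent theta (x + c) X by rewrite /tangent nu_capc dotC.
have := Fpsd (cap_capS Sx) Xt; rewrite /Wform nu_capc.
by rewrite -(derive2_hom_unit oU' G2 Sx.1 (U'cap (cap_capS Sx)) xX xX).
Qed.

Let derive_mu J U x : open U -> Ck 1 U J -> U (x + c) ->
  'D_(mu theta (x + c)) J (x + c) = (sin theta)^-1 * (ct * 'D_x J (x + c) - 'D_E J (x + c)).
Proof.
move=> oU J1 Ux; have Jd := J1.1 _ Ux.
by rewrite /mu nu_capc deriveZdir // deriveBdir // deriveZdir.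
Qed.

Let hbd x : S x -> x ord0 ord_max = ct -> 'D_E h x = 0.
Proof.
move=> Sx xm; have xb := bcap_capS Sx xm; have H1 := Ck_le oUh (isT : (1 <= 4)%N) H4.
have Ux := capUh (cap_capS Sx).
have e := derive_hom_unit E oUh H1 Sx.1 Ux; rewrite dot_Elast xm in e.
exact (robin_flat sn0 (derive_mu oUh H1 Ux) (Hbd xb) e).
Qed.

Let ubd x : S x -> x ord0 ord_max = ct -> 0 <= 'D_E u x.
Proof.
move=> Sx xm; have xb := bcap_capS Sx xm; have Ux := U'cap (cap_capS Sx).
have G1 := Ck_le oU' (isT : (1 <= 2)%N) G2.
have e := derive_hom_unit E oU' G1 Sx.1 Ux; rewrite dot_Elast xm in e.
have Fd := (sF' 1).1 _ Ux; have Fx := F0 (cap_capS Sx).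
rewrite !(derive_powR _ _ Fd Fx) in e.
have P0 : 0 <= F (x + c) `^ (- a^-1 - 1) by exact: powR_ge0.
have Q : G (x + c) = F (x + c) `^ (- a^-1 - 1) * F (x + c).
  have -> : F (x + c) `^ (- a^-1 - 1) * F (x + c) = F (x + c) `^ (- a^-1 - 1) * F (x + c) `^ 1.
    by rewrite powRr1 // ltW.
  rewrite -powRD ?subrK //; apply/implyP => _; exact: lt0r_neq0.
exact (robin_power sn0 a0 P0 (derive_mu oU' (sF' 1) Ux) (Fbd xb) Q e).
Qed.

(** The point completes a tangent eigenframe to an ambient one and has eigenvalue 0, so the ambient
    symmetric functions are those of the [n] tangential eigenvalues. *)
Let heq x (v : 'I_n.+1 -> V) : S x -> onb v ->
  [/\ 0 < esp (\matrix_(i, j) 'D_(v i) ('D_(v j) h) x) k, 0 < esp (\matrix_(i, j) 'D_(v i) ('D_(v j) h) x) l &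
    ln (esp (\matrix_(i, j) 'D_(v i) ('D_(v j) h) x) k) - ln (esp (\matrix_(i, j) 'D_(v i) ('D_(v j) h) x) l)
    = - (p - 1 + (k - l)%:R) * ln (u x) + (p - 1) * ln (h x)].
Proof.
move=> Sx vo; have Kx := SK Sx; have [x1 _] := Sx; have xc := cap_capS Sx.
have xx Y : 'D_x ('D_Y h) x = 0 := euler_D1 oK KZ h4 hZ Y Kx.
have v1 i j : (i < 1)%N -> (j < 1)%N -> dot ((fun=> x) i) ((fun=> x) j) = (i == j)%:R.
  by case: i => // _; case: j => // _; rewrite x1.
have ve i : (i < 1)%N -> exists b, forall Y, 'D_x ('D_Y h) x = b * dot x Y.
  by move=> _; exists 0 => Y; rewrite mul0r; exact: (xx Y).
have [w [wo wv we]] := eigenframe oK h4 (v := fun=> x) Kx (isT : (1 <= n.+1)%N) v1 ve.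
have w0 : w ord0 = x by rewrite wv.
pose b i := 'D_(w i) ('D_(w i) h) x.
pose Fr i := w (lift ord0 i); pose lam i := b (lift ord0 i).
have xF i : dot x (Fr i) = 0 by rewrite -w0 wo.
have b0 : b ord0 = 0 by rewrite /b w0; exact: (xx x).
have Ee : eigs theta (Wform theta H (x + c)) (x + c) lam.
  exists Fr; split; first split.
  - by move=> i; rewrite /tangent nu_capc dotC xF.
  - by move=> i j; rewrite wo (inj_eq lift_inj); case: eqP.
  - have m i j : (\matrix_(i < n, j < n) Wform theta H (x + c) (Fr i) (Fr j)) i j = if i == j then lam i else 0.
      rewrite mxE -(Wform_hom Sx (xF i) (xF j)).
      apply: etrans (we _ _) _; rewrite wo (inj_eq lift_inj).
      by case: eqP => _; rewrite ?mulr1 ?mulr0.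
    rewrite char_poly_trig; first by apply: eq_bigr => i _; rewrite m eqxx.
    by apply/is_trig_mxP => i j ij; rewrite m ifF //; apply/eqP => e; rewrite e ltnn in ij.
have [Gk e] := Heq xc Ee.
have ge0 i : 0 <= b i.
  have [->|i0] := eqVneq i ord0; first by rewrite b0.
  by apply: hpsd Sx _; rewrite -w0 wo eq_sym (negbTE i0).
have sE m : esp (\matrix_(i, j) 'D_(v i) ('D_(v j) h) x) m = sigma m lam.
  by apply: etrans (esp_frame oK h4 m Kx vo wo we) _; rewrite gen_lift0 // coef_gen_sigma.
have sk : 0 < sigma k lam by apply: Gk; rewrite leqnn andbT (leq_ltn_trans _ lk).
(* The order [l] may be 0, which [Gamma] does not cover; for nonnegative eigenvalues positivity at
   order [k] passes to all lower orders. *)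
have sl : 0 < sigma l lam.
  rewrite -coef_gen_sigma; apply: (coef_gen_gt0 (k := k)) (ltnW lk) => [i|]; first exact: ge0.
  by rewrite coef_gen_sigma.
rewrite !sE /u /h !hom_unit //; split=> //.
have Fx := F0 xc; have Hx := H0 xc; have ane := lt0r_neq0 a0.
by rewrite -aE; exact: log_equation sk sl Fx ane e Hx.
Qed.

Lemma strict_convexity xi X : cap theta xi -> tangent theta xi X -> X != 0 -> 0 < Wform theta H xi X X.
Proof.
move=> xc Xt X0; have Sx := capS_nu xc.
have e : nu theta xi + c = xi by exact: subrK.
have xX : dot (nu theta xi) X = 0 by rewrite dotC.
have W := Wform_hom Sx xX xX; rewrite e in W.
rewrite -W; exact (flat_convexity oK KZ h4 hZ u2 uZ SK lk ct0 ct1 p1 h0 u0 hpsd upsd heq hbd ubd (ltnW n2) Sx xX X0).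
Qed.

End Capillary.

Theorem theorem4p1 (R : realType) (n k l : nat) (theta p : R)
  (Uf Uh : set 'rV[R]_(n.+1)) (F H : 'rV[R]_(n.+1) -> R) :
  (2 <= n)%N -> (l < k)%N -> (k <= n.-1)%N ->
  0 < theta -> theta < pi / 2 -> 1 <= p ->
  (* f : positive, smooth up to the boundary (restriction of F) *)
  open Uf -> cap theta `<=` Uf -> smooth_on Uf F ->
  (forall xi, cap theta xi -> 0 < F xi) ->
  (* nabla^2 f^{-1/(p+k-l-1)} + f^{-1/(p+k-l-1)} sigma >= 0 in C_theta *)
  (forall xi X, cap theta xi -> tangent theta xi X ->
     0 <= Wform theta
            (fun x => F x `^ (- (p + k%:R - l%:R - 1)^-1)) xi X X) ->
  (* nabla_mu f + cot theta (p+k-l-1) f >= 0 on the boundary *)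
  (forall xi, bcap theta xi ->
     0 <= 'D_(mu theta xi) F xi
          + cos theta / sin theta * (p + k%:R - l%:R - 1) * F xi) ->
  (* h in C^4 up to the boundary (restriction of H), positive *)
  open Uh -> cap theta `<=` Uh -> Ck 4 Uh H ->
  (forall xi, cap theta xi -> 0 < H xi) ->
  (* admissible solution of sigma_k(W)/sigma_l(W) = f h^{p-1} *)
  (forall xi lam, cap theta xi -> eigs theta (Wform theta H xi) xi lam ->
     Gamma k lam /\ sigma k lam / sigma l lam = F xi * H xi `^ (p - 1)) ->
  (* Robin-type boundary condition nabla_mu h = cot theta h *)
  (forall xi, bcap theta xi ->
     'D_(mu theta xi) H xi = cos theta / sin theta * H xi) ->
  (* W = nabla^2 h + h sigma positive semi-definite *)
  (forall xi X, cap theta xi -> tangent theta xi X ->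
     0 <= Wform theta H xi X X) ->
  (* conclusion: W positive definite *)
  forall xi X, cap theta xi -> tangent theta xi X -> X != 0 ->
    0 < Wform theta H xi X X.
Proof.
move=> n2 lk _ t0 t1 p1 oUf cUf sF F0 Fpsd Fbd oUh cUh H4 H0 Heq Hbd Hpsd xi X xc Xt X0.
exact (strict_convexity n2 lk t0 t1 p1 oUf cUf sF F0 Fpsd Fbd oUh cUh H4 H0 Heq Hbd Hpsd xc Xt X0).
Qed.
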